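(* Let $a\in\mathbb{Z}$, $a\neq-1$, and let the numbers $d^{(a)}_{k,m}$ ($k\ge0$, $m\ge1$) be defined by the expansion $$x\frac{\partial}{\partial x}\Psi^{(a)}_{0,1}(t;x)=\sum_{k\ge0,\,m\ge1}m\,d^{(a)}_{k,m}\log(1-e^{-kt}x^m).$$ Then $$d^{(a)}_{k,m}=\sum_{n\mid(k,m)}\frac{\mu(n)}{n^2}(-1)^{k/n}\frac{\prod_{j=1}^{m/n-1}(ma/n+j+k/n)}{(m/n)\cdot(k/n)!\,(m/n-k/n)!}.$$
   Context: In the formula for $d^{(a)}_{k,m}$: $\mu(n)$ is the M\''obius function, $(k,m)$ is the greatest common divisor (with $(0,m)=m$), empty products equal $1$, and $1/r!=0$ for $r<0$. Notation: $i=\sqrt{-1}$, $q=e^{i\lambda}$, $q^{1/2}=e^{i\lambda/2}$, $Q=-e^{-t}$. $\mathbf p=(p_1,p_2,\dots)$ are commuting formal variables and $p_\eta=\prod_j p_{\eta_j}$. For a partition $\mu$: $|\mu|$ is its size, $l(\mu)$ its length, $\mu^t$ its transpose, $\kappa_\mu=\sum_j\mu_j(\mu_j-2j+1)$, $z_\mu=\prod_{j}j^{m_j(\mu)}m_j(\mu)!$ with $m_j(\mu)$ the multiplicity of $j$ in $\mu$; $\chi_\mu(\eta)$ is the value of the irreducible character of $S_{|\mu|}$ indexed by $\mu$ on the class of cycle type $\eta$ (taken to be $0$ if $|\mu|\ne|\eta|$). $W_{\mu,\nu}(q)$ is the rational function of $q^{1/2}$ given by $W_{\mu,\nu}(q)=s_\mu(q^{\rho})\,s_\nu(q^{\mu+\rho})$,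 where $s$ denotes Schur functions, $q^\rho=(q^{-1/2},q^{-3/2},\dots)$ and $q^{\mu+\rho}=(q^{\mu_j-j+1/2})_{j\ge1}$ (sums convergent for $|q|>1$), and $W_\nu(q)=s_\nu(q^\rho)$. The open string amplitude of the resolved conifold with one outer brane and framing $a$ is $$Z^{(a)}(\lambda;t;\mathbf p)=\sum_{\mu,\nu,\eta}q^{a\kappa_\mu/2}W_{\mu,\nu}(q)\,Q^{|\nu|}\,W_{\nu^t}(q)\,\frac{\chi_\mu(\eta)}{z_\eta\, i^{\,l(\eta)}}\,p_\eta$$ (sum over all partitions, a formal power series in $Q$ and the $p_n$). Put $\hat Z^{(a)}(\lambda;t;\mathbf p)=Z^{(a)}(\lambda;t;\mathbf p)/Z^{(a)}(\lambda;t;0)$ and $F^{(a)}=\log\hat Z^{(a)}$. The one-point function $F^{(a)}_n(\lambda;t)$ is the coefficient of the linear monomial $p_n$ in $F^{(a)}$; it is expanded as $F^{(a)}_n(\lambda;t)=\sum_{g\ge0}\lambda^{2g-1}F^{(a)}_{g;n}(t)$, and $\Psi^{(a)}_{0,1}(t;x)=\sum_{n\ge1}F^{(a)}_{0;n}(t)\,x^n$. *)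

(* Defs.v *)
From HB Require Import structures.
From mathcomp Require Import all_boot all_order all_algebra all_fingroup
  all_solvable all_field all_character.
From Stdlib Require Import ClassicalEpsilon.

Set Implicit Arguments.
Unset Strict Implicit.
Unset Printing Implicit Defensive.

Import Order.TTheory GRing.Theory Num.Theory.
Local Open Scope ring_scope.

(** * Partitions

A partition is the weakly decreasing sequence of its (positive) parts, so that
[sumn mu] is its size, [size mu] its length, and [nth 0 mu j] the part usually
written mu_(j+1). *)

Definition is_partition (mu : seq nat) : bool :=
  sorted geq mu && (0%N \notin mu).

(* All partitions of n; they are found among the decreasing sequences of length
   n with entries at most n, padded with zeros. *)
Definition parts (n : nat) : seq (seq nat) :=
  [seq [seq val i | i <- tval t & val i != 0%N]
     | t <- enum {: n.-tuple 'I_n.+1}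
     & sorted geq [seq val i | i <- tval t] &&
       (sumn [seq val i | i <- tval t] == n)].

Lemma mem_parts n s : (s \in parts n) = is_partition s && (sumn s == n).
Proof.
have sumf (u : seq nat) : sumn [seq x <- u | x != 0%N] = sumn u.
  by elim: u => //= x u IH; case: eqP => [->|] /=; rewrite IH.
have mf (u : seq 'I_n.+1) :
    [seq val i | i <- u & val i != 0%N] = [seq x <- map val u | x != 0%N].
  by rewrite filter_map.
have geq_tr : transitive geq by move=> a b c /= h1 h2; exact: leq_trans h2 h1.
apply/mapP/idP.
  case=> t; rewrite mem_filter => /andP[/andP[so /eqP su] _] ->.
  rewrite mf sumf su eqxx andbT /is_partition sorted_filter //=.
  by rewrite mem_filter eqxx.
move=> /andP[/andP[so n0] /eqP su].
have len : (size s <= n)%N.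
  rewrite -su; elim: s n0 {so su} => //= x s IH.
  rewrite inE negb_or => /andP[x0 /IH h].
  by rewrite -add1n leq_add // lt0n eq_sym.
have le x : x \in s -> (x < n.+1)%N.
  rewrite -su ltnS; elim: s {so su n0 len} => //= y s IH.
  rewrite inE => /orP[/eqP->|/IH h]; first exact: leq_addr.
  exact: leq_trans h (leq_addl _ _).
pose u := [seq inord x : 'I_n.+1 | x <- s ++ nseq (n - size s) 0%N].
have su' : size u == n by rewrite size_map size_cat size_nseq subnKC.
have vu : map val u = s ++ nseq (n - size s) 0%N.
  rewrite -map_comp -[RHS]map_id; apply/eq_in_map => x /=.
  rewrite mem_cat => /orP[/le h|]; first by rewrite inordK.
  by rewrite mem_nseq => /andP[_ /eqP->]; rewrite inordK.
exists (Tuple su') => /=.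
  rewrite mem_filter mem_enum andbT /= vu sumn_cat sumn_nseq mul0n addn0 su eqxx andbT.
  case: s {u su' vu n0 su le len} so => [_|x s so] /=.
    by elim: (n - 0)%N => //= k; case: k => //.
  rewrite cat_path (so : path geq x s) /=.
  by elim: (n - _)%N (last x s) => //= k IH y; rewrite IH.
rewrite mf vu filter_cat.
have -> : [seq x <- nseq (n - size s) 0%N | x != 0%N] = [::].
  by elim: (n - _)%N.
rewrite cats0; apply/esym/all_filterP/allP => x xs; apply: contraNneq n0 => <- //.
Qed.

Definition conj_part (mu : seq nat) : seq nat :=
  [seq count (fun p => j < p)%N mu | j <- iota 0 (head 0%N mu)].

Definition kappa (mu : seq nat) : int :=
  \sum_(j < size mu)
     (nth 0%N mu j)%:Z * ((nth 0%N mu j)%:Z - 2 * (j.+1)%:Z + 1).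

Definition zpart (mu : seq nat) : nat :=
  (\prod_(1 <= j < (sumn mu).+1) (j ^ count_mem j mu * (count_mem j mu)`!))%N.

(** * Irreducible characters of the symmetric groups *)

Definition cycle_type (n : nat) (s : 'S_n) : seq nat :=
  sort geq [seq #|(X : {set 'I_n})| | X <- enum (porbits s)].

Definition fiber_stab_set (n : nat) (f : nat -> nat) : {set 'S_n} :=
  [set s : 'S_n | [forall i, f (s i) == f i]].

Fact fiber_stab_group_set n f : group_set (fiber_stab_set n f).
Proof.
apply/group_setP; split=> [|s t].
  by rewrite inE; apply/forallP => i; rewrite perm1.
rewrite !inE => /forallP hs /forallP ht; apply/forallP => i.
by rewrite permM (eqP (ht _)) hs.
Qed.

Definition fiber_stab (n : nat) (f : nat -> nat) : {group 'S_n} :=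
  Group (fiber_stab_group_set n f).

(* Number the cells of the Young diagram of mu from 0, row after row: cell i
   lies in row [reshape_index mu i] and in column [reshape_offset mu i]. *)
Definition row_group (mu : seq nat) : {group 'S_(sumn mu)} :=
  fiber_stab (sumn mu) (reshape_index mu).

Definition col_group (mu : seq nat) : {group 'S_(sumn mu)} :=
  fiber_stab (sumn mu) (reshape_offset mu).

Fact cfSign_subproof n (G : {group 'S_n}) :
  is_class_fun <<G>>%g [ffun s : 'S_n => (s \in <<G>>%g)%:R * (-1) ^+ odd_perm s].
Proof.
apply: intro_class_fun => [s t _ Gt | s /negbTE->]; last by rewrite mul0r.
by rewrite groupJr // odd_permJ.
Qed.

Definition cfSign n (G : {group 'S_n}) : 'CF(G) :=
  Cfun 0 (cfSign_subproof G).

(* The irreducible character indexed by mu is the common irreducible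
   constituent of the trivial character induced from the row group and of the
   sign character induced from the column group (so that (n) indexes the
   trivial character, and (1^n) the sign). *)
Definition is_sym_irr (mu : seq nat) (i : Iirr [set: 'S_(sumn mu)]) : bool :=
  (i \in irr_constt ('Ind[[set: 'S_(sumn mu)]] (1 : 'CF(row_group mu)))) &&
  (i \in irr_constt ('Ind[[set: 'S_(sumn mu)]] (cfSign (col_group mu)))).

(* Value on the class of cycle type eta; it is 0 if |mu| <> |eta|, as no
   permutation of |mu| points then has cycle type eta. *)
Definition sym_char (mu eta : seq nat) : algC :=
  if [pick i | @is_sym_irr mu i] is Some i then
    if [pick s : 'S_(sumn mu) | cycle_type s == eta] is Some s
    then 'chi_i s else 0
  else 0.

(** * The functions W_(mu,nu)

Rational functions of v = q^(1/2). *)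

Notation ratfun := {fraction {poly algC}}.
Local Notation "p %:F" := (@FracField.tofrac {poly algC} p)
  (at level 1, format "p %:F") : ring_scope.

Definition qhalf : ratfun := ('X : {poly algC})%:F.

Definition cst (c : algC) : ratfun := (c%:P)%:F.

(* R is regular at v, with value y. *)
Definition rat_value (R : ratfun) (v y : algC) : Prop :=
  exists A B : {poly algC},
    [/\ R = A%:F / B%:F, B.[v] != 0 & y = A.[v] / B.[v]].

(* The Schur polynomial s_nu(x_0, ..., x_(N-1)) as a quotient of alternants,
   at a point whose coordinates are pairwise distinct. *)
Definition schur_poly (N : nat) (nu : seq nat) (x : nat -> algC) : algC :=
  if (size nu <= N)%N then
    \det (\matrix_(i < N, j < N) x i ^+ (nth 0%N nu j + (N - j.+1))) /
    \det (\matrix_(i < N, j < N) x i ^+ (N - j.+1))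
  else 0.

(* q^(mu_j - j + 1/2) for j = i + 1, where q = v ^ 2. *)
Definition q_mu_rho (mu : seq nat) (v : algC) (i : nat) : algC :=
  v ^ (2 * (nth 0%N mu i)%:Z - 2 * i%:Z - 1).

Definition is_limit (u : nat -> algC) (l : algC) : Prop :=
  forall e : algC, 0 < e ->
    exists N0 : nat, forall N : nat, (N0 <= N)%N -> `|u N - l| < e.

(* s_nu(q^(mu + rho)): the rational function of q^(1/2) to which the Schur
   polynomials in finitely many variables converge wherever |q| > 1. *)
Definition is_schur_q (nu mu : seq nat) (R : ratfun) : Prop :=
  forall v : algC, 1 < `|v| ->
    exists2 y, rat_value R v y &
      is_limit (fun N => schur_poly N nu (q_mu_rho mu v)) y.

Definition schur_q (nu mu : seq nat) : ratfun :=
  epsilon (inhabits 0) (is_schur_q nu mu).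

Definition W2 (mu nu : seq nat) : ratfun := schur_q mu [::] * schur_q nu mu.

Definition W1 (nu : seq nat) : ratfun := schur_q nu [::].

(** * Formal power series in Q, p_1, p_2, ...

[f k eta] is the coefficient of Q^k p_eta, for eta a partition. *)

Definition series := nat -> seq nat -> ratfun.

(* The pairs (alpha, beta) of partitions with p_alpha p_beta = p_eta. *)
Definition splits (eta : seq nat) : seq (seq nat * seq nat) :=
  undup [seq (mask (tval m) eta, mask (map negb (tval m)) eta)
           | m <- enum {: (size eta).-tuple bool}].

Definition smul (f g : series) : series := fun k eta =>
  \sum_(j < k.+1) \sum_(ab <- splits eta) f j ab.1 * g (k - j)%N ab.2.

Definition sone : series := fun k eta => ((k == 0%N) && (eta == [::]))%:R.

Definition ssub (f g : series) : series := fun k eta => f k eta - g k eta.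

Definition spow (f : series) (r : nat) : series := iter r (smul f) sone.

(* Inverse and logarithm of a series with constant term 1. If g has constant
   term 0, the coefficient of Q^k p_eta in g^r vanishes for r > k + l(eta). *)
Definition sinv (f : series) : series := fun k eta =>
  \sum_(r < (k + size eta).+1) spow (ssub sone f) r k eta.

Definition slog (f : series) : series := fun k eta =>
  \sum_(1 <= r < (k + size eta).+1)
     (-1) ^+ r.+1 / r%:R * spow (ssub f sone) r k eta.

(* The series at p = 0. *)
Definition at_p0 (f : series) : series := fun k eta =>
  if eta == [::] then f k [::] else 0.

(** * The open string amplitude *)

(* Only |nu| = k contributes to Q^k, and only |mu| = |eta| to p_eta. *)
Definition Zopen (a : int) : series := fun k eta =>
  \sum_(mu <- parts (sumn eta)) \sum_(nu <- parts k)
     qhalf ^ (a * kappa mu) * W2 mu nu * W1 (conj_part nu) *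
     cst (sym_char mu eta / ((zpart eta)%:R * 'i ^+ size eta)).

Definition Zhat (a : int) : series := smul (Zopen a) (sinv (at_p0 (Zopen a))).

Definition Fopen (a : int) : series := slog (Zhat a).

(* Coefficient of Q^k in F_n^(a), a function of lambda via q = e^(i lambda). *)
Definition one_point (a : int) (n k : nat) : ratfun := Fopen a k [:: n].

(** * Expansion in lambda *)

(* The coefficient of lambda^n in A(e^(i lambda / 2)). *)
Definition exp_coef (A : {poly algC}) (n : nat) : algC :=
  \sum_(j < size A) A`_j * ('i * j%:R / 2) ^+ n / n`!%:R.

(* \sum_(e : int) (c e) lambda^e, with finitely many negative exponents, is the
   Laurent expansion of R(e^(i lambda / 2)) at lambda = 0: for R = A / B,
     B(e^(i lambda / 2)) * \sum_e (c e) lambda^(e + w)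
       = lambda^w A(e^(i lambda / 2)). *)
Definition is_laurent (R : ratfun) (c : int -> algC) : Prop :=
  exists (A B : {poly algC}) (w : nat),
    [/\ B != 0, R = A%:F / B%:F,
        forall e : int, e < - w%:Z -> c e = 0 &
        forall n : nat,
          \sum_(j < n.+1) exp_coef B j * c ((n - j)%:Z - w%:Z) =
          (if (w <= n)%N then exp_coef A (n - w) else 0)].

Definition laurent (R : ratfun) : int -> algC :=
  epsilon (inhabits (fun _ => 0)) (is_laurent R).

(* Coefficient of Q^k in F_(g;n)^(a). *)
Definition one_point_genus (a : int) (g n k : nat) : algC :=
  laurent (one_point a n k) (2 * g%:Z - 1).

(* Coefficient of e^(-kt) x^n in Psi_(0,1)^(a), where Q = - e^(-t). *)
Definition Psi01 (a : int) (k n : nat) : algC :=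
  if n == 0%N then 0 else (-1) ^+ k * one_point_genus a 0 n k.

(* Coefficient of e^(-Kt) x^N in x d/dx Psi_(0,1)^(a). *)
Definition xdPsi01 (a : int) (K N : nat) : algC := N%:R * Psi01 a K N.

(* Coefficient of e^(-Kt) x^N in log(1 - e^(-kt) x^m), for m >= 1. *)
Definition log_coef (k m K N : nat) : algC :=
  - \sum_(1 <= r < N.+1 | (k * r == K)%N && (m * r == N)%N) r%:R^-1.

(* x d/dx Psi_(0,1)^(a)
     = \sum_(k >= 0, m >= 1) m (d k m) log(1 - e^(-kt) x^m),
   as formal power series in e^(-t) and x; the terms with k > K or m > N do
   not contribute to the coefficient of e^(-Kt) x^N. *)
Definition log_expansion (a : int) (d : nat -> nat -> algC) : Prop :=
  forall K N : nat,
    xdPsi01 a K N =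
    \sum_(k < K.+1) \sum_(1 <= m < N.+1) m%:R * d k m * log_coef k m K N.

(** * Arithmetic functions of the formula *)

Definition moebius (n : nat) : int :=
  if [&& (0 < n)%N & all (fun p => logn p n == 1%N) (primes n)]
  then (-1) ^+ size (primes n) else 0.

Definition inv_fact (r : int) : algC :=
  if r is Posz n then n`!%:R^-1 else 0.

(* Main.v *)
(** Only the coefficient of a single variable p_n enters the one-point function,
hence only the characters of n-cycles. Up to the factor n, the indicator function
of the n-cycles is the sum over j of (-1)^j (n - j) times the j-th exterior power
of the permutation representation, so that the irreducible characters vanish on
n-cycles outside the hooks, and take the value (-1)^b there for (n - b, 1^b).

By the dual Cauchy identity, the sum over nu of
s_nu(q^(mu + rho)) s_(nu^t)(q^rho) Q^|nu| is the limit of a product of one factor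
per variable of q^(mu + rho). Its quotient by the same sum for mu empty is the
finite product of the 1 + q^c Q over the contents c of mu, which for a hook does
not depend on its shape up to rescaling Q. The q-binomial theorem then sums the
contributions of the n hooks: with [m] = q^(m/2) - q^(-m/2), the coefficient of
Q^k in F_n is
  [n]! / ([k]! [n-k]!) * prod_(l = 1)^(n-1) [n a + k + l] / (n i [n]!).
It has a simple pole at q^(1/2) = 1, whose leading coefficient is the genus 0
part, and the expansion in logarithms is undone by Moebius inversion. *)

Require Import Defs.
From mathcomp Require Import all_boot all_order all_algebra all_fingroup
  all_solvable all_field all_character.
From mathcomp Require Import zify ring.
From Stdlib Require Import ClassicalEpsilon.

Set Implicit Arguments.
Unset Strict Implicit.
Unset Printing Implicit Defensive.

Import Order.TTheory GRing.Theory Num.Theory GroupScope.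
Local Open Scope ring_scope.

(** * Characters of an n-cycle *)

(** Several objects are defined without a formula: an irreducible character is picked as a common
    constituent, while W and the Laurent coefficients come from [epsilon]. For each of them
    existence has to be proved, and then that the definition determines the value.

    For a character the only handle is inner products. A pigeonhole argument against the row and
    column characters confines a constituent of a diagram with r rows and c columns to the exterior
    degrees n - c <= j <= r. A hook leaves two adjacent degrees, any other shape at most one. Since
    the alternating sum of the exterior powers vanishes, the two multiplicities of a hook agree, and
    a lone one is 0.

    Identities for W are proved with N variables at complex v with |v| > 1 and passed to the limit;
    they return to rational functions because values at v = 2, 3, ... determine a rational function.
    The quotient by the amplitude of the empty partition is taken before the limit, where it is a
    finite product exactly, so no infinite product has to be handled. *)

Section SignCharacters.

Variables (gT : finGroupType) (G : {group gT}) (e : gT -> bool).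
Hypothesis eM : {in G &, {morph e : x y / (x * y)%g >-> x (+) y}}.

Fact sign_mx_repr : mx_repr G (fun x => ((-1) ^+ e x)%:M : 'M[algC]_1).
Proof.
have e1 : e 1%g = false by move: (eM (group1 G) (group1 G)); rewrite mul1g addbb.
split=> [|x y Gx Gy]; first by rewrite e1 expr0.
by rewrite eM // signr_addb scalar_mxM.
Qed.

Definition sign_cf : 'CF(G) := cfRepr (MxRepresentation sign_mx_repr).

Lemma sign_cf_char : sign_cf \is a character.
Proof. exact: cfRepr_char. Qed.

Lemma sign_cfE x : sign_cf x = if x \in G then (-1) ^+ e x else 0.
Proof.
rewrite cfunE; case Gx: (x \in G); last by rewrite mulr0n.
by rewrite mulr1n /= mxtrace_scalar.
Qed.

(** Translation by an element of sign -1 turns the sum into its opposite. *)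
Lemma sum_sign0 t : t \in G -> e t -> \sum_(x in G) (-1) ^+ e x = 0 :> algC.
Proof.
move=> Gt et; set S := \sum_(x in G) _.
have SN : S = - S.
  rewrite {1}/S (reindex_inj (mulgI t)) /= -sumrN.
  rewrite (eq_bigl (mem G)) => [|x]; last by rewrite /= groupMl.
  by apply: eq_bigr => x Gx; rewrite eM // et signr_addb expr1 mulN1r.
by have := mulrn_eq0 S 2; rewrite mulr2n {1}SN addNr eqxx => /esym/eqP.
Qed.

End SignCharacters.

(** * Exterior powers of the permutation representation *)

Section ExteriorCharacters.

Variable n : nat.
Implicit Types (T U : {set 'I_n}) (s t : 'S_n).
Local Notation G := [set: 'S_n]%G.

Definition stab T : {group 'S_n} := ('N(T | 'P))%G.
Definition sgn_on T s : bool := restr_perm T s.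

Lemma sgn_onM T : {in stab T &, {morph sgn_on T : x y / (x * y)%g >-> x (+) y}}.
Proof. by move=> x y Nx Ny; rewrite /sgn_on morphM //= odd_permM. Qed.

Lemma stabP T s : reflect (forall x, (s x \in T) = (x \in T)) (s \in stab T).
Proof.
rewrite inE in_setT /=; apply: (iffP idP) => [|sT].
  rewrite inE => /subsetP sT x.
  have im : s @: T = T.
    apply/eqP; rewrite eqEcard card_imset ?leqnn ?andbT; last exact: perm_inj.
    by apply/subsetP => _ /imsetP[y Ty ->]; have := sT _ Ty; rewrite inE.
  by rewrite -{1}im mem_imset //; exact: perm_inj.
by rewrite inE; apply/subsetP => x Tx; rewrite inE /= apermE sT.
Qed.

Definition lam T : 'CF(stab T) := sign_cf (@sgn_onM T).
(* The character of the j-th exterior power of the permutation representation,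
   where j = #|T|. *)
Definition psi T : 'CF(G) := 'Ind[G] (lam T).

Lemma lamE T s : lam T s = if s \in stab T then (-1) ^+ sgn_on T s else 0.
Proof. exact: sign_cfE. Qed.

Lemma psi_char T : psi T \is a character.
Proof. by rewrite cfInd_char ?sign_cf_char. Qed.

(** List T and then its complement, and likewise for U: the permutation sends each entry of the
    first list to the entry of the second at the same place. *)
Lemma exists_perm_im T U : #|T| = #|U| -> exists s, s @: T = U.
Proof.
move=> TU.
pose lT := enum T ++ enum (~: T); pose lU := enum U ++ enum (~: U).
have allT (V : {set 'I_n}) (x : 'I_n) : x \in enum V ++ enum (~: V).
  by rewrite mem_cat !mem_enum inE orbN.
have uT (V : {set 'I_n}) : uniq (enum V ++ enum (~: V)).
  rewrite cat_uniq !enum_uniq /= andbT; apply/hasPn => x.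
  by rewrite !mem_enum inE.
have sz : size lT = size lU.
  by rewrite !size_cat -!cardE !cardsC.
pose f x := nth x lU (index x lT).
have f_inj : injective f.
  move=> x y; rewrite /f => exy.
  have ix z : (index z lT < size lU)%N by rewrite -sz index_mem allT.
  have : index x lT = index y lT.
    apply/eqP; rewrite -(nth_uniq x (ix x) (ix y) (uT U)); apply/eqP.
    by rewrite exy; apply: set_nth_default; rewrite ix.
  by move/(congr1 (nth x lT)); rewrite !nth_index ?allT.
exists (perm f_inj); apply/eqP; rewrite eqEcard card_imset; last exact: perm_inj.
rewrite TU leqnn andbT; apply/subsetP => _ /imsetP[x Tx ->].
rewrite permE /f /lT index_cat mem_enum Tx /lU nth_cat -cardE -TU.
have ix : (index x (enum T) < #|T|)%N by rewrite cardE index_mem mem_enum.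
by rewrite ix -mem_enum mem_nth // -cardE -TU.
Qed.

Lemma stabE T s : (s \in stab T) = (s @: T == T).
Proof.
apply/stabP/eqP => [sT|sT x]; last by rewrite -{1}sT mem_imset //; exact: perm_inj.
apply/eqP; rewrite eqEcard card_imset ?leqnn ?andbT; last exact: perm_inj.
by apply/subsetP => _ /imsetP[y Ty ->]; rewrite sT.
Qed.

Lemma stab_im T s t : (s ^ t \in stab T)%g = (s \in stab (t^-1%g @: T)).
Proof.
have mt x : (x \in t^-1%g @: T) = (t x \in T).
  by rewrite -{1}(permK t x) mem_imset //; exact: perm_inj.
apply/stabP/stabP => sT x.
  by rewrite !mt -(sT (t x)) conjgE !permM permK.
by rewrite conjgE !permM; have := sT (t^-1%g x); rewrite !mt permKV.
Qed.

Lemma sgn_on_im T s t : (s ^ t \in stab T)%g ->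
  sgn_on T (s ^ t)%g = sgn_on (t^-1%g @: T) s.
Proof.
move=> sT; have sT' : s \in stab (t^-1%g @: T) by rewrite -stab_im.
rewrite /sgn_on; suff -> : restr_perm T (s ^ t)%g = (restr_perm (t^-1%g @: T) s ^ t)%g.
  by rewrite odd_permJ.
have mt x : (t^-1%g x \in t^-1%g @: T) = (x \in T).
  by rewrite mem_imset //; exact: perm_inj.
apply/permP => x; rewrite [in RHS]conjgE !permM.
case Tx: (x \in T).
  by rewrite !restr_permE ?mt // conjgE !permM.
rewrite (out_perm (restr_perm_on _ _)) ?Tx //.
by rewrite (out_perm (restr_perm_on _ _)) ?mt ?Tx // permKV.
Qed.

(** This is the trace on the exterior power in the basis of wedges indexed by subsets. In the
    induction formula the elements y are grouped by U = y^-1 T; each group is a coset of [stab T],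
    whose order cancels the division. *)
Lemma psiE T s :
  psi T s = \sum_(U : {set 'I_n} | (#|U| == #|T|) && (s \in stab U))
              (-1) ^+ sgn_on U s.
Proof.
rewrite cfIndE ?subsetT //.
pose F U : algC := if s \in stab U then (-1) ^+ sgn_on U s else 0.
rewrite (eq_bigr (fun y : 'S_n => F (y^-1%g @: T))) => [|y _]; last first.
  by rewrite lamE /F -stab_im; case: ifP => // h; rewrite sgn_on_im.
rewrite (partition_big (fun y : 'S_n => y^-1%g @: T) (fun U => #|U| == #|T|)) /=.
  rewrite big_mkcondr mulr_sumr; apply: eq_bigr => U /eqP cU.
  rewrite (eq_bigr (fun=> F U)) => [|y /andP[_ /eqP->] //].
  rewrite sumr_const.
  have -> : #|[pred y : 'S_n | (y \in [set: 'S_n]) && (y^-1%g @: T == U)]| = #|stab T|.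
    have [y0 y0U] := exists_perm_im (esym cU).
    have h (y : 'S_n) : (y^-1%g @: T == U) = (y0 * y \in stab T)%g.
      rewrite stabE -y0U -(inj_eq (imset_inj (@perm_inj _ y))).
      rewrite -!imset_comp eq_sym; congr (_ == _).
        by apply: eq_imset => x; rewrite /= permM.
      by rewrite -[RHS]imset_id; apply: eq_imset => x; rewrite /= permKV.
    rewrite -(card_imset _ (@mulgI _ y0)).
    apply: eq_card => y; apply/imsetP/idP => [[z]|hy].
      by case/andP=> _; rewrite h => hz ->.
    by exists (y0^-1 * y)%g; [apply/andP; split; [exact: in_setT | rewrite h mulKVg] | rewrite mulKVg].
  rewrite -(mulr_natl (F U)) mulrA mulVf ?mul1r // pnatr_eq0 -lt0n; exact: cardG_gt0.
by move=> y _; rewrite card_imset //; exact: perm_inj.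
Qed.

(** For an invariant U this is the number of cycles of s inside U. *)
Definition cyc s U : nat := #|porbit s @: U|.

Lemma stab_porbit T s x y : s \in stab T -> y \in porbit s x -> (y \in T) = (x \in T).
Proof.
move=> /stabP sT /porbitP[i ->]; elim: i => [|i IH]; first by rewrite expg0 perm1.
by rewrite expgSr permM sT.
Qed.

Lemma porbit_stab x s : s \in stab (porbit s x).
Proof.
by apply/stabP => y; rewrite -!eq_porbit_mem -[s y]/((s ^+ 1)%g y) porbit_perm.
Qed.

Lemma porbit_restr T s x : s \in stab T ->
  porbit (restr_perm T s) x = if x \in T then porbit s x else [set x].
Proof.
move=> sT; have sN : s \in 'N(T | 'P) := sT.
case: ifP => Tx; last first.
  apply/setP => y; rewrite inE; apply/porbitP/eqP => [[i ->]|->].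
    elim: i => [|i IH]; first by rewrite expg0 perm1.
    by rewrite expgSr permM IH (out_perm (restr_perm_on _ _)) ?Tx.
  by exists 0%N; rewrite expg0 perm1.
have E i : (restr_perm T s ^+ i)%g x = (s ^+ i)%g x.
  elim: i => [|i IH]; first by rewrite !expg0.
  rewrite !expgSr !permM IH restr_permE //.
  by rewrite (stab_porbit sT (mem_porbit s i x)).
by apply/setP => y; apply/porbitP/porbitP => -[i ->]; exists i; rewrite E.
Qed.

Lemma card_porbits_restr T s : s \in stab T ->
  #|porbits (restr_perm T s)| = (cyc s T + #|~: T|)%N.
Proof.
move=> sT.
have -> : porbits (restr_perm T s) = (porbit s @: T) :|: (set1 @: ~: T).
  apply/setP => X; rewrite in_setU; apply/imsetP/orP => [[x _ ->]|[]/imsetP[x Tx ->]].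
  - rewrite porbit_restr //; case: ifP => Tx; [left|right]; apply: imset_f => //.
    by rewrite inE Tx.
  - by exists x; rewrite // porbit_restr // Tx.
  - by exists x => //; rewrite porbit_restr //; move: Tx; rewrite inE => /negbTE ->.
rewrite cardsU (card_imset (mem (~: T)) (@set1_inj _)) -[RHS]subn0; congr (_ - _)%N.
apply/eqP; rewrite cards_eq0 -subset0; apply/subsetP => X.
rewrite in_setI => /andP[/imsetP[x Tx ->] /imsetP[y Ty]] E.
have : y \in porbit s x by rewrite E inE.
by move/(stab_porbit sT); move: Ty; rewrite inE Tx => /negbTE ->.
Qed.

(** A permutation of |T| points with c cycles has sign (-1)^(|T| - c). In sums weighted by (-1)^j
    only the number of cycles is then left in the exponent. *)
Lemma sign_cyc T s : s \in stab T ->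
  (-1) ^+ #|T| * (-1) ^+ sgn_on T s = (-1) ^+ cyc s T :> algC.
Proof.
move=> sT; rewrite /sgn_on /odd_perm card_porbits_restr //.
rewrite -(cardsC T) -(signr_odd _ #|T|) -(signr_odd _ (cyc s T)) !oddD -signr_addb.
by do 3!case: (odd _).
Qed.

Lemma cyc_union s U x : s \in stab U -> x \notin U ->
  cyc s (porbit s x :|: U) = (cyc s U).+1.
Proof.
move=> sU Ux; rewrite /cyc imsetU.
have -> : porbit s @: porbit s x = [set porbit s x].
  apply/setP => X; rewrite inE; apply/imsetP/eqP => [[y xy ->]|->].
    by apply/eqP; rewrite eq_porbit_mem.
  by exists x; rewrite // porbit_id.
rewrite cardsU1; case: imsetP => // -[y Uy E].
have : x \in porbit s y by rewrite -E porbit_id.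
by move/(stab_porbit sU); rewrite Uy (negbTE Ux).
Qed.

(* Toggling the cycle of x cancels the invariant sets in pairs. *)
Lemma toggle_sum0 s x (P : pred {set 'I_n}) :
  (forall U, x \notin U -> P (porbit s x :|: U) = P U) ->
  \sum_(U : {set 'I_n} | (s \in stab U) && P U) (-1) ^+ cyc s U = 0 :> algC.
Proof.
move=> PU; rewrite (bigID (fun U : {set 'I_n} => x \in U)) /=.
have sx := porbit_stab x s.
have sub U : s \in stab U -> x \in U -> porbit s x \subset U.
  by move=> sU Ux; apply/subsetP => y /(stab_porbit sU) ->.
have dis U y : s \in stab U -> x \notin U -> y \in porbit s x -> (y \in U) = false.
  by move=> sU /negbTE Ux /(stab_porbit sU) ->.
rewrite (reindex_onto (fun U => porbit s x :|: U) (fun U => U :\: porbit s x)) /=.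
  rewrite (eq_bigl (fun U => (s \in stab U) && P U && (x \notin U))).
    rewrite -big_split /= big1 // => U /andP[/andP[sU _] Ux].
    by rewrite cyc_union // exprS mulN1r addNr.
  move=> U; rewrite in_setU porbit_id /= andbT.
  apply/andP/andP => [[/andP[sU pU] /eqP E]|[/andP[sU pU] xU]].
    have xU : x \notin U by rewrite -E in_setD porbit_id.
    rewrite -PU // pU xU andbT; split=> //.
    apply/stabP => y; rewrite -E !in_setD.
    by move/stabP: sU => ->; move/stabP: sx => ->.
  rewrite PU // pU andbT; split.
    by apply/stabP => y; rewrite !in_setU; move/stabP: sU => ->; move/stabP: sx => ->.
  apply/eqP/setP => y; rewrite in_setD in_setU.
  by case E: (y \in porbit s x) => //=; rewrite (dis U y).
move=> U /andP[/andP[sU _] xU].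
by rewrite setDE setUIr setUCr setIT; apply/setUidPr/sub.
Qed.

Definition low_set (j : nat) : {set 'I_n} := [set i : 'I_n | (i < j)%N].

Lemma card_low_set j : (j <= n)%N -> #|low_set j| = j.
Proof.
move=> jn; rewrite -sum1dep_card (big_ord_narrow jn) /=.
by rewrite sum1_card card_ord.
Qed.

Lemma psi_low_sum (w : nat -> algC) s :
  \sum_(j < n.+1) (-1) ^+ j * w j * psi (low_set j) s =
  \sum_(U : {set 'I_n} | s \in stab U) (-1) ^+ cyc s U * w #|U|.
Proof.
rewrite (partition_big (fun U : {set 'I_n} => inord #|U| : 'I_n.+1) xpredT) //=.
apply: eq_bigr => j _; rewrite psiE card_low_set; last by rewrite -ltnS.
rewrite mulr_sumr; apply: eq_big => [U|U /andP[/eqP cU sU]].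
  rewrite andbC; congr (_ && _).
  by rewrite -(inj_eq val_inj) /= inordK // ltnS -[X in (_ <= X)%N]card_ord max_card.
by rewrite -cU mulrAC -(sign_cyc sU).
Qed.

(** The sum is det(1 - s) on the permutation representation, zero because s fixes the sum of the
    basis vectors; combinatorially, any one cycle can be toggled. *)
Lemma psi_alt_sum s : (0 < n)%N ->
  \sum_(j < n.+1) (-1) ^+ j * psi (low_set j) s = 0.
Proof.
move=> n0; have := psi_low_sum (fun=> 1) s.
under eq_bigr do rewrite mulr1.
move=> ->; under eq_bigr do rewrite mulr1.
rewrite -[RHS](@toggle_sum0 s (Ordinal n0) xpredT (fun _ _ => erefl)).
by apply: eq_bigl => U; rewrite andbT.
Qed.

Definition transitive_perm s := [forall x, porbit s x == [set: 'I_n]].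

(** The weight n - |U| counts the points z outside U. For fixed z, any cycle not through z can be
    toggled, so the sum is zero unless s is a single cycle; then U is empty, and each of the n
    points z gives 1. *)
Lemma psi_weighted_sum s :
  \sum_(j < n.+1) (-1) ^+ j * (n - j)%:R * psi (low_set j) s =
  if transitive_perm s then n%:R else 0.
Proof.
rewrite (psi_low_sum (fun j => (n - j)%:R)).
have E U : (n - #|U|)%:R = \sum_(z : 'I_n | z \notin U) 1 :> algC.
  rewrite sumr_const; congr (_ *+ _).
  rewrite -[X in (X - _)%N](card_ord n) -(cardsC U) addKn.
  by apply: eq_card => z; rewrite inE.
under eq_bigr => U _ do rewrite E mulr_sumr big_mkcond.
rewrite exchange_big /=.
under eq_bigr => z _ do rewrite -big_mkcondr.
case: ifP => [/forallP tr|/negbT]; last first.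
  rewrite negb_forall => /existsP[x /eqP nx].
  apply: big1 => z _.
  have [y zy] : exists y, y \notin porbit s z.
    apply/existsP; rewrite -negb_forall; apply/negP => /forallP zz; apply: nx.
    have /eqP -> : porbit s x == porbit s z by rewrite eq_porbit_mem.
    by apply/setP => y; rewrite inE zz.
  under eq_bigr do rewrite mulr1.
  apply: (@toggle_sum0 s y (fun U => z \notin U)) => U yU.
  by rewrite in_setU negb_or porbit_sym zy.
rewrite -[in RHS](card_ord n) -sumr_const; apply: eq_bigr => z _.
rewrite (big_pred1 set0) => [|U]; first by rewrite /cyc imset0 cards0 mulr1.
apply/andP/eqP => [[sU zU]|->].
  apply/setP => y; rewrite inE (stab_porbit (x := z) sU) ?(negbTE zU) //.
  by rewrite (eqP (tr z)) inE.
by split; [apply/stabP => y|]; rewrite !inE.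
Qed.

End ExteriorCharacters.

(** * Inner products of induced sign characters *)

Section SignInduction.

Variables (gT : finGroupType) (G H M : {group gT}) (e d : gT -> bool).
Hypotheses (sHG : H \subset G) (sMG : M \subset G).
Hypothesis eM : {in H &, {morph e : x y / (x * y)%g >-> x (+) y}}.
Hypothesis dM : {in M &, {morph d : x y / (x * y)%g >-> x (+) y}}.

(** This is the intersection of M with y H y^-1. The product of the two sign characters on it is
    again a sign character, so [sum_at y] is 0 or the order of this group. *)
Let mack y := (M :&: H :^ y^-1)%G.
Let sgn_at y x := e (x ^ y)%g (+) d x.
Let sum_at y : algC := \sum_(x in mack y) (-1) ^+ sgn_at y x.

Let mem_mack y x : (x \in mack y) = (x \in M) && (x ^ y \in H)%g.
Proof. by rewrite in_setI mem_conjg invgK. Qed.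

Let sgn_atM y : {in mack y &, {morph sgn_at y : x z / (x * z)%g >-> x (+) z}}.
Proof.
move=> x z; rewrite !mem_mack => /andP[Mx Hx] /andP[Mz Hz].
by rewrite /sgn_at conjMg eM // dM // addbACA.
Qed.

Let sum_at_cases y : sum_at y = 0 \/ sum_at y = #|mack y|%:R.
Proof.
have [/existsP[t /andP[Ht et]]|] := boolP [exists t, (t \in mack y) && sgn_at y t].
  by left; apply: (sum_sign0 (@sgn_atM y) Ht et).
rewrite negb_exists => /forallP nt; right.
rewrite /sum_at -sumr_const; apply: eq_bigr => x Mx.
by have := nt x; rewrite Mx /= => /negbTE ->.
Qed.

(** Frobenius reciprocity followed by Mackey's formula, summed over all y in G rather than over
    double coset representatives, whence the division by both group orders. *)
Lemma cfdot_ind_sign :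
  '['Ind[G] (sign_cf eM), 'Ind[G] (sign_cf dM)] =
  #|M|%:R^-1 * (#|H|%:R^-1 * \sum_(y in G) sum_at y).
Proof.
rewrite -cfdot_Res_l cfdotE; congr (_ * _).
rewrite mulr_sumr /sum_at.
under [in RHS]eq_bigr do rewrite big_mkcond mulr_sumr.
rewrite exchange_big /= big_mkcond /=; apply: eq_bigr => x _.
rewrite -mulr_sumr; case: ifP => Mx; last first.
  rewrite big1 ?mulr0 // => y _.
  by rewrite -[x \in _]/(x \in mack y) mem_mack Mx.
rewrite cfResE // cfIndE // -mulrA; congr (_ * _).
rewrite mulr_suml; apply: eq_bigr => y _.
rewrite -[X in if X then _ else _]/(x \in mack y) mem_mack Mx /= !sign_cfE Mx.
case: ifP => // _; last by rewrite mul0r.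
by rewrite rmorphXn /= rmorphN rmorph1 -signr_addb.
Qed.

Lemma cfdot_ind_sign0 :
  (forall y, y \in G -> exists t, [/\ t \in M, (t ^ y)%g \in H & e (t ^ y)%g (+) d t]) ->
  '['Ind[G] (sign_cf eM), 'Ind[G] (sign_cf dM)] = 0.
Proof.
move=> bad; rewrite cfdot_ind_sign big1 ?mulr0 // => y /bad[t [Mt Ht et]].
by apply: (sum_sign0 (@sgn_atM y) (t := t)) => //; rewrite mem_mack Mt.
Qed.

(** The summand at y = 1 is positive and the others are nonnegative. *)
Lemma cfdot_ind_sign_neq0 :
  (forall t, t \in M -> t \in H -> e t = d t) ->
  '['Ind[G] (sign_cf eM), 'Ind[G] (sign_cf dM)] != 0.
Proof.
move=> good; rewrite cfdot_ind_sign !mulf_neq0 ?invr_eq0 ?pnatr_eq0 -?lt0n ?cardG_gt0 //.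
rewrite (bigD1 1%g) //= gt_eqF // ltr_pwDl //.
  rewrite /sum_at (eq_bigr (fun=> 1)); first by rewrite sumr_const ltr0n cardG_gt0.
  move=> x; rewrite mem_mack conjg1 => /andP[Mx Hx].
  by rewrite /sgn_at conjg1 good // addbb.
by apply: sumr_ge0 => y _; have [-> //|->] := sum_at_cases y; apply: ler0n.
Qed.

(** Only y in M H contribute, each exactly 1, because [mack y] is then conjugate to a subgroup of
    the trivial intersection of M and H; and M H has at most |M| |H| elements. *)
Lemma cfdot_ind_sign_le1 :
  M :&: H = 1%g ->
  (forall y, y \in G ->
     (exists t, [/\ t \in M, (t ^ y)%g \in H & e (t ^ y)%g (+) d t]) \/
     y \in (M * H)%g) ->
  '['Ind[G] (sign_cf eM), 'Ind[G] (sign_cf dM)] <= 1.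
Proof.
move=> tiMH bad; rewrite cfdot_ind_sign mulrA -invfM mulrC ler_pdivrMr; last first.
  by rewrite mulr_gt0 // ltr0n cardG_gt0.
rewrite mul1r -natrM (le_trans (y := \sum_(y in G) (y \in (M * H)%g)%:R)) //.
  apply: ler_sum => y Gy.
  case yMH: (y \in (M * H)%g); last first.
    have [[t [Mt Ht et]]|] := bad y Gy; last by rewrite yMH.
    by rewrite /sum_at (sum_sign0 (@sgn_atM y) (t := t)) //; rewrite mem_mack Mt.
  have tr : mack y :=: 1%g.
    apply/trivgP/subsetP => x; rewrite mem_mack => /andP[Mx Hx].
    have /imset2P[r c Mr Hc Ey] := yMH.
    have : (x ^ r)%g \in M :&: H.
      rewrite in_setI groupJ //=.
      by rewrite -(groupJr _ Hc) -conjgM -Ey.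
    by rewrite tiMH inE conjg_eq1 => /eqP ->; rewrite inE.
  rewrite /sum_at tr big_set1 /sgn_at conj1g.
  have -> : e 1%g = false by move: (eM (group1 H) (group1 H)); rewrite mul1g addbb.
  have -> : d 1%g = false by move: (dM (group1 M) (group1 M)); rewrite mul1g addbb.
  by [].
rewrite -natr_sum ler_nat.
have -> : (\sum_(y in G) (y \in (M * H)%g) = \sum_(y in G | y \in (M * H)%g) 1)%N.
  by rewrite big_mkcondr; apply: eq_bigr => y _; case: ifP.
rewrite (eq_bigl (fun y => y \in (M * H)%g)) => [|y].
  by rewrite sum1_card mul_cardG leq_pmulr ?cardG_gt0.
by apply: andb_idl; apply: (subsetP (mul_subG sMG sHG)).
Qed.

End SignInduction.

Lemma cf1_sign (gT : finGroupType) (M : {group gT})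
  (dM : {in M &, {morph (fun=> false) : x y / (x * y)%g >-> x (+) y}}) :
  sign_cf dM = 1.
Proof. by apply/cfunP => x; rewrite sign_cfE cfun1E; case: ifP. Qed.

Lemma cfSign_sign n (C : {group 'S_n})
  (dM : {in C &, {morph (@odd_perm _) : x y / (x * y)%g >-> x (+) y}}) :
  cfSign C = sign_cf dM.
Proof.
apply/cfunP => x; rewrite sign_cfE cfunE /=; rewrite genGid.
by case: ifP; rewrite ?mul1r ?mul0r.
Qed.

Section Fibers.

Variables (n : nat).
Local Notation G := [set: 'S_n]%G.

Lemma fiber_stabP (f : nat -> nat) (s : 'S_n) :
  reflect (forall i : 'I_n, f (s i) = f i) (s \in fiber_stab n f).
Proof. by rewrite inE; apply: (iffP forallP) => h i; apply/eqP; exact: h. Qed.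

Lemma tperm_fiber (f : nat -> nat) (a b : 'I_n) : f a = f b -> tperm a b \in fiber_stab n f.
Proof. by move=> fab; apply/fiber_stabP => i; case: tpermP => [->|->|]. Qed.

Lemma sgn_on_tperm_in (T : {set 'I_n}) a b : a \in T -> b \in T -> a != b ->
  (tperm a b \in stab T) && sgn_on T (tperm a b).
Proof.
move=> Ta Tb nab.
have st : tperm a b \in stab T.
  by apply/stabP => x; case: tpermP => [->|->|] //; rewrite ?Ta ?Tb.
rewrite st /sgn_on; have -> : restr_perm T (tperm a b) = tperm a b.
  apply/permP => x; case Tx: (x \in T); first by rewrite restr_permE.
  rewrite (out_perm (restr_perm_on _ _)) ?Tx // tpermD //.
    by apply: contraFneq Tx => <-.
  by apply: contraFneq Tx => <-.
by rewrite odd_tperm nab.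
Qed.

Lemma sgn_on_tperm_out (T : {set 'I_n}) a b : a \notin T -> b \notin T -> a != b ->
  (tperm a b \in stab T) && ~~ sgn_on T (tperm a b).
Proof.
move=> Ta Tb nab.
have st : tperm a b \in stab T.
  by apply/stabP => x; case: tpermP => [->|->|] //; rewrite ?(negbTE Ta) ?(negbTE Tb).
rewrite st /sgn_on; have -> : restr_perm T (tperm a b) = 1%g.
  apply/permP => x; rewrite perm1; case Tx: (x \in T).
    rewrite restr_permE // tpermD //.
      by apply: contraNneq Ta => ->.
    by apply: contraNneq Tb => ->.
  by rewrite (out_perm (restr_perm_on _ _)) ?Tx.
by rewrite odd_perm1.
Qed.

Lemma pigeonhole (A : {set 'I_n}) (f : nat -> nat) L :
  (forall i : 'I_n, f i < L)%N -> (L < #|A|)%N ->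
  exists a b : 'I_n, [/\ a \in A, b \in A, a != b & f a = f b].
Proof.
move=> fL LA.
have [/existsP[a /existsP[b /and4P[Aa Ab nab /eqP fab]]]|no] :=
  boolP [exists a : 'I_n, [exists b : 'I_n, [&& a \in A, b \in A, a != b & f a == f b]]].
  by exists a, b.
move: LA; rewrite ltnNge => /negP[]; pose g (i : 'I_n) := Ordinal (fL i).
have gi : {in A &, injective g}.
  move=> a b Aa Ab /(congr1 val) /= fab; apply: contraNeq no => nab.
  by apply/existsP; exists a; apply/existsP; exists b; rewrite Aa Ab nab fab eqxx.
by rewrite -(card_in_imset gi) -[X in (_ <= X)%N]card_ord max_card.
Qed.

Lemma fiber_stab1M (f : nat -> nat) :
  {in fiber_stab n f &, {morph (fun=> false) : x y / (x * y)%g >-> x (+) y}}.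
Proof. by []. Qed.

Lemma fiber_stab_oddM (f : nat -> nat) :
  {in fiber_stab n f &, {morph (@odd_perm _) : x y / (x * y)%g >-> x (+) y}}.
Proof. by move=> x y _ _; apply: odd_permM. Qed.

Lemma imset_inv_mem (T : {set 'I_n}) (y : 'S_n) a : (a \in y^-1%g @: T) = (y a \in T).
Proof. by rewrite -{1}(permK y a) mem_imset //; exact: perm_inj. Qed.

(** With more points in T than rows, each translate of T has two points in one row. Their
    transposition acts trivially in the row character but is odd on T. *)
Lemma psi_row0 (T : {set 'I_n}) (f : nat -> nat) L :
  (forall i : 'I_n, f i < L)%N -> (L < #|T|)%N ->
  '[psi T, 'Ind[G] (1 : 'CF(fiber_stab n f))] = 0.
Proof.
move=> fL LT; rewrite -(cf1_sign (@fiber_stab1M f)).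
apply: cfdot_ind_sign0; rewrite ?subsetT // => y _.
have : (L < #|y^-1%g @: T|)%N by rewrite card_imset //; exact: perm_inj.
move=> /(pigeonhole fL)[a [b [Aa Ab nab fab]]]; exists (tperm a b).
have nab' : y a != y b by rewrite (inj_eq perm_inj).
move: Aa Ab; rewrite !imset_inv_mem => Ta Tb.
have /andP[st sg] := sgn_on_tperm_in Ta Tb nab'.
by rewrite tpermJ st sg; split=> //; apply: tperm_fiber.
Qed.

(** Dually, two points of the complement share a column: their transposition is odd in the column
    character but acts trivially on T. *)
Lemma psi_col0 (T : {set 'I_n}) (h : nat -> nat) L :
  (forall i : 'I_n, h i < L)%N -> (L < #|~: T|)%N ->
  '[psi T, 'Ind[G] (cfSign (fiber_stab n h))] = 0.
Proof.
move=> hL LT; rewrite (cfSign_sign (@fiber_stab_oddM h)).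
apply: cfdot_ind_sign0; rewrite ?subsetT // => y _.
have : (L < #|y^-1%g @: (~: T)|)%N by rewrite card_imset //; exact: perm_inj.
move=> /(pigeonhole hL)[a [b [Aa Ab nab hab]]]; exists (tperm a b).
have nab' : y a != y b by rewrite (inj_eq perm_inj).
move: Aa Ab; rewrite !imset_inv_mem !in_setC => Ta Tb.
have /andP[st /negbTE sg] := sgn_on_tperm_out Ta Tb nab'.
by rewrite tpermJ st sg odd_tperm nab; split=> //; apply: tperm_fiber.
Qed.

End Fibers.

(** The alternating sum forces m b = m b.+1; the weights n - b and n - b - 1 differ by one, so a
    single copy survives. *)
Lemma alt_sum_two_terms (R : comRingType) n b (m : nat -> R) :
  (b < n)%N ->
  (forall j, (j <= n)%N -> m j != 0 -> (j == b) || (j == b.+1)) ->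
  \sum_(j < n.+1) (-1) ^+ j * m j = 0 ->
  \sum_(j < n.+1) (-1) ^+ j * (n - j)%:R * m j = (-1) ^+ b * m b.+1 /\ m b = m b.+1.
Proof.
move=> bn supp.
have bn1 : (b < n.+1)%N by apply: ltnW.
have two (c : nat -> R) : \sum_(j < n.+1) c j * m j = c b * m b + c b.+1 * m b.+1.
  rewrite (bigD1 (Ordinal bn1)) //= (bigD1 (Ordinal (bn : b.+1 < n.+1)%N)) /=; last first.
    by rewrite -val_eqE /= gtn_eqF.
  rewrite big1 ?addr0 // => j /andP[]; rewrite -!val_eqE /= => jb jb1.
  have := supp j; rewrite -ltnS ltn_ord (negbTE jb) (negbTE jb1) => h.
  by case: (eqVneq (m j) 0) => [->|/h]; rewrite ?mulr0 // => /(_ isT).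
rewrite (two (fun j => (-1) ^+ j)) (two (fun j => (-1) ^+ j * (n - j)%:R)).
set e := (-1) ^+ b; rewrite exprS mulN1r -/e => E.
have ee : e * e = 1 by rewrite -expr2 sqrr_sign.
have mb : m b = m b.+1.
  apply/eqP; rewrite -subr_eq0 -[_ - _]mul1r -ee -mulrA.
  by rewrite mulrBr -mulNr E mulr0.
by split=> //; rewrite mb -(subnSK bn) -natr1; ring.
Qed.

Lemma alt_sum_one_term (R : idomainType) n b (m : nat -> R) :
  (b <= n)%N ->
  (forall j, (j <= n)%N -> m j != 0 -> j == b) ->
  \sum_(j < n.+1) (-1) ^+ j * m j = 0 ->
  \sum_(j < n.+1) (-1) ^+ j * (n - j)%:R * m j = 0.
Proof.
move=> bn supp.
have one (c : nat -> R) : \sum_(j < n.+1) c j * m j = c b * m b.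
  rewrite (bigD1 (Ordinal (bn : b < n.+1)%N)) //= big1 ?addr0 // => j.
  rewrite -!val_eqE /= => jb; have := supp j; rewrite -ltnS ltn_ord (negbTE jb) => h.
  by case: (eqVneq (m j) 0) => [->|/h]; rewrite ?mulr0 // => /(_ isT).
rewrite (one (fun j => (-1) ^+ j)) (one (fun j => (-1) ^+ j * (n - j)%:R)).
by move/eqP; rewrite mulf_eq0 signr_eq0 /= => /eqP ->; rewrite mulr0.
Qed.

Section Cycles.

Variable n : nat.
Hypothesis n_gt0 : (0 < n)%N.
Local Notation G := [set: 'S_n]%G.
Local Notation psi_ j := (psi (low_set n j)).

(** By [psi_weighted_sum] this is n times the indicator function of the n-cycles, written so that
    its pairing with a character involves multiplicities only. *)
Let W : 'CF(G) := \sum_(j < n.+1) ((-1) ^+ j * (n - j)%:R) *: psi_ j.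

Let WE s : W s = if transitive_perm s then n%:R else 0.
Proof.
rewrite -psi_weighted_sum sum_cfunE; apply: eq_bigr => j _.
by rewrite cfunE.
Qed.

Let W_dot (chi : 'CF(G)) :
  '[W, chi] = \sum_(j < n.+1) (-1) ^+ j * (n - j)%:R * '[psi_ j, chi].
Proof. by rewrite cfdot_suml; apply: eq_bigr => j _; rewrite cfdotZl. Qed.

Lemma psi_alt_dot (chi : 'CF(G)) : \sum_(j < n.+1) (-1) ^+ j * '[psi_ j, chi] = 0.
Proof.
have E : \sum_(j < n.+1) (-1) ^+ j *: psi_ j = 0 :> 'CF(G).
  apply/cfunP => s; rewrite sum_cfunE cfunE; apply: etrans (psi_alt_sum s n_gt0).
  by apply: eq_bigr => j _; rewrite cfunE.
apply: etrans (cfdot0l chi); rewrite -E cfdot_suml.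
by apply: eq_bigr => j _; rewrite cfdotZl.
Qed.

Lemma psi_card (T U : {set 'I_n}) : #|T| = #|U| -> psi T = psi U.
Proof. by move=> TU; apply/cfunP => s; rewrite !psiE TU. Qed.

Let Tr := [set s : 'S_n | transitive_perm s].

Lemma psi0 : psi_ 0 = 1.
Proof.
apply/cfunP => s; rewrite psiE cfun1E inE card_low_set //.
rewrite (big_pred1 set0) => [|U]; last first.
  rewrite cards_eq0; apply: andb_idr => /eqP ->.
  by apply/stabP => y; rewrite !inE.
have s0 : s \in stab (set0 : {set 'I_n}) by apply/stabP => y; rewrite !inE.
by have := sign_cyc s0; rewrite /cyc imset0 !cards0 !expr0 mul1r => ->.
Qed.

(** Pairing [W] with the trivial character gives 1, since exterior powers of degree above 1 have no
    trivial constituent. This counts the n-cycles, and in particular shows that they exist. *)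
Let n_card_Tr : (n * #|Tr|)%:R = #|G|%:R :> algC.
Proof.
have W1 : '[W, 1] = 1.
  have supp j : (j <= n)%N -> '[psi_ j, 1] != 0 -> (j == 0%N) || (j == 1%N).
    move=> jn; apply: contraNT; rewrite negb_or => j01.
    have eG : fiber_stab n (fun=> 0%N) = G.
      by apply/group_inj/setP => s; rewrite in_setT; apply/fiber_stabP.
    have := @psi_row0 n (low_set n j) (fun=> 0%N) 1%N (fun=> isT).
    by rewrite card_low_set // eG cfInd_id => -> //; case: j j01 {jn} => [|[]].
  have [] := alt_sum_two_terms n_gt0 supp (psi_alt_dot 1).
  by rewrite -W_dot mul1r => -> <-; rewrite psi0 cfnorm1.
move: W1; rewrite cfdotE => /(congr1 ( *%R #|G|%:R)).
rewrite mulVKf ?neq0CG // mulr1 => <-.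
rewrite natrM mulr_natr -sumr_const; apply/esym.
rewrite [RHS]big_mkcond [LHS]big_mkcond /=; apply: eq_bigr => s _.
by rewrite !inE WE cfun1E inE rmorph1 mulr1.
Qed.

(** A permutation commuting with a transitive c is determined by the image of one point, so the
    centralizer has at most n elements and the class of c at least |G| / n, which is the number of
    n-cycles. *)
Let class_Tr c : transitive_perm c -> (c ^: G)%g = Tr.
Proof.
move=> trc; apply/eqP; rewrite eqEcard; apply/andP; split.
  apply/subsetP => _ /imsetP[g _ ->]; rewrite inE.
  apply/forallP => x; apply/eqP/setP => y; rewrite in_setT.
  have : g^-1%g y \in porbit c (g^-1%g x) by rewrite (eqP (forallP trc _)) in_setT.
  case/porbitP => k yx; apply/porbitP; exists k.
  by rewrite -conjXg conjgE !permM -yx permKV.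
have x0 : 'I_n := Ordinal n_gt0.
have cent_le : (#|'C_G[c]%g| <= n)%N.
  pose ev (z : 'S_n) := z x0.
  have ev_inj : {in 'C_G[c]%g &, injective ev}.
    move=> z z'; rewrite !in_setI => /andP[_ /cent1P cz] /andP[_ /cent1P cz'] zz.
    apply/permP => x; have : x \in porbit c x0.
      by rewrite (eqP (forallP trc _)) in_setT.
    case/porbitP => k ->; rewrite -!permM.
    by rewrite -(commuteX k cz) -(commuteX k cz') !permM; congr (_ _); exact: zz.
  by rewrite -(card_in_imset ev_inj) -[X in (_ <= X)%N]card_ord max_card.
rewrite -(leq_pmul2l n_gt0); have := n_card_Tr => /eqP; rewrite eqr_nat => /eqP ->.
by rewrite -(Lagrange (subsetIl G 'C[c]%g)) index_cent1 leq_mul2r cent_le orbT.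
Qed.

Lemma chi_at_cycle i c : transitive_perm c ->
  ('chi[G]_i c)^* = \sum_(j < n.+1) (-1) ^+ j * (n - j)%:R * '[psi_ j, 'chi_i].
Proof.
move=> trc; rewrite -W_dot cfdotE.
have -> : \sum_(x in G) W x * ('chi_i x)^* = (n * #|Tr|)%:R * ('chi_i c)^*.
  rewrite natrM mulrAC mulr_natr -sumr_const [RHS]big_mkcond [LHS]big_mkcond /=.
  apply: eq_bigr => s _; rewrite inE WE -(class_Tr trc).
  case: ifP => [trs|ntrs]; case: ifP => //.
  - by case/imsetP => g _ ->; rewrite cfunJ // inE.
  - by rewrite (class_Tr trc) inE trs.
  - by rewrite (class_Tr trc) inE ntrs.
  - by rewrite mul0r.
by rewrite n_card_Tr mulKf ?neq0CG.
Qed.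

Lemma exists_transitive_perm : exists c : 'S_n, transitive_perm c.
Proof.
have : #|Tr| != 0%N.
  apply: contraTneq isT => T0; have /eqP := n_card_Tr.
  by rewrite T0 muln0 eq_sym (negbTE (neq0CG _)).
by rewrite cards_eq0 => /set0Pn[c]; rewrite inE; exists c.
Qed.

End Cycles.

(** * Row and column groups of a hook *)

Section HookGroups.

Variables n a b : nat.
Hypothesis nE : n = (a + b).+1.
Local Notation G := [set: 'S_n]%G.

(** The hook (a+1, 1^b) is numbered row after row: cells 0, ..., a form the first row, and every
    later cell is alone in its row and lies in column 0. *)
Definition hook_row a i : nat := if (i <= a)%N then 0%N else (i - a)%N.
Definition hook_col a i : nat := if (i <= a)%N then i else 0%N.

Let R := fiber_stab n (hook_row a).
Let C := fiber_stab n (hook_col a).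
(** The first column; it meets the first row A only in the corner cell 0. *)
Let B : {set 'I_n} := [set i : 'I_n | (nat_of_ord i == 0%N) || (a < i)%N].
Let A : {set 'I_n} := [set i : 'I_n | (i <= a)%N].

Let n_gt0 : (0 < n)%N. Proof. by rewrite nE. Qed.
Let o0 : 'I_n := Ordinal n_gt0.

Let card_A : #|A| = a.+1.
Proof.
have -> : A = low_set n a.+1 by apply/setP => i; rewrite !inE.
by rewrite card_low_set // nE ltnS leq_addr.
Qed.

Let card_AC : #|~: A| = b.
Proof. by have := cardsC A; rewrite card_A card_ord; lia. Qed.

Let card_B : #|B| = b.+1.
Proof.
have -> : B = o0 |: ~: A by apply/setP => i; rewrite !inE -ltnNge.
by rewrite cardsU1 card_AC !inE.
Qed.

Let card_BC : #|~: B| = a.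
Proof. by have := cardsC B; rewrite card_B card_ord; lia. Qed.

Let R_out s x : s \in R -> x \notin A -> s x = x.
Proof.
move/fiber_stabP => /(_ x); rewrite inE -ltnNge /hook_row => E ax.
by apply: val_inj => /=; move: E; case: leqP => /= ?; case: leqP => /= ?; lia.
Qed.

Let C_out s x : s \in C -> x \notin B -> s x = x.
Proof.
move/fiber_stabP => /(_ x); rewrite inE negb_or -leqNgt /hook_col => E /andP[x0 ax].
by apply: val_inj => /=; move: E x0; case: leqP => /= ?; case: leqP => /= ?; lia.
Qed.

Let R_A s x : s \in R -> (s x \in A) = (x \in A).
Proof.
move/fiber_stabP => /(_ x); rewrite !inE /hook_row.
by case: leqP => /= ?; case: leqP => /= ?; lia.
Qed.

Let C_B s x : s \in C -> (s x \in B) = (x \in B).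
Proof.
move/fiber_stabP => /(_ x); rewrite !inE /hook_col.
by case: leqP => /= ?; case: leqP => /= ?; lia.
Qed.

Let A_B x : x \in A -> x \in B -> x = o0.
Proof. by rewrite !inE => xa xb; apply: val_inj => /=; lia. Qed.

Let R_mem (s : 'S_n) : (forall x, x \notin A -> s x = x) -> s \in R.
Proof.
move=> sx; apply/fiber_stabP => x; case Ax: (x \in A); last by rewrite sx ?Ax.
have : s x \in A.
  apply: contraTT (Ax) => sxA; have /perm_inj E := sx _ sxA.
  by move: sxA; rewrite E.
by move: Ax; rewrite !inE /hook_row => -> ->.
Qed.

Let C_mem (s : 'S_n) : (forall x, x \notin B -> s x = x) -> s \in C.
Proof.
move=> sx; apply/fiber_stabP => x; case Bx: (x \in B); last by rewrite sx ?Bx.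
have : s x \in B.
  apply: contraTT (Bx) => sxB; have /perm_inj E := sx _ sxB.
  by move: sxB; rewrite E.
move: Bx; rewrite !inE /hook_col; case: leqP => /= ?; case: leqP => /= ?; lia.
Qed.

Let R_C : R :&: C = 1%g.
Proof.
apply/trivgP/subsetP => s; rewrite in_setI => /andP[Rs Cs].
rewrite inE; apply/eqP/permP => x; rewrite perm1.
case Ax: (x \in A); last by rewrite R_out // Ax.
case Bx: (x \in B); last by rewrite C_out // Bx.
by rewrite (A_B Ax Bx); apply: A_B; rewrite ?R_A ?C_B // -?(A_B Ax Bx).
Qed.

(** The dichotomy behind Young symmetrizers: either y carries two cells of one row into one column,
    whose transposition makes the Mackey summand vanish, or y is a row permutation times a column
    permutation. *)
Let exchange_or_product (y : 'S_n) :
  (exists t, [/\ t \in R, (t ^ y)%g \in C & odd_perm (t ^ y)%g (+) false]) \/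
  y \in (R * C)%g.
Proof.
have [/existsP[x0 /andP[Ax0 Bx0]]|] := boolP [exists x, (x \notin A) && (y x \notin B)].
  left; pose A' := [set i in A | y i \in B].
  (* Of the a cells outside B one is y x0, so at most a - 1 of the a + 1 cells of A are sent out of
     B. *)
  have A'2 : (1 < #|A'|)%N.
    have : (#|A| <= #|A'| + #|~: B :\ y x0|)%N.
      rewrite -(card_imset (mem (_ :\ _)) (@perm_inj _ y^-1%g)) -cardsUI.
      apply: leq_trans (leq_addr _ _); apply: subset_leq_card; apply/subsetP => i Ai.
      rewrite in_setU inE Ai /=; case Bi: (y i \in B) => //=.
      apply/imsetP; exists (y i); rewrite ?permK // in_setD1 in_setC Bi andbT.
      by rewrite (inj_eq perm_inj); apply: contraNneq Ax0 => <-.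
    by have := cardsD1 (y x0) (~: B); rewrite card_A card_BC in_setC Bx0; lia.
  have /card_gt1P[i [j [Hi Hj nij]]] := A'2.
  move: Hi Hj; rewrite !inE => /andP[Ai Bi] /andP[Aj Bj].
  exists (tperm i j); rewrite tpermJ odd_tperm (inj_eq perm_inj) nij; split=> //.
    by apply: tperm_fiber; rewrite /hook_row Ai Aj.
  apply: tperm_fiber; rewrite /hook_col; move: Bi Bj; case: leqP => /= ?; case: leqP => /= ?; lia.
rewrite negb_exists => /forallP yB; right.
have {}yB x : x \notin A -> y x \in B.
  by move=> Ax; have := yB x; rewrite Ax /= negbK.
have /set0Pn[b0] : B :\: (y @: ~: A) != set0.
  rewrite -card_gt0 cardsD subn_gt0; apply: leq_ltn_trans (_ : #|y @: ~: A| < _)%N.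
    by apply/subset_leq_card/subsetIr.
  by rewrite card_imset ?card_AC ?card_B //; exact: perm_inj.
rewrite in_setD => /andP[yb0 Bb0].
(* The column factor agrees with y off the first row, sends the corner to the cell b0 of the column
   that y has not reached from there, and fixes the rest of the first row. *)
pose c x := if x \notin A then y x else if x == o0 then b0 else x.
have c_inj : injective c.
  have yb x : x \notin A -> y x <> b0.
    by move=> Ax E; move: yb0; rewrite -E imset_f // inE.
  move=> i j; rewrite /c; case Ai: (i \in A); case Aj: (j \in A) => /=.
  - case: eqP => [->|ni]; case: eqP => [->|nj] //= E.
      by case: nj; apply: A_B => //; rewrite -E.
    by case: ni; apply: A_B => //; rewrite E.
  - case: eqP => [->|ni] E; first by case: (yb j); rewrite ?Aj.
    by case: ni; apply: A_B => //; rewrite E yB ?Aj.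
  - case: eqP => [->|nj] E; first by case: (yb i); rewrite ?Ai.
    by case: nj; apply: A_B => //; rewrite -E yB ?Ai.
  - by move/perm_inj.
have Cc : perm c_inj \in C.
  apply: C_mem => x Bx; rewrite permE /c.
  have -> : x \in A by move: Bx; rewrite !inE; lia.
  by case: eqP => //= E; move: Bx; rewrite E inE.
rewrite -[y](mulgKV (perm c_inj)); apply: mem_mulg => //.
apply: R_mem => x Ax; rewrite permM.
by apply: (canLR (permK (perm c_inj))); rewrite permE /c Ax.
Qed.

Let Res_lam c : c \in C -> (c \in stab B) && (sgn_on B c == c).
Proof.
move=> Cc; have st : c \in stab B by apply/stabP => x; rewrite C_B.
rewrite st /sgn_on; have -> : restr_perm B c = c.
  apply/permP => x; case Bx: (x \in B); first by rewrite restr_permE.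
  by rewrite (out_perm (restr_perm_on _ _)) ?Bx // C_out ?Bx.
by rewrite eqxx.
Qed.

Let C_sub : C \subset stab B.
Proof. by apply/subsetP => c /Res_lam /andP[]. Qed.

(** The sign of C is the restriction of [lam B]. Inducing it to [stab B] gives [lam B] times a
    permutation character, which contains the trivial character. *)
Let psi_sub_col : exists2 X : 'CF(G), X \is a character & 'Ind[G] (cfSign C) = psi B + X.
Proof.
have E : cfSign C = 'Res[C] (lam B).
  apply/cfunP => c; rewrite (cfSign_sign (@fiber_stab_oddM n (hook_col a))) sign_cfE.
  case: ifP => Cc; last by rewrite cfun0 ?Cc.
  by have /andP[sc /eqP sg] := Res_lam Cc; rewrite cfResE // lamE sc sg.
have N1 : 'Ind[stab B] (1 : 'CF(C)) \is a character by rewrite cfInd_char ?rpred1.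
have : (0 : Iirr (stab B)) \in irr_constt ('Ind[stab B] (1 : 'CF(C))).
  by rewrite irr_consttE irr0 -cfdot_Res_r cfRes_cfun1 ?cfnorm1 ?oner_eq0.
case/(constt_charP _ N1) => chi Nchi E1.
exists ('Ind[G] (chi * lam B)).
  by rewrite cfInd_char // rpredM // sign_cf_char.
rewrite -(cfIndInd _ (subsetT (stab B)) C_sub).
rewrite -[cfSign C]mul1r E cfIndM // E1 irr0 mulrDl mul1r.
by rewrite linearD.
Qed.

(** An element of the row group stabilizing B fixes B pointwise, since A and B share only the
    corner; so both signs are trivial on the intersection. *)
Let psi_row : '[psi B, 'Ind[G] (1 : 'CF(R))] != 0.
Proof.
rewrite -(cf1_sign (@fiber_stab1M n (hook_row a))).
apply: cfdot_ind_sign_neq0; rewrite ?subsetT // => t Rt st.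
rewrite /sgn_on; have -> : restr_perm B t = 1%g; last by rewrite odd_perm1.
apply/permP => x; rewrite perm1; case Bx: (x \in B); last first.
  by rewrite (out_perm (restr_perm_on _ _)) ?Bx.
rewrite restr_permE //; case Ax: (x \in A); last by rewrite R_out ?Ax.
rewrite (A_B Ax Bx); apply: A_B; rewrite ?R_A -?(A_B Ax Bx) //.
by move/stabP: st => ->.
Qed.

Let R1 := 'Ind[G] (1 : 'CF(R)).
Let SC := 'Ind[G] (cfSign C).

Let R1_char : R1 \is a character.
Proof. by rewrite cfInd_char ?rpred1. Qed.

Let SC_char : SC \is a character.
Proof. by rewrite cfInd_char // (cfSign_sign (@fiber_stab_oddM n (hook_col a))) sign_cf_char. Qed.

Let dot_le1 : '[SC, R1] <= 1.
Proof.
rewrite /SC /R1 -(cf1_sign (@fiber_stab1M n (hook_row a))).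
rewrite (cfSign_sign (@fiber_stab_oddM n (hook_col a))).
by apply: cfdot_ind_sign_le1; rewrite ?subsetT ?R_C // => y _; apply: exchange_or_product.
Qed.

Let nat_ge1 (x : algC) : x \in Num.nat -> x != 0 -> 1 <= x.
Proof. by move=> /natrP[k ->]; rewrite pnatr_eq0 -lt0n ler1n. Qed.

Lemma hook_common_exists : exists i, (i \in irr_constt R1) && (i \in irr_constt SC).
Proof.
have [X NX E] := psi_sub_col.
have := psi_row; rewrite cfdot_char_r // => nz.
have [/existsP[i /andP[pi ri]]|] := boolP [exists i, ('[psi B, 'chi_i] != 0) && ('[R1, 'chi_i] != 0)].
  exists i; rewrite !irr_consttE ri /SC E cfdotDl.
  by rewrite paddr_eq0 ?natr_ge0 ?Cnat_cfdot_char_irr ?psi_char // negb_and pi.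
rewrite negb_exists => /forallP no; case/eqP: nz; apply: big1 => i _.
by have := no i; rewrite negb_and !negbK => /orP[]/eqP ->; rewrite ?mul0r ?mulr0.
Qed.

(** The row and column characters pair to at most 1, so i is their only common constituent. As
    [psi B] lies inside the column character and meets the row character, it contains i, and no more
    often than the column character does, which is once. *)
Lemma hook_common_mult i :
  i \in irr_constt R1 -> i \in irr_constt SC -> '[psi (low_set n b.+1), 'chi_i] = 1.
Proof.
rewrite !irr_consttE => ri si.
have -> : psi (low_set n b.+1) = psi B.
  by apply: psi_card; rewrite card_B card_low_set // nE ltnS leq_addl.
have [X NX E] := psi_sub_col.
have := dot_le1; rewrite cfdot_char_r // => le1.
have N1 j : '[SC, 'chi_j] \in Num.nat by apply: Cnat_cfdot_char_irr.
have N2 j : '[R1, 'chi_j] \in Num.nat by apply: Cnat_cfdot_char_irr.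
have N3 j : '[psi B, 'chi_j] \in Num.nat by apply: Cnat_cfdot_char_irr; apply: psi_char.
have N4 j : '[X, 'chi_j] \in Num.nat by apply: Cnat_cfdot_char_irr.
have ge0 j : 0 <= '[SC, 'chi_j] * '[R1, 'chi_j] by rewrite mulr_ge0 ?natr_ge0.
have ge1 : 1 <= '[SC, 'chi_i] * '[R1, 'chi_i].
  by apply: nat_ge1; [rewrite rpredM | rewrite mulf_neq0].
have other j : j != i -> '[psi B, 'chi_j] * '[R1, 'chi_j] = 0.
  move=> ji; suff : '[SC, 'chi_j] * '[R1, 'chi_j] = 0.
    move/eqP; rewrite mulf_eq0 => /orP[/eqP s0|/eqP ->]; last by rewrite mulr0.
    move: s0; rewrite /SC E cfdotDl => /eqP; rewrite paddr_eq0 ?natr_ge0 //.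
    by case/andP => /eqP -> _; rewrite mul0r.
  apply/eqP; rewrite eq_le ge0 andbT.
  move: le1; rewrite (bigD1 i) //= (bigD1 j) //=.
  set S := \sum_(_ | _) _ => le1; have S0 : 0 <= S by apply: sumr_ge0.
  have : '[SC, 'chi_i] * '[R1, 'chi_i] + '[SC, 'chi_j] * '[R1, 'chi_j] <= 1.
    by apply: le_trans le1; rewrite addrA lerDl.
  by move=> h; rewrite -(lerD2l 1) addr0; apply: le_trans h; rewrite lerD2r.
have p0 : '[psi B, 'chi_i] != 0.
  have := psi_row; rewrite cfdot_char_r // (bigD1 i) //= big1 ?addr0 //.
  by rewrite mulf_eq0 negb_or => /andP[].
have SC1 : '[SC, 'chi_i] <= 1.
  apply: le_trans (_ : '[SC, 'chi_i] * '[R1, 'chi_i] <= 1).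
    by rewrite ler_peMr ?natr_ge0 // nat_ge1.
  by apply: le_trans le1; rewrite (bigD1 i) //= lerDl sumr_ge0.
apply/eqP; rewrite eq_le nat_ge1 // andbT.
by apply: le_trans SC1; rewrite /SC E cfdotDl lerDl natr_ge0.
Qed.

End HookGroups.

Lemma cycle_type_full n (s : 'S_n) : (0 < n)%N ->
  (cycle_type s == [:: n]) = transitive_perm s.
Proof.
move=> n0; apply/eqP/forallP => [E x|tr].
  rewrite eqEcard subsetT cardsT card_ord.
  have : #|porbit s x| \in cycle_type s.
    by rewrite mem_sort; apply/mapP; exists (porbit s x); rewrite // mem_enum imset_f.
  by rewrite E inE => /eqP -> /=.
rewrite /cycle_type; have -> : porbits s = [set [set: 'I_n]].
  apply/setP => X; rewrite inE; apply/imsetP/eqP => [[x _ ->]|->].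
    by apply/eqP; apply: tr.
  by exists (Ordinal n0); rewrite // (eqP (tr _)).
by rewrite enum_set1 /= cardsT card_ord.
Qed.

Lemma fiber_stab_ext n (f g : nat -> nat) :
  (forall i, (i < n)%N -> f i = g i) -> fiber_stab n f = fiber_stab n g.
Proof.
move=> fg; apply/group_inj/setP => s.
apply/fiber_stabP/fiber_stabP => h i; first by rewrite -!fg //; exact: h.
by rewrite !fg //; exact: h.
Qed.

Definition hook (a b : nat) : seq nat := a.+1 :: nseq b 1%N.

Lemma sumn_hook a b : sumn (hook a b) = (a + b).+1.
Proof. by rewrite /= sumn_nseq mul1n addSn. Qed.

Lemma flatten_index_hook a b i : (i < (a + b).+1)%N ->
  i = flatten_index (hook a b) (hook_row a i) (hook_col a i) /\
  (hook_col a i < nth 0 (hook a b) (hook_row a i))%N.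
Proof.
rewrite /hook_row /hook_col /flatten_index => ib; case: (leqP i a) => ia /=; first by split; rewrite ?ltnS.
case E: (i - a)%N => [|r]; first by lia.
rewrite /= take_nseq ?sumn_nseq ?nth_nseq; last by lia.
by split; [lia | case: (ltnP r b) => /= ?; lia].
Qed.

Lemma row_group_hook a b :
  row_group (hook a b) = fiber_stab (sumn (hook a b)) (hook_row a).
Proof.
apply: fiber_stab_ext => i; rewrite sumn_hook => /flatten_index_hook[E lt].
by rewrite {1}E flatten_indexKl.
Qed.

Lemma col_group_hook a b :
  col_group (hook a b) = fiber_stab (sumn (hook a b)) (hook_col a).
Proof.
apply: fiber_stab_ext => i; rewrite sumn_hook => /flatten_index_hook[E lt].
by rewrite {1}E flatten_indexKr.
Qed.

(** * Exterior degrees of a constituent and its value at n-cycles *)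

Section Support.

Variables (n r c : nat) (f h : nat -> nat) (i : Iirr [set: 'S_n]).
Hypothesis n_gt0 : (0 < n)%N.
Hypothesis fr : forall j : 'I_n, (f j < r)%N.
Hypothesis hc : forall j : 'I_n, (h j < c)%N.
Hypothesis i_row : i \in irr_constt ('Ind[[set: 'S_n]] (1 : 'CF(fiber_stab n f))).
Hypothesis i_col : i \in irr_constt ('Ind[[set: 'S_n]] (cfSign (fiber_stab n h))).

Let m j := '[psi (low_set n j), 'chi_i].

Let cfdot0_constt (j : nat) (phi : 'CF([set: 'S_n]%G)) : phi \is a character ->
  i \in irr_constt phi -> '[psi (low_set n j), phi] = 0 -> m j = 0.
Proof.
move=> Nphi; rewrite irr_consttE => phi0; rewrite cfdot_char_r // => /psumr_eq0P E.
have /eqP := E (fun k _ => mulr_ge0 (natr_ge0 (Cnat_cfdot_char_irr k (psi_char _)))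
  (natr_ge0 (Cnat_cfdot_char_irr k Nphi))) i isT.
by rewrite mulf_eq0 (negbTE phi0) orbF => /eqP.
Qed.

(** The window n - c <= j <= r holds two degrees when r + c = n + 1, the case of a hook, and at most
    one when r + c <= n. *)
Lemma psi_mult_support j : (j <= n)%N -> m j != 0 -> (j <= r)%N && (n <= j + c)%N.
Proof.
move=> jn mj; apply/andP; split; rewrite leqNgt; apply: contraNN mj => lt; apply/eqP.
  apply: cfdot0_constt i_row _; first by rewrite cfInd_char ?rpred1.
  by apply: (psi_row0 fr); rewrite card_low_set.
apply: cfdot0_constt i_col _.
  by rewrite cfInd_char // (cfSign_sign (@fiber_stab_oddM n h)) sign_cf_char.
apply: (psi_col0 hc).
by have := cardsC (low_set n j); rewrite card_ord card_low_set //; lia.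
Qed.

Lemma chi_nonhook_cycle s : (r + c <= n)%N -> transitive_perm s -> 'chi_i s = 0.
Proof.
move=> rc trs; apply: (fmorph_inj Num.conj); rewrite /= rmorph0.
rewrite (chi_at_cycle n_gt0) //; apply: (@alt_sum_one_term _ n r m).
- by apply: leq_trans rc; apply: leq_addr.
- by move=> j jn /psi_mult_support => /(_ jn); lia.
- exact: psi_alt_dot.
Qed.

Lemma chi_hook_cycle b s : r = b.+1 -> (r + c = n.+1)%N ->
  '[psi (low_set n b.+1), 'chi_i] = 1 ->
  (b < n)%N -> transitive_perm s -> 'chi_i s = (-1) ^+ b.
Proof.
move=> rb rc m1 bn trs; apply: (fmorph_inj Num.conj).
rewrite rmorphXn /= rmorphN rmorph1 (chi_at_cycle n_gt0) //.
have [|->] := @alt_sum_two_terms _ n b m bn _ (psi_alt_dot n_gt0 'chi_i).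
  by move=> j jn /psi_mult_support => /(_ jn); lia.
by rewrite /m m1 mulr1.
Qed.

End Support.

Lemma sym_char_hook a b : sym_char (hook a b) [:: (a + b).+1] = (-1) ^+ b.
Proof.
rewrite /sym_char; set n := sumn _.
have nE : n = (a + b).+1 := sumn_hook a b.
have n0 : (0 < n)%N by rewrite nE.
case: pickP => [i|no]; last first.
  have [i /andP[ri ci]] := hook_common_exists nE.
  by have := no i; rewrite /is_sym_irr row_group_hook col_group_hook ri ci.
rewrite /is_sym_irr row_group_hook col_group_hook => /andP[ri ci].
case: pickP => [s|no]; last first.
  have [c trc] := exists_transitive_perm n0.
  by have := no c; rewrite -nE cycle_type_full // trc.
rewrite -nE cycle_type_full // => trs.
apply: (@chi_hook_cycle n b.+1 a.+1 (hook_row a) (hook_col a) i) => //.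
- by move=> j; have := ltn_ord j; rewrite /hook_row; case: (leqP j a) => //= ?; lia.
- by move=> j; rewrite /hook_col; case: (leqP j a) => //= ?; lia.
- by rewrite nE; lia.
- exact: (hook_common_mult nE ri ci).
- by rewrite nE; lia.
Qed.

Lemma partition_nth_le mu j : is_partition mu -> (nth 0%N mu j <= head 0%N mu)%N.
Proof.
case: mu => [|x mu] /andP[so _]; first by rewrite nth_nil.
case: j => [|j] //=; have [jm|jm] := ltnP j (size mu); last by rewrite nth_default.
have geq_tr : transitive geq by move=> p q u /= h1 h2; exact: leq_trans h2 h1.
move: so; rewrite /= (path_sortedE geq_tr) => /andP[/allP h _].
exact: (h _ (mem_nth 0%N jm)).
Qed.

Lemma sym_char_nonhook mu : is_partition mu -> (0 < sumn mu)%N ->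
  (size mu + head 0 mu <= sumn mu)%N -> sym_char mu [:: sumn mu] = 0.
Proof.
move=> pm n0 le; rewrite /sym_char.
case: pickP => [i|//]; rewrite /is_sym_irr => /andP[ri ci].
case: pickP => [s|//]; rewrite cycle_type_full // => trs.
apply: (chi_nonhook_cycle n0 _ _ ri ci le) => // j.
  exact: reshape_indexP.
by apply: leq_trans (reshape_offsetP (ltn_ord j)) _; apply: partition_nth_le.
Qed.

Lemma sym_char0 : sym_char [::] [::] = 1.
Proof.
rewrite /sym_char /=.
have tr (s : 'S_0) : s = 1%g by apply/permP => -[].
have trG : [set: 'S_0] = 1%g by apply/setP => s; rewrite !inE (tr s) eqxx.
have chi1 (i : Iirr [set: 'S_0]) (s : 'S_0) : 'chi_i s = 1.
  have : 'chi_i \is a linear_char.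
    have ab : abelian [set: 'S_0] by rewrite trG abelian1.
    exact: (char_abelianP _ ab i).
  by move/lin_char1; rewrite (tr s).
case: pickP => [i _|no].
  case: pickP => [s _|no']; first exact: chi1.
  have := no' 1%g; rewrite /cycle_type.
  have -> : porbits (1%g : 'S_0) = set0 by apply/setP => X; rewrite inE; apply/imsetP => -[[]].
  by rewrite enum_set0.
have := no 0; rewrite /is_sym_irr.
have eG (M : {group 'S_0}) : M = [set: 'S_0]%G.
  by apply/group_inj/setP => s; rewrite (tr s) !group1.
have E1 (M : {group 'S_0}) (phi : 'CF(M)) : phi 1%g = 1 -> 'Ind[[set: 'S_0]] phi = 1.
  move: phi; rewrite (eG M) => phi phi1; rewrite cfInd_id; apply/cfunP => s.
  by rewrite (tr s) cfun1E phi1 inE.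
rewrite !irr_consttE irr0 !E1 ?cfnorm1 ?oner_eq0 //.
  by rewrite (cfSign_sign (@fiber_stab_oddM _ _)) sign_cfE group1 odd_perm1.
by rewrite cfun1E group1.
Qed.

(** * Partitions as decreasing sequences *)

Lemma sum_ord_extend (V : nmodType) (f : nat -> V) m n : (m <= n)%N ->
  (forall k, (m <= k < n)%N -> f k = 0) -> \sum_(k < n) f k = \sum_(k < m) f k.
Proof.
move=> mn f0; rewrite -!(big_mkord xpredT) (big_cat_nat (leq0n m) mn) /=.
by rewrite [X in _ + X]big_nat [X in _ + X]big1 ?addr0 // => k /f0.
Qed.

Lemma geq_transitive : transitive geq.
Proof. by move=> p q u /= h1 h2; exact: leq_trans h2 h1. Qed.

(** The zeros of a decreasing sequence form a tail, and [nth] returns 0 past the end anyway. *)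
Lemma nth_filter_sorted (s : seq nat) i : sorted geq s ->
  nth 0%N [seq x <- s | x != 0%N] i = nth 0%N s i.
Proof.
elim: s i => [|x s IH] i //= so.
have so' := path_sorted so.
case: eqVneq => [x0|_] /=; last by case: i => //= i; apply: IH.
move: so; rewrite (path_sortedE geq_transitive) x0 => /andP[/allP s0 _].
have -> : [seq y <- s | y != 0%N] = [::].
  apply/eqP; rewrite -(negbK (_ == _)) -has_filter; apply/hasPn => y /s0.
  by rewrite /= leqn0 negbK.
rewrite nth_nil; case: i => [|i] //=; have [ism|ism] := ltnP i (size s).
  by have := s0 _ (mem_nth 0%N ism); rewrite /= leqn0 => /eqP.
by rewrite nth_default.
Qed.

Lemma part_nth_gt0 mu i : is_partition mu -> (0 < nth 0%N mu i)%N = (i < size mu)%N.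
Proof.
move=> /andP[_ n0]; case: (ltnP i (size mu)) => im; last by rewrite nth_default.
by rewrite lt0n; apply: contraNneq n0 => <-; apply: mem_nth.
Qed.

Lemma part_eq mu nu : is_partition mu -> is_partition nu ->
  nth 0%N mu =1 nth 0%N nu -> mu = nu.
Proof.
move=> pm pn E; apply: (@eq_from_nth _ 0%N) => [|i _]; last exact: E.
have lt i : (i < size mu)%N = (i < size nu)%N.
  by rewrite -!part_nth_gt0 // E.
by case: (ltngtP (size mu) (size nu)) => // h;
  [have := lt (size mu) | have := lt (size nu)]; rewrite ltnn h.
Qed.

Lemma part_nth_decr mu i j : is_partition mu -> (i <= j)%N ->
  (nth 0%N mu j <= nth 0%N mu i)%N.
Proof.
move=> /andP[so _] ij; have [jm|jm] := ltnP j (size mu); last by rewrite (nth_default _ jm).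
have := sorted_leq_nth geq_transitive (fun x => leqnn x) 0%N so.
by move=> /(_ i j); rewrite !inE; apply => //; apply: leq_ltn_trans jm.
Qed.

Lemma sumn_nth_le (s : seq nat) N : (size s <= N)%N -> sumn s = (\sum_(i < N) nth 0%N s i)%N.
Proof.
elim: s N => [|x s IH] N; first by rewrite big1 // => i _; rewrite nth_nil.
by case: N => // N /IH sN; rewrite big_ord_recl /= sN.
Qed.

Lemma part_of_fun (f : nat -> nat) N :
  (forall i j, (i <= j < N)%N -> (f j <= f i)%N) ->
  exists nu, [/\ is_partition nu, (size nu <= N)%N &
    forall i, (i < N)%N -> nth 0%N nu i = f i].
Proof.
move=> fd; exists [seq x <- mkseq f N | x != 0%N].
have so : sorted geq (mkseq f N).
  apply/(sortedP 0%N) => i; rewrite size_mkseq => iN.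
  by rewrite !nth_mkseq ?(ltnW iN) //=; apply: fd; rewrite leqnSn.
split.
- rewrite /is_partition sorted_filter //=; last exact: geq_transitive.
  by rewrite mem_filter eqxx.
- by rewrite size_filter (leq_trans (count_size _ _)) // size_mkseq.
- by move=> i iN; rewrite nth_filter_sorted // nth_mkseq.
Qed.

Lemma parts_uniq n : uniq (parts n).
Proof.
rewrite /parts map_inj_in_uniq; first exact: filter_uniq (enum_uniq _).
move=> s t; rewrite !mem_filter => /andP[/andP[ss _] _] /andP[/andP[st _] _].
have E (u : n.-tuple 'I_n.+1) : [seq val i | i <- tval u & val i != 0%N] =
    [seq x <- map val u | x != 0%N] by rewrite filter_map.
rewrite !E => /(congr1 (nth 0%N)) nn; apply/val_inj/(inj_map val_inj).
apply: (@eq_from_nth _ 0%N) => [|i _]; first by rewrite !size_map !size_tuple.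
by rewrite -!(nth_filter_sorted _ ss, nth_filter_sorted _ st) nn.
Qed.

(** * Jacobi-Trudi and dual Cauchy identities *)

Section JacobiTrudiDet.

Variable R : comNzRingType.
Implicit Types (f : nat -> R) (nu : seq nat).

(** The guard encodes f_r = 0 for r < 0 in the determinant of the f_(nu_i - i + j). The sequence f
    is arbitrary: it will be h_r, e_r, or the rational functions to which these converge. *)
Definition jt_entry f nu i j : R :=
  if (i <= nth 0%N nu i + j)%N then f (nth 0%N nu i + j - i)%N else 0.

Definition jt_det f nu l : R := \det (\matrix_(i < l, j < l) jt_entry f nu i j).

(** The only nonzero entry of the added row is f_0 = 1, on the diagonal. *)
Lemma jt_det_succ f nu l : f 0%N = 1 -> (size nu <= l)%N ->
  jt_det f nu l.+1 = jt_det f nu l.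
Proof.
move=> f0 nl; rewrite /jt_det (expand_det_row _ ord_max) (bigD1 ord_max) //=.
rewrite big1 ?addr0 => [|j jl]; last first.
  rewrite mxE /jt_entry nth_default // leqNgt add0n ltn_neqAle -ltnS ltn_ord andbT.
  by rewrite jl mul0r.
rewrite mxE /jt_entry nth_default // add0n leqnn subnn f0 mul1r.
rewrite /cofactor -signr_odd oddD addbb mul1r; congr (\det _).
by apply/matrixP => i j; rewrite !mxE !lift_max.
Qed.

Lemma jt_det_size f nu l : f 0%N = 1 -> (size nu <= l)%N ->
  jt_det f nu l = jt_det f nu (size nu).
Proof.
move=> f0 nl; rewrite -(subnK nl); elim: (l - _)%N => // m IH.
by rewrite addSn jt_det_succ ?leq_addl.
Qed.

Lemma jt_det_nil f l : f 0%N = 1 -> jt_det f [::] l = 1.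
Proof. by move=> f0; rewrite jt_det_size //= /jt_det det_mx00. Qed.

Lemma det_rev_ord n (A : 'I_n -> 'I_n -> R) :
  \det (\matrix_(i, j) A (rev_ord i) (rev_ord j)) = \det (\matrix_(i, j) A i j).
Proof.
pose s := perm (@rev_ord_inj n).
have -> : \matrix_(i, j) A (rev_ord i) (rev_ord j) =
          row_perm s (col_perm s (\matrix_(i, j) A i j)).
  by apply/matrixP => i j; rewrite !mxE !permE.
rewrite row_permE col_permE !det_mulmx !det_perm odd_permV mulrCA mulrC.
by rewrite -signr_addb addbb mul1r.
Qed.

End JacobiTrudiDet.

Section CoefCongruence.

Variable R : comNzRingType.
Implicit Types p q : {poly R}.

(** Congruence modulo X^K, which lets truncated polynomials stand for power series. *)
Definition eq_upto K p q := forall i, (i < K)%N -> p`_i = q`_i.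

Lemma eq_upto_mul K p p' q q' :
  eq_upto K p p' -> eq_upto K q q' -> eq_upto K (p * q) (p' * q').
Proof.
move=> pp qq i iK; rewrite !coefM; apply: eq_bigr => j _.
have ji : (j <= i)%N by rewrite -ltnS.
by rewrite pp ?qq // (leq_ltn_trans _ iK) // leq_subr.
Qed.

Lemma eq_upto_prod K (I : Type) (r : seq I) (P : pred I) (p q : I -> {poly R}) :
  (forall i, P i -> eq_upto K (p i) (q i)) ->
  eq_upto K (\prod_(i <- r | P i) p i) (\prod_(i <- r | P i) q i).
Proof. by move=> pq; elim/big_rec2: _ => // i p' q' Pi; apply: eq_upto_mul; apply: pq. Qed.

Lemma eq_upto_trans K p q s : eq_upto K p q -> eq_upto K q s -> eq_upto K p s.
Proof. by move=> pq qs i iK; rewrite pq ?qs. Qed.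

Lemma eq_upto_sym K p q : eq_upto K p q -> eq_upto K q p.
Proof. by move=> pq i iK; rewrite pq. Qed.

Definition geom (x : R) K : {poly R} := \poly_(r < K) x ^+ r.

Lemma geomP x K : eq_upto K ((1 - x *: 'X) * geom x K) 1.
Proof.
move=> i iK; rewrite mulrBl mul1r -scalerAl coefB coefZ coefXM !coef_poly iK coef1.
case: i iK => [|i] iK /=; first by rewrite mulr0 subr0 expr0.
by rewrite (ltnW iK) exprS subrr.
Qed.

Lemma geom_upto x K K' : (K' <= K)%N -> eq_upto K' (geom x K) (geom x K').
Proof. by move=> KK i iK; rewrite !coef_poly iK (leq_trans iK KK). Qed.

Definition hpoly (x : nat -> R) N K : {poly R} := \prod_(i < N) geom (x i) K.
(* h_r(x_0, ..., x_(N-1)) *)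
Definition hsym (x : nat -> R) N r : R := (hpoly x N r.+1)`_r.

Lemma coef_hpoly x N K r : (r < K)%N -> (hpoly x N K)`_r = hsym x N r.
Proof.
move=> rK; rewrite /hsym; apply: (@eq_upto_prod r.+1) => // i _.
exact: geom_upto.
Qed.

Lemma hsym0 x N : hsym x N 0 = 1.
Proof.
rewrite /hsym /hpoly; elim: N => [|N IH]; first by rewrite big_ord0 coef1.
by rewrite big_ord_recr /= coef0M IH coef_poly /= mul1r.
Qed.

End CoefCongruence.

Section JacobiTrudi.

Variables (x : nat -> algC) (N : nat).
Hypothesis x_inj : forall i j, (i < N)%N -> (j < N)%N -> x i = x j -> i = j.

Definition alternant nu : algC :=
  \det (\matrix_(i < N, j < N) x i ^+ (nth 0%N nu j + (N - j.+1))).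

Lemma alternant_nil_neq0 : alternant [::] != 0.
Proof.
pose s := perm (@rev_ord_inj N).
rewrite /alternant -det_tr.
have -> : (\matrix_(i < N, j < N) x i ^+ (nth 0%N [::] j + (N - j.+1)))^T =
          row_perm s (Vandermonde N (\row_(j < N) x j)).
  by apply/matrixP => i j; rewrite !mxE permE nth_nil.
rewrite row_permE det_mulmx det_perm mulf_neq0 ?signr_eq0 // det_Vandermonde.
apply/prodf_neq0 => i _; apply/prodf_neq0 => j ij; rewrite !mxE subr_eq0.
by apply: contraTneq ij => /x_inj -> //; rewrite ltnn.
Qed.

(** Macdonald's argument. With p the product of the 1 - x_m X over m != i and H the series of the
    h_r, p H = 1 / (1 - x_i X), so x_i^L is the sum of the p_k h_(L-k). The alternant is thus a
    determinant free of nu times the Jacobi-Trudi determinant, and the empty partition identifies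
    the first factor. *)
Lemma alternant_jt nu : alternant nu = alternant [::] * jt_det (hsym x N) nu N.
Proof.
pose M := \matrix_(i < N, k < N)
  (\prod_(m < N | m != i) (1 - x m *: 'X))`_(N - k.+1).
have main mu : alternant mu = \det M * jt_det (hsym x N) mu N.
  rewrite /alternant /jt_det -[X in _ * X]det_tr -det_mulmx; congr (\det _).
  apply/matrixP => i j; rewrite !mxE.
  pose p := \prod_(m < N | m != i) (1 - x m *: 'X).
  set L := (nth 0%N mu j + (N - j.+1))%N.
  have szp : (size p <= N)%N.
    rewrite /p (leq_trans (size_poly_prod_leq _ _)) // leq_subLR.
    have -> : #|(fun m : 'I_N => m != i)| = N.-1.
      by have := cardC1 i; rewrite card_ord.
    apply: leq_trans (_ : (\sum_(m < N | m != i) 2).+1 <= _)%N.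
      rewrite ltnS; apply: leq_sum => m _.
      apply: leq_trans (size_polyD _ _) _; rewrite size_poly1 size_polyN geq_max /=.
      by apply: leq_trans (size_scale_leq _ _) _; rewrite size_polyX.
    rewrite sum_nat_const; have := cardC1 i; rewrite card_ord => ->.
    by have := ltn_ord i; lia.
  have key : eq_upto L.+1 (p * hpoly x N L.+1) (geom (x i) L.+1).
    rewrite /hpoly (bigD1 i) //= mulrCA -big_split /= -[X in eq_upto _ _ X]mulr1.
    apply: eq_upto_mul => //.
    apply: (@eq_upto_trans _ _ _ (\prod_(m < N | m != i) 1)); last by rewrite big1.
    by apply: eq_upto_prod => m _; apply: geomP.
  have := key L (ltnSn L); rewrite coef_poly ltnSn => <-.
  pose G k := if (k <= L)%N then p`_k * hsym x N (L - k) else 0.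
  have -> : (p * hpoly x N L.+1)`_L = \sum_(k < L.+1) G k.
    rewrite coefM; apply: eq_bigr => k _; have kL : (k <= L)%N by rewrite -ltnS.
    by rewrite /G kL coef_hpoly // ltnS leq_subr.
  rewrite [RHS](reindex_inj rev_ord_inj) /=.
  (* The convolution stops at L and the matrix product at N - 1. Both extend to the larger range: G
     vanishes beyond L by its guard, and from N on because p has degree below N. *)
  transitivity (\sum_(k < maxn N L.+1) G k).
    apply/esym/sum_ord_extend; first exact: leq_maxr.
    by move=> k /andP[kL _]; rewrite /G leqNgt kL.
  rewrite (@sum_ord_extend _ _ N); first last.
  - move=> k /andP[kN _]; rewrite /G [p`_k]nth_default ?mul0r ?if_same //.
    exact: leq_trans szp kN.
  - exact: leq_maxl.
  apply: eq_bigr => k _; rewrite !mxE /= /jt_entry /G -/p.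
  have kN := ltn_ord k; have jN := ltn_ord j.
  have -> : (N - (N - k.+1).+1 = k)%N by lia.
  have -> : (j <= nth 0 mu j + (N - k.+1))%N = (k <= L)%N by rewrite /L; lia.
  case: ifP => kL; last by rewrite mulr0.
  by congr (_ * hsym x N _); rewrite /L; lia.
have := main [::]; rewrite jt_det_nil ?hsym0 // mulr1 => ->; exact: main.
Qed.

End JacobiTrudi.

Section Cauchy.

Variables (x : nat -> algC) (N : nat).
Hypothesis x_inj : forall i j, (i < N)%N -> (j < N)%N -> x i = x j -> i = j.

Lemma schur_poly_alternant nu : (size nu <= N)%N ->
  schur_poly N nu x = alternant x N nu / alternant x N [::].
Proof.
move=> nN; rewrite /schur_poly nN; congr (_ / \det _).
by apply/matrixP => i j; rewrite !mxE nth_nil.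
Qed.

Lemma schur_poly_jt nu : (size nu <= N)%N ->
  schur_poly N nu x = jt_det (hsym x N) nu (size nu).
Proof.
move=> nN; rewrite schur_poly_alternant // alternant_jt // mulrC mulKf.
  by rewrite jt_det_size ?hsym0.
exact: alternant_nil_neq0.
Qed.

Variables (k : nat) (e : nat -> algC).

Local Notation gfun := {ffun 'I_N -> 'I_k.+1}.
Implicit Types (g : gfun) (nu : seq nat) (tau : 'S_N).

Let expo g (j : 'I_N) : nat := (g j + (N - j.+1))%N.
(** The contribution of a choice g of one exponent per factor, once the Vandermonde alternant is
    multiplied in; its determinant is an alternant up to the order of the columns. *)
Let Phi g : algC :=
  \prod_(j < N) e (g j) * \det (\matrix_(i < N, j < N) x i ^+ expo g j).
Let total g : nat := \sum_(j < N) g j.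

Let expand : alternant x N [::] *
    (\prod_(i < N) \poly_(r < k.+1) (e r * x i ^+ r))`_k =
  \sum_(g | total g == k) Phi g.
Proof.
under eq_bigr do rewrite poly_def.
rewrite bigA_distr_bigA coef_sum /=.
have -> : \sum_(f : gfun) (\prod_(i < N) ((e (f i) * x i ^+ f i) *: 'X^(f i)))`_k =
    \sum_(f : gfun | total f == k) \prod_(i < N) (e (f i) * x i ^+ f i).
  rewrite [RHS]big_mkcond; apply: eq_bigr => f _.
  rewrite scaler_prod prodrXr coefZ coefXn eq_sym.
  by case: ifP => _; rewrite ?mulr1 ?mulr0.
rewrite /alternant /determinant mulr_suml.
under [RHS]eq_bigr do rewrite /Phi /determinant mulr_sumr.
rewrite [RHS]exchange_big /=; apply: eq_bigr => s _.
rewrite mulr_sumr (reindex (fun g : gfun => [ffun i => g (s i)] : gfun)) /=; last first.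
  exists (fun g : gfun => [ffun i => g (s^-1%g i)]) => g _; apply/ffunP => i;
  by rewrite !ffunE ?permK ?permKV.
apply: eq_big => [g|g _].
  congr (_ == k); rewrite /total [RHS](reindex_inj (@perm_inj _ s)).
  by apply: eq_bigr => i _; rewrite ffunE.
rewrite mulrCA -!mulrA; congr (_ * _).
rewrite [X in _ = X * _](reindex_inj (@perm_inj _ s)) -!big_split /=.
apply: eq_bigr => i _; rewrite !mxE ffunE /expo nth_nil add0n exprD; ring.
Qed.

Let Phi0 g : ~ injective (expo g) -> Phi g = 0.
Proof.
move=> ninj; have /injectiveP := ninj.
case/injectivePn => i [j nij eij]; rewrite /Phi -det_tr (determinant_alternate nij).
  by rewrite mulr0.
by move=> l; rewrite !mxE eij.
Qed.

(** The exponents of g, read in the order tau, are the strictly decreasing exponents nu_i + N - 1 -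
    i of an alternant. *)
Let rel g nu tau := [forall i : 'I_N, (g (tau i) + i == nth 0 nu i + tau i)%N].

Let rel_expo g nu tau i : rel g nu tau ->
  expo g (tau i) = (nth 0 nu i + (N - i.+1))%N.
Proof.
move/forallP/(_ i)/eqP; rewrite /expo.
by have := ltn_ord i; have := ltn_ord (tau i); lia.
Qed.

Let term nu tau : algC :=
  alternant x N nu * ((-1) ^+ tau * \prod_(i < N) jt_entry e nu i (tau i)).

(** A permutation tau in the Jacobi-Trudi determinant prescribes g(tau i) = nu_i + tau i - i:
    exactly one g, or none if some index is negative. The sign of tau is that of reordering the
    columns of the alternant. *)
Let term_sum nu tau : is_partition nu -> sumn nu = k -> (size nu <= N)%N ->
  term nu tau = \sum_(g | (total g == k) && rel g nu tau) Phi g.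
Proof.
move=> pn sk nN.
have [/forallP valid|] := boolP [forall i : 'I_N, (i <= nth 0 nu i + tau i)%N]; last first.
  rewrite negb_forall => /existsP[i /negbTE ni].
  rewrite /term (bigD1 i) //= {1}/jt_entry ni mul0r !mulr0 big1 // => g /andP[_].
  by move/forallP/(_ i)/eqP => E; move: ni; rewrite -E leq_addl.
pose v (i : 'I_N) := (nth 0 nu i + tau i - i)%N.
have sv : (\sum_i v i = k)%N.
  have : (\sum_i v i + \sum_(i < N) i = \sum_(i < N) (nth 0 nu i + tau i))%N.
    by rewrite -big_split; apply: eq_bigr => i _; rewrite /v /= subnK.
  rewrite big_split /= -(sumn_nth_le nN) sk.
  have -> : (\sum_(i < N) tau i = \sum_(i < N) i)%N.
    by rewrite [RHS](reindex_inj (@perm_inj _ tau)).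
  by move/eqP; rewrite eqn_add2r => /eqP.
have vk i : (v i < k.+1)%N by rewrite ltnS -sv (bigD1 i) //= leq_addr.
pose g0 : gfun := [ffun j => Ordinal (vk (tau^-1%g j))].
have g0E i : g0 (tau i) = v i :> nat by rewrite ffunE /= permK.
have rel0 : rel g0 nu tau by apply/forallP => i; rewrite g0E /v subnK.
rewrite (big_pred1 g0) => [|g]; last first.
  apply/andP/eqP => [[_ rg]|->]; last first.
    split=> //; rewrite -sv /total (reindex_inj (@perm_inj _ tau)) /=.
    by apply/eqP/eq_bigr => i _; rewrite g0E.
  apply/ffunP => j; apply/val_inj => /=; rewrite -[j](permKV tau).
  set i := (tau^-1)%g j; rewrite g0E /v.
  by move/forallP/(_ i)/eqP: rg => <-; rewrite addnK.
rewrite /term /Phi mulrC [X in X * _ = _]mulrC -mulrA; congr (_ * _).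
  rewrite [RHS](reindex_inj (@perm_inj _ tau)) /=; apply: eq_bigr => i _.
  by rewrite g0E /jt_entry valid.
have -> : \matrix_(i < N, j < N) x i ^+ expo g0 j =
   col_perm tau^-1%g (\matrix_(i < N, j < N) x i ^+ (nth 0%N nu j + (N - j.+1))).
  apply/matrixP => i j; rewrite !mxE -{1}[j](permKV tau) (rel_expo _ rel0).
  by [].
by rewrite col_permE det_mulmx det_perm mulrC !odd_permV.
Qed.

Let rel_sorted g nu tau : is_partition nu -> rel g nu tau ->
  sorted geq [seq expo g (tau i) | i <- enum 'I_N].
Proof.
move=> pn rg; have -> : [seq expo g (tau i) | i <- enum 'I_N] =
    [seq (nth 0 nu i + (N - i.+1))%N | i <- iota 0 N].
  rewrite -val_enum_ord -map_comp; apply: eq_map => i /=.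
  exact: (rel_expo i rg).
rewrite (homo_sorted (e := leq)) ?iota_sorted // => i j ij /=.
by apply: leq_add; [apply: part_nth_decr | lia].
Qed.

(** Sorting the distinct exponents and subtracting N - 1, ..., 0 produces the only possible
    partition, and the sorting permutation is the only tau. *)
Let count_rel g : injective (expo g) -> total g = k ->
  \sum_(nu <- parts k | (size nu <= N)%N) \sum_tau (rel g nu tau)%:R = 1 :> algC.
Proof.
move=> inj tg.
pose t := [tuple expo g j | j < N].
have /tuple_permP[tau st] : perm_eq (sort geq t) t by rewrite perm_sort.
pose m i := nth 0%N (sort geq t) i.
have mE (i : 'I_N) : m i = expo g (tau i).
  by rewrite /m st -(tnth_nth 0%N _ i) !tnth_mktuple.
have so : sorted geq (sort geq t) by apply: sort_sorted => p q; apply: leq_total.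
have szm : size (sort geq t) = N by rewrite size_sort size_tuple.
have m_lt i : (i.+1 < N)%N -> (m i.+1 < m i)%N.
  move=> iN; have iN' := ltnW iN; rewrite ltn_neqAle; apply/andP; split.
    rewrite (mE (Ordinal iN)) (mE (Ordinal iN')).
    apply/eqP => /inj/perm_inj/(congr1 val)/= E; lia.
  have := sorted_leq_nth geq_transitive (fun p => leqnn p) 0%N so.
  by move=> /(_ i i.+1); rewrite !inE szm; apply.
have gap i d : (i + d < N)%N -> (m (i + d) + d <= m i)%N.
  elim: d => [|d IH]; first by rewrite !addn0.
  by rewrite !addnS => h; have := IH (ltnW h); have := m_lt _ h; lia.
have low i : (i < N)%N -> (N - i.+1 <= m i)%N.
  by move=> iN; have := gap i (N - i.+1)%N; rewrite addnC; lia.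
have [nu0 [pn0 nN0 nuE]] : exists nu, [/\ is_partition nu, (size nu <= N)%N &
    forall i, (i < N)%N -> nth 0%N nu i = (m i - (N - i.+1))%N].
  apply: part_of_fun => i j /andP[ij jN].
  by have := gap i (j - i)%N; rewrite subnKC //; have := low _ jN; lia.
have rel0 : rel g nu0 tau.
  apply/forallP => i; rewrite nuE // mE.
  have := low i (ltn_ord i); rewrite mE /expo.
  by have := ltn_ord (tau i); have := ltn_ord i; lia.
have sn0 : sumn nu0 = k.
  have : (\sum_(i < N) (g (tau i) + i) = \sum_(i < N) (nth 0 nu0 i + tau i))%N.
    by apply: eq_bigr => i _; apply/eqP; move/forallP: rel0.
  rewrite !big_split /= -(sumn_nth_le nN0).
  have -> : (\sum_(i < N) tau i = \sum_(i < N) i)%N.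
    by rewrite [RHS](reindex_inj (@perm_inj _ tau)).
  have -> : (\sum_(i < N) g (tau i) = total g)%N.
    by rewrite /total [RHS](reindex_inj (@perm_inj _ tau)).
  by rewrite tg => /eqP; rewrite eqn_add2r => /eqP.
have uniq_rel nu tau' : is_partition nu -> (size nu <= N)%N -> rel g nu tau' ->
    tau' = tau /\ nu = nu0.
  move=> pn nN rg; have perm_enum (s : 'S_N) :
      perm_eq [seq expo g (s i) | i <- enum 'I_N] [seq expo g i | i <- enum 'I_N].
    have -> : [seq expo g (s i) | i <- enum 'I_N] = map (expo g) (map s (enum 'I_N)).
      exact: (map_comp (expo g) s).
    apply: perm_map; apply: uniq_perm; rewrite ?enum_uniq //.
      by rewrite map_inj_uniq ?enum_uniq //; exact: perm_inj.
    move=> j; rewrite mem_enum; apply/mapP; exists (s^-1%g j); rewrite ?mem_enum //.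
    by rewrite permKV.
  have E : [seq expo g (tau' i) | i <- enum 'I_N] = [seq expo g (tau i) | i <- enum 'I_N].
    apply: (sorted_eq geq_transitive); rewrite ?(rel_sorted pn rg) ?(rel_sorted pn0 rel0) //.
      by move=> p q /andP[/= h1 h2]; apply/eqP; rewrite eqn_leq h1 h2.
    by rewrite (perm_trans (perm_enum tau')) // perm_sym perm_enum.
  have tE : tau' = tau.
    apply/permP => i; have /eq_in_map/(_ i) := E; rewrite mem_enum => /(_ isT).
    by move/inj.
  split=> //; subst tau'; apply: part_eq => // i; have [iN|Ni] := ltnP i N.
    move/forallP/(_ (Ordinal iN))/eqP: rg; move/forallP/(_ (Ordinal iN))/eqP: rel0 => -> /=.
    by move/addIn.
  by rewrite !nth_default // ?(leq_trans nN Ni) // (leq_trans nN0 Ni).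
rewrite big_mkcond (bigD1_seq nu0) /= ?parts_uniq //; last by rewrite mem_parts pn0 sn0 eqxx.
rewrite nN0 (bigD1 tau) //= rel0 big1 ?addr0; last first.
  move=> tau' nt; case E: (rel g nu0 tau') => //.
  by have [tt _] := uniq_rel _ _ pn0 nN0 E; rewrite tt eqxx in nt.
rewrite big_seq_cond big1 ?addr0 // => nu; rewrite mem_parts => /andP[/andP[pn _] nn].
case: ifP => // nN; apply: big1 => tau' _; case E: (rel g nu tau') => //.
by have [_ tt] := uniq_rel _ _ pn nN E; rewrite tt eqxx in nn.
Qed.

(** After multiplication by the Vandermonde alternant both sides are sums of [Phi g]: terms with a
    repeated exponent vanish, and every other g arises from exactly one pair (nu, tau). With e_r in
    the determinant this is the dual Cauchy identity. *)
Lemma dual_cauchy_coef :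
  (\prod_(i < N) \poly_(r < k.+1) (e r * x i ^+ r))`_k =
  \sum_(nu <- parts k) schur_poly N nu x * jt_det e nu N.
Proof.
apply: (mulfI (alternant_nil_neq0 x_inj)); rewrite expand.
rewrite mulr_sumr [RHS](bigID (fun nu => size nu <= N)%N) /= [X in _ + X]big1 ?addr0; last first.
  by move=> nu /negbTE nN; rewrite /schur_poly nN mul0r mulr0.
have -> : \sum_(nu <- parts k | (size nu <= N)%N)
    alternant x N [::] * (schur_poly N nu x * jt_det e nu N) =
  \sum_(nu <- parts k | (size nu <= N)%N) \sum_tau
    \sum_(g | total g == k) (rel g nu tau)%:R * Phi g.
  rewrite big_seq_cond [RHS]big_seq_cond; apply: eq_bigr => nu.
  rewrite mem_parts => /andP[/andP[pn /eqP sn] nN].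
  rewrite mulrA schur_poly_alternant // mulrCA mulfV ?alternant_nil_neq0 // mulr1.
  rewrite /jt_det /determinant mulr_sumr; apply: eq_bigr => tau _.
  transitivity (term nu tau).
    by rewrite /term; congr (_ * (_ * _)); apply: eq_bigr => i _; rewrite mxE.
  rewrite term_sum // big_mkcondr; apply: eq_bigr => g _.
  by case: ifP; rewrite ?mul1r ?mul0r.
under [RHS]eq_bigr do rewrite exchange_big.
rewrite [RHS]exchange_big /=; apply: eq_bigr => g /eqP tg.
under eq_bigr do rewrite -mulr_suml.
rewrite -mulr_suml.
have [/injectiveP inj|/injectiveP ninj] := boolP (injectiveb (expo g)).
  by rewrite count_rel // mul1r.
by rewrite Phi0 ?mulr0.
Qed.

End Cauchy.

(** Polynomials p_j of degree at most j are a triangular change of basis from the monomials of a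
    Vandermonde matrix. *)
Lemma det_poly_family (F : comNzRingType) l (p : nat -> {poly F}) (z : 'I_l -> F) :
  (forall j, (size (p j) <= j.+1)%N) ->
  \det (\matrix_(i < l, j < l) (p j).[z i]) =
  \prod_(j < l) (p j)`_j * \prod_(j < l) \prod_(i < l | (i < j)%N) (z j - z i).
Proof.
move=> sp; pose U := \matrix_(j < l, k < l) (p j)`_k.
have -> : \matrix_(i < l, j < l) (p j).[z i] =
    (Vandermonde l (\row_(i < l) z i))^T *m U^T.
  apply/matrixP => i j; rewrite !mxE (@horner_coef_wide _ l); last first.
    by apply: leq_trans (sp j) _.
  by apply: eq_bigr => k _; rewrite !mxE mulrC.
rewrite det_mulmx !det_tr det_Vandermonde mulrC; congr (_ * _).
  rewrite det_trig; first by apply: eq_bigr => j _; rewrite mxE.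
  apply/is_trig_mxP => i j ij; rewrite mxE nth_default //.
  exact: leq_trans (sp i) ij.
rewrite (exchange_big_dep xpredT) //=; apply: eq_bigr => j _.
by apply: eq_big => i //; rewrite !mxE.
Qed.

(* The first column hook lengths of nu, bottom row first. *)
Definition beta nu l j : nat := (nth 0 nu (l - j.+1) + j)%N.
Definition beta_seq nu l : seq nat := [seq beta nu l j | j <- iota 0 l].

(** The sum of the contents of nu, in the form in which the determinant yields it: a factor from
    each row, the leading coefficients of the columns, and the differences of a Vandermonde
    product. *)
Definition beta_exp nu l : int :=
  \sum_(j < l) ('C(beta nu l j, 2)%:Z + (j ^ 2)%N%:Z - (l%:Z - 1) * (beta nu l j)%:Z).

(** * Principal specialization and the q-binomial theorem *)

Section Brackets.

Variables (F : fieldType) (w eps : F).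
Hypotheses (w_neq0 : w != 0) (eps2 : eps * eps = 1).

(** The sign lets (w, eps) = (v, 1) and (1/v, -1) give the same bracket, so that h_r and e_r at
    q^rho are treated together. *)
Definition gbr (m : nat) : F := eps * (w ^+ m - w ^- m).
Hypothesis gbr_neq0 : forall m, (0 < m)%N -> gbr m != 0.

Definition gfact n : F := \prod_(i < n) gbr i.+1.
Definition gbin_ser r : F := w ^+ 'C(r, 2) / gfact r.
(** For s the beta numbers of nu and t the numbers below some bound missing from s, the differences
    x - y > 0 are the hook lengths of nu. *)
Definition gcross (s t : seq nat) : F :=
  \prod_(x <- s) \prod_(y <- t | (y < x)%N) gbr (x - y).

Lemma gfact_neq0 n : gfact n != 0.
Proof. by apply/prodf_neq0 => i _; apply: gbr_neq0. Qed.

Lemma gfactS n : gfact n.+1 = gfact n * gbr n.+1.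
Proof. by rewrite /gfact big_ord_recr. Qed.

Lemma gfact_iota n x : (x <= n)%N ->
  \prod_(y <- iota 0 n | (y < x)%N) gbr (x - y) = gfact x.
Proof.
move=> xn; rewrite -(subnKC xn) iotaD big_cat /= [X in _ * X]big1_seq ?mulr1; last first.
  by move=> y; rewrite mem_iota add0n => /andP[yx /andP[xy _]]; lia.
have -> : iota 0 x = index_iota 0 x by rewrite /index_iota subn0.
rewrite big_nat_cond (eq_bigl (fun y => (0 <= y < x)%N)) => [|y]; last first.
  by rewrite leq0n andbb.
rewrite -big_nat big_nat_rev /= big_mkord; apply: eq_bigr => i _.
by congr gbr; have := ltn_ord i; lia.
Qed.

Lemma gcross_neq0 s t : gcross s t != 0.
Proof.
rewrite /gcross prodf_seq_neq0; apply/allP => x _ /=.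
rewrite prodf_seq_neq0; apply/allP => y _; apply/implyP => yx.
by apply: gbr_neq0; rewrite subn_gt0.
Qed.

Let falling (L d : nat) : (d <= L)%N ->
  gfact L = gfact (L - d) * \prod_(t < d) gbr (L - t).
Proof.
elim: d => [|d IH] dL; first by rewrite subn0 big_ord0 mulr1.
by rewrite big_ord_recr /= IH ?(ltnW dL) // -subnSK // gfactS subnSK //; ring.
Qed.

Let qpoly (d : nat) : {poly F} :=
  (eps ^+ d * w ^+ d) *: \prod_(t < d) (1 - w ^+ (2 * t) *: 'X).

Let size_lin_prod m : (size (\prod_(t < m) (1 - w ^+ (2 * t) *: 'X))%R <= m.+1)%N.
Proof.
elim: m => [|m IH]; first by rewrite big_ord0 size_poly1.
rewrite big_ord_recr /=; apply: leq_trans (size_polyMleq _ _) _.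
have : (size (1 - w ^+ (2 * m) *: 'X)%R <= 2)%N.
  apply: leq_trans (size_polyD _ _) _; rewrite size_poly1 size_polyN geq_max /=.
  by apply: leq_trans (size_scale_leq _ _) _; rewrite size_polyX.
by move: IH; move: (size _) (size _) => p q; lia.
Qed.

Let size_qpoly d : (size (qpoly d) <= d.+1)%N.
Proof. exact: leq_trans (size_scale_leq _ _) (size_lin_prod d). Qed.

Let lead_qpoly d : (qpoly d)`_d = (- eps) ^+ d * w ^+ (d ^ 2).
Proof.
rewrite coefZ; suff -> : (\prod_(t < d) (1 - w ^+ (2 * t) *: 'X) : {poly F})`_d =
    (-1) ^+ d * w ^+ (d * d.-1).
  have -> : (d ^ 2 = d + d * d.-1)%N by case: d => // d; rewrite expnS expn1 /=; lia.
  rewrite -[- eps]mulN1r exprMn exprD.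
  by move: ((-1) ^+ d) (eps ^+ d) (w ^+ d) (w ^+ _) => s e p q; ring.
elim: d => [|d IH]; first by rewrite big_ord0 coef1 expr0 mul1r.
rewrite big_ord_recr /= mulrBr mulr1 -scalerAr coefB coefZ coefMX /= IH.
rewrite [_`_d.+1]nth_default ?size_lin_prod // sub0r.
rewrite exprS mulrCA -exprD -mulrA mulN1r; congr (- (_ * w ^+ _)).
by case: d {IH} => // d /=; lia.
Qed.

(** In terms of the beta number L of a row, the entry is a row factor times a polynomial of degree d
    in w^(-2L). Its factor t = L vanishes when L < d, which matches f_r = 0 for negative r. *)
Let entry L d : gfact L * (if (d <= L)%N then gbin_ser (L - d) else 0) =
  w ^+ 'C(L, 2) * (qpoly d).[w ^- (2 * L)].
Proof.
rewrite hornerZ horner_prod.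
under eq_bigr do rewrite hornerD hornerN hornerZ hornerX hornerC.
case: leqP => [dL|Ld]; last first.
  rewrite (bigD1 (Ordinal Ld)) //= mulfV ?expf_neq0 //.
  by rewrite subrr mul0r !mulr0.
have E : \prod_(t < d) gbr (L - t) =
    eps ^+ d * \prod_(t < d) w ^+ (L - t) * \prod_(t < d) (1 - w ^+ (2 * t) * w ^- (2 * L)).
  rewrite -[d in eps ^+ d]card_ord -prodr_const -!big_split /=; apply: eq_bigr => t _.
  rewrite /gbr -!mulrA; congr (_ * _).
  rewrite mulrBr mulr1; congr (_ - _).
  have tL : (t <= L)%N by rewrite ltnW // (leq_trans (ltn_ord t) dL).
  apply: (mulfI (expf_neq0 (2 * L) w_neq0)).
  rewrite [RHS]mulrCA [X in _ = _ * X]mulrCA mulfV ?expf_neq0 // mulr1.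
  apply: (mulIf (expf_neq0 (L - t) w_neq0)); rewrite mulfVK ?expf_neq0 //.
  by rewrite -!exprD; congr (w ^+ _); lia.
have exps : ('C(L - d, 2) + \sum_(t < d) (L - t) = 'C(L, 2) + d)%N.
  elim: d dL {E} => [|d IH] dL; first by rewrite big_ord0 subn0.
  rewrite big_ord_recr /= [RHS]addnS -(IH (ltnW dL)).
  rewrite -(subnSK dL) binS bin1.
  by rewrite !addnS addnA addnAC.
rewrite (falling dL) /gbin_ser E prodrXr.
rewrite -/(\prod_(t < d) (1 - w ^+ (2 * t) * w ^- (2 * L))).
set P := \prod_(t < d) (1 - w ^+ (2 * t) * w ^- (2 * L)); move: (gfact_neq0 (L - d)); set g := gfact _ => g0.
have -> : g * (eps ^+ d * w ^+ (\sum_(t < d) (L - t)) * P) * (w ^+ 'C(L - d, 2) / g) =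
    eps ^+ d * P * w ^+ ('C(L - d, 2) + \sum_(t < d) (L - t)).
  by rewrite exprD; field.
by rewrite exps exprD; ring.
Qed.

Let exp_sum n (f : nat -> int) : w ^ (\sum_(j < n) f j) = \prod_(j < n) w ^ f j.
Proof.
elim: n => [|n IH]; first by rewrite !big_ord0.
by rewrite !big_ord_recr /= expfzDr // IH.
Qed.

Let pair_sum l (m : nat -> nat) :
  \sum_(j < l) \sum_(i < j) (- (m i)%:Z - (m j)%:Z) =
  \sum_(j < l) (- ((l%:Z - 1) * (m j)%:Z)).
Proof.
elim: l => [|l IH]; first by rewrite !big_ord0.
rewrite big_ord_recr IH [RHS]big_ord_recr /= sumrB sumr_const card_ord.
have -> : l.+1%:Z - 1 = l%:Z by rewrite -addn1 PoszD addrK.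
rewrite -[(m l)%:Z *+ l]mulr_natl natz addrA -big_split /=; congr (_ + _).
by apply: eq_bigr => j _; ring.
Qed.

(** The hook length form of the principal specialization. With each row multiplied by the factorial
    of its beta number, the determinant becomes a Vandermonde determinant in the w^(-2 M j), whose
    differences are brackets. *)
Lemma jt_det_cross nu l t n :
  (forall i j, (i <= j)%N -> (nth 0 nu j <= nth 0 nu i)%N) ->
  perm_eq (beta_seq nu l ++ t) (iota 0 n) ->
  jt_det gbin_ser nu l = w ^ beta_exp nu l / gcross (beta_seq nu l) t.
Proof.
move=> decr pe; pose M := beta nu l.
have M_lt i j : (i < j < l)%N -> (M i < M j)%N.
  case/andP => ij jl; have := decr (l - j.+1)%N (l - i.+1)%N.
  by rewrite /M /beta; lia.
have M_ltE (i j : 'I_l) : (M i < M j)%N = (i < j)%N.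
  case: (ltngtP i j) => [ij|ij|->]; last by rewrite ltnn.
    by rewrite M_lt // ij ltn_ord.
  by apply/negbTE; rewrite -leqNgt ltnW // M_lt // ij ltn_ord.
(* The factorial of M j runs over all y below M j. The y in the beta set cancel the Vandermonde
   product; the y in t remain and give the hooks. *)
have facts : \prod_(j < l) gfact (M j) =
    \prod_(j < l) \prod_(i < l | (i < j)%N) gbr (M j - M i) * gcross (beta_seq nu l) t.
  have iotaE : iota 0 l = index_iota 0 l by rewrite /index_iota subn0.
  rewrite /gcross big_map iotaE big_mkord -big_split /=; apply: eq_bigr => j _.
  have jn : (M j <= n)%N.
    apply: ltnW; suff : M j \in iota 0 n by rewrite mem_iota add0n => /andP[].
    rewrite -(perm_mem pe) mem_cat map_f // mem_iota add0n; exact: ltn_ord.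
  rewrite -(gfact_iota jn) -(perm_big _ pe) big_cat /=; congr (_ * _).
  rewrite big_map iotaE big_mkord.
  by apply: eq_bigl => i; rewrite -/(M i) M_ltE.
pose z (j : 'I_l) := w ^- (2 * M j).
have zE (i j : 'I_l) : (i < j)%N ->
    z j - z i = - eps * (w ^- (M i) * w ^- (M j)) * gbr (M j - M i).
  move=> ij; have mij : (M i < M j)%N by rewrite M_ltE.
  have [p Mj] : exists p, M j = (p + M i)%N by exists (M j - M i)%N; rewrite subnK // ltnW.
  rewrite /z /gbr Mj addnK; move: (M i) => q.
  have p0 := expf_neq0 p w_neq0; have q0 := expf_neq0 q w_neq0.
  rewrite ![(2 * _)%N]mulnC !exprM !exprD.
  move: (w ^+ p) (w ^+ q) p0 q0 => A B A0 B0.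
  transitivity (- (eps * eps) * (B^-1 / (A * B)) * (A - A^-1)); last by ring.
  by rewrite eps2; field; rewrite A0 B0.
have main : \prod_(j < l) gfact (M j) * jt_det gbin_ser nu l =
    w ^ beta_exp nu l * \prod_(j < l) \prod_(i < l | (i < j)%N) gbr (M j - M i).
  have -> : \prod_(j < l) gfact (M j) * jt_det gbin_ser nu l =
      \det (\matrix_(i < l, j < l) (w ^+ 'C(M i, 2) * (qpoly j).[z i])).
    (* [beta] lists the bottom row first, so rows and columns are reversed together, which costs no
       sign. *)
    rewrite /jt_det -det_rev_ord.
    have -> : \prod_(j < l) gfact (M j) = \det (diag_mx (\row_(j < l) gfact (M j))).
      by rewrite det_diag; apply: eq_bigr => j _; rewrite mxE.
    rewrite -det_mulmx mul_diag_mx; congr (\det _); apply/matrixP => i j.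
    rewrite !mxE -entry /jt_entry /=; congr (_ * _).
    have il := ltn_ord i; have jl := ltn_ord j.
    have -> : (l - i.+1 <= nth 0 nu (l - i.+1) + (l - j.+1))%N = (j <= M i)%N.
      by rewrite /M /beta; lia.
    by case: ifP => // ji; congr gbin_ser; rewrite /M /beta in ji *; lia.
  have -> : \matrix_(i < l, j < l) (w ^+ 'C(M i, 2) * (qpoly j).[z i]) =
      diag_mx (\row_(i < l) w ^+ 'C(M i, 2)) *m \matrix_(i < l, j < l) (qpoly j).[z i].
    by apply/matrixP => i j; rewrite mul_diag_mx !mxE.
  rewrite det_mulmx det_diag (det_poly_family _ size_qpoly).
  pose fe (j : nat) : int := 'C(M j, 2)%:Z + (j ^ 2)%N%:Z - (l%:Z - 1) * (M j)%:Z.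
  have -> : beta_exp nu l = \sum_(j < l) fe j by [].
  rewrite exp_sum.
  have -> : \prod_(j < l) w ^ fe j =
     \prod_(j < l) (w ^+ 'C(M j, 2) * w ^+ (j ^ 2)) *
       \prod_(j < l) \prod_(i < l | (i < j)%N) (w ^- (M i) * w ^- (M j)).
    have -> : \prod_(j < l) \prod_(i < l | (i < j)%N) (w ^- (M i) * w ^- (M j)) =
        \prod_(j < l) w ^ (- ((l%:Z - 1) * (M j)%:Z)).
      rewrite -(exp_sum l (fun j => - ((l%:Z - 1) * (M j)%:Z))) -pair_sum.
      rewrite (exp_sum l (fun j => \sum_(i < j) (- (M i)%:Z - (M j)%:Z))).
      apply: eq_bigr => j _; rewrite (exp_sum j (fun i => - (M i)%:Z - (M j)%:Z)).
      rewrite -(big_ord_widen l (fun i => w ^- (M i) * w ^- (M j))); last exact: ltnW.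
      by apply: eq_bigr => i _; rewrite expfzDr // !exprnN.
    rewrite -big_split /=; apply: eq_bigr => j _.
    by rewrite !expfzDr.
  rewrite -!big_split /=; apply: eq_bigr => j _.
  rewrite mxE lead_qpoly.
  have -> : \prod_(i < l | (i < j)%N) (z j - z i) =
     (- eps) ^+ j * \prod_(i < l | (i < j)%N) (w ^- (M i) * w ^- (M j)) *
     \prod_(i < l | (i < j)%N) gbr (M j - M i).
    rewrite (eq_bigr _ (fun i => zE i j)) big_split big_split prodr_const; congr (_ ^+ _ * _ * _).
    have -> : #|(fun i : 'I_l => (i < j)%N)| = (\sum_(i < l | (i < j)%N) 1)%N.
      by rewrite sum1_card.
    by rewrite -(big_ord_widen l (fun=> 1%N)) ?sum1_card ?card_ord // ltnW.
  move: (\prod_(i < l | _) gbr _) (\prod_(i < l | _) (_ * _)) => B A.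
  have se : (- eps) ^+ j * (- eps) ^+ j = 1 by rewrite -exprMn mulrNN eps2 expr1n.
  by rewrite -[RHS]mul1r -{1}se; move: ((- eps) ^+ j) => s; ring.
have f0 : \prod_(j < l) gfact (M j) != 0 by apply/prodf_neq0 => j _; apply: gfact_neq0.
apply: (mulfI f0); rewrite main facts.
by rewrite mulrCA mulfK ?gcross_neq0 // mulrC.
Qed.

End Brackets.

Lemma two_bin2 (x : nat) : 2 * 'C(x, 2)%:Z = x%:Z ^+ 2 - x%:Z.
Proof.
elim: x => [|x IH]; first by [].
by rewrite binS bin1 PoszD mulrDr IH (intS x); ring.
Qed.

(** * Beta numbers of the conjugate partition *)

Section Conjugate.

Variable nu : seq nat.
Hypothesis part_nu : is_partition nu.

Let l := size nu.
Let m := head 0%N nu.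
Let n := (l + m)%N.
Let col j := count (fun p => j < p)%N nu.
Let flip x := (n - x.+1)%N.

Lemma ltn_count_part (s : seq nat) i j : sorted geq s ->
  (i < count (fun p => j < p) s)%N = (j < nth 0%N s i)%N.
Proof.
elim: s i => [|x s IH] i //= so; first by rewrite nth_nil.
have so' := path_sorted so.
case: (ltnP j x) => jx /=.
  by case: i => [|i] //=; rewrite add1n ltnS IH.
have -> : count (fun p => j < p)%N s = 0%N.
  apply/eqP; rewrite -leqn0 leqNgt -has_count; apply/hasPn => y ys.
  move: so; rewrite (path_sortedE geq_transitive) => /andP[/allP /(_ y ys) /= yx _].
  by rewrite -leqNgt (leq_trans yx jx).
rewrite ltn0; apply/esym/negbTE; rewrite -leqNgt; case: i => [|i] //=.
have [si|si] := ltnP i (size s); last by rewrite nth_default.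
move: so; rewrite (path_sortedE geq_transitive) => /andP[/allP h _].
exact: leq_trans (h _ (mem_nth 0%N si)) jx.
Qed.

Let colE i j : (i < col j)%N = (j < nth 0%N nu i)%N.
Proof. by apply: ltn_count_part; case/andP: part_nu. Qed.

Let nth_le i : (nth 0%N nu i <= m)%N.
Proof. exact: partition_nth_le. Qed.

Let col_le j : (col j <= l)%N. Proof. exact: count_size. Qed.

Let col_mono i j : (i <= j)%N -> (col j <= col i)%N.
Proof. by move=> ij; apply: sub_count => p /= h; apply: leq_ltn_trans h. Qed.

Lemma nth_conj j : nth 0%N (conj_part nu) j = col j.
Proof.
rewrite /conj_part; have [jm|jm] := ltnP j m.
  by rewrite (nth_map 0%N) ?size_iota // nth_iota.
rewrite nth_default ?size_map ?size_iota //; apply/esym/eqP.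
rewrite -leqn0 leqNgt colE -leqNgt; exact: leq_trans (nth_le 0) jm.
Qed.

Lemma size_conj : size (conj_part nu) = m.
Proof. by rewrite size_map size_iota. Qed.

Lemma conj_decr i j : (i <= j)%N ->
  (nth 0%N (conj_part nu) j <= nth 0%N (conj_part nu) i)%N.
Proof. by rewrite !nth_conj; apply: col_mono. Qed.

Let decr i j : (i <= j)%N -> (nth 0%N nu j <= nth 0%N nu i)%N.
Proof. exact: part_nth_decr. Qed.

Let S := beta_seq nu l.
Let B := beta_seq (conj_part nu) m.

Let S_lt x : x \in S -> (x < n)%N.
Proof.
case/mapP => j; rewrite mem_iota add0n => /andP[_ jl] ->; rewrite /beta /n.
by have := nth_le (l - j.+1)%N; lia.
Qed.

Let B_lt x : x \in B -> (x < n)%N.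
Proof.
case/mapP => j; rewrite mem_iota add0n => /andP[_ jl] ->; rewrite /beta /n nth_conj.
by have := col_le (m - j.+1)%N; lia.
Qed.

Let flip_uniq s : {in s, forall x, x < n}%N -> uniq s -> uniq (map flip s).
Proof.
move=> sn us; rewrite map_inj_in_uniq // => x y /sn xn /sn yn; rewrite /flip; lia.
Qed.

Let flipK x : (x < n)%N -> flip (flip x) = x.
Proof. rewrite /flip; lia. Qed.

Lemma beta_seq_uniq s k :
  (forall i j, (i <= j)%N -> (nth 0 s j <= nth 0 s i)%N) -> uniq (beta_seq s k).
Proof.
move=> sd; rewrite map_inj_in_uniq ?iota_uniq // => i j; rewrite !mem_iota !add0n /=.
move=> ik jk; rewrite /beta; have := sd (k - i.+1)%N (k - j.+1)%N.
by have := sd (k - j.+1)%N (k - i.+1)%N; case: (ltngtP i j); lia.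
Qed.

(* Macdonald, Symmetric Functions and Hall Polynomials, I (1.7). *)
Lemma beta_conj_perm : perm_eq (S ++ map flip B) (iota 0 n).
Proof.
have uSB : uniq (S ++ map flip B).
  rewrite cat_uniq beta_seq_uniq // flip_uniq ?beta_seq_uniq //; last exact: conj_decr.
  rewrite andbT; apply/hasPn => x /mapP[y /mapP[j]].
  rewrite mem_iota add0n => /andP[_ jm] -> -> {x y}; apply/mapP => -[i].
  rewrite mem_iota add0n => /andP[_ il]; rewrite /beta nth_conj /flip.
  have := colE (l - i.+1)%N (m - j.+1)%N; have := col_le (m - j.+1)%N.
  have := nth_le (l - i.+1)%N; rewrite /n.
  by case: ltnP; case: ltnP => //; lia.
have sz : size (iota 0 n) = size (S ++ map flip B).
  by rewrite size_cat !size_map !size_iota.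
have sub : {subset S ++ map flip B <= iota 0 n}.
  move=> x; rewrite mem_cat mem_iota add0n /= => /orP[/S_lt //|/mapP[y /B_lt yn ->]].
  by rewrite /flip; lia.
apply: uniq_perm; rewrite ?iota_uniq //.
by have [] := uniq_min_size uSB sub; rewrite sz.
Qed.

Lemma beta_conj_perm' : perm_eq (B ++ map flip S) (iota 0 n).
Proof.
have pI : perm_eq (map flip (iota 0 n)) (iota 0 n).
  have us : uniq (map flip (iota 0 n)).
    by apply: flip_uniq (iota_uniq _ _) => x; rewrite mem_iota add0n.
  apply: uniq_perm; rewrite ?iota_uniq //.
  have sub : {subset map flip (iota 0 n) <= iota 0 n}.
    by move=> x /mapP[y]; rewrite !mem_iota !add0n /flip => /= yn ->; lia.
  by have [] := uniq_min_size us sub; rewrite size_map size_iota.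
apply: perm_trans pI; rewrite perm_sym.
apply: (perm_trans (perm_map flip _)); first by rewrite perm_sym; exact: beta_conj_perm.
have -> : map flip (S ++ map flip B) = map flip S ++ B.
  rewrite map_cat; congr (_ ++ _); rewrite -map_comp -[RHS]map_id.
  by apply/eq_in_map => x /B_lt; exact: flipK.
by rewrite perm_catC.
Qed.

Lemma beta_exp_seq s k : beta_exp s k =
  \sum_(x <- beta_seq s k) ('C(x, 2)%:Z - (k%:Z - 1) * x%:Z) + \sum_(j < k) (j ^ 2)%N%:Z.
Proof.
have iotaE : iota 0 k = index_iota 0 k by rewrite /index_iota subn0.
rewrite /beta_seq big_map iotaE big_mkord -big_split /=.
by apply: eq_bigr => j _; rewrite -/(beta s k j); ring.
Qed.

(** Conjugation negates the contents. Each exponent is a sum of a quadratic polynomial over beta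
    numbers; [flip] moves those of the conjugate to the complement of those of nu, so that together
    they are summed over an interval. The factors 2 and 6 clear denominators. *)
Lemma beta_exp_conj : beta_exp (conj_part nu) m = - beta_exp nu l.
Proof.
pose q (k x : nat) : int := x%:Z ^+ 2 - (2 * k%:Z - 1) * x%:Z.
have two s k : 2 * beta_exp s k = \sum_(x <- beta_seq s k) q k x + 2 * \sum_(j < k) (j ^ 2)%N%:Z.
  rewrite beta_exp_seq mulrDr mulr_sumr; congr (_ + _); apply: eq_bigr => x _.
  by rewrite mulrBr two_bin2 /q; ring.
have qflip x : (x < n)%N -> q m x = q l (flip x) + (n%:Z - 1) * (l%:Z - m%:Z).
  move=> xn; rewrite /q.
  have -> : (flip x)%:Z = n%:Z - x%:Z - 1 by rewrite /flip; lia.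
  by rewrite /n PoszD; ring.
have sq k : 6 * \sum_(j < k) (j ^ 2)%N%:Z = (k%:Z - 1) * k%:Z * (2 * k%:Z - 1).
  elim: k => [|k IH]; first by rewrite big_ord0.
  by rewrite big_ord_recr /= mulrDr IH (intS k) -mulnn PoszM; ring.
have qs k : 6 * \sum_(x <- iota 0 k) q l x =
    (k%:Z - 1) * k%:Z * (2 * k%:Z - 1) - 3 * (2 * l%:Z - 1) * (k%:Z * (k%:Z - 1)).
  elim: k => [|k IH]; first by rewrite big_nil; ring.
  by rewrite -(addn1 k) iotaD big_cat big_seq1 mulrDr IH add0n PoszD /q; ring.
have sB : \sum_(x <- B) q m x =
    \sum_(x <- map flip B) q l x + m%:Z * ((n%:Z - 1) * (l%:Z - m%:Z)).
  transitivity (\sum_(x <- B) (q l (flip x) + (n%:Z - 1) * (l%:Z - m%:Z))).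
    by rewrite big_seq [RHS]big_seq; apply: eq_bigr => x /B_lt; exact: qflip.
  rewrite big_split /= [in RHS]big_map; congr (_ + _); rewrite big_const_seq count_predT size_map size_iota.
  by rewrite iter_addr_0 -mulr_natl natz.
have : 6 * (2 * (beta_exp (conj_part nu) m + beta_exp nu l)) = 0.
  rewrite mulrDr !two -/S -/B sB.
  have -> : forall u z d e f : int, 6 * (u + z + 2 * d + (e + 2 * f)) =
     6 * (e + u) + 6 * z + 2 * (6 * d) + 2 * (6 * f) by move=> *; ring.
  rewrite -big_cat (perm_big _ beta_conj_perm) /= qs !sq /n PoszD; ring.
by move=> E; apply/eqP; rewrite -addr_eq0; lia.
Qed.

(** [flip] reverses the order and keeps differences: transposing a diagram preserves its hook
    lengths. *)
Lemma gcross_conj (F : fieldType) (w eps : F) :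
  gcross w eps B (map flip S) = gcross w eps S (map flip B).
Proof.
rewrite /gcross; under eq_bigr do rewrite big_map big_mkcond.
rewrite exchange_big /=; rewrite big_seq [RHS]big_seq; apply: eq_bigr => x xS.
rewrite big_map [RHS]big_mkcond big_seq [RHS]big_seq; apply: eq_bigr => y yB.
have xn := S_lt xS; have yn := B_lt yB.
have -> : (flip x < y)%N = (flip y < x)%N by rewrite /flip; lia.
by case: ifP => // h; congr gbr; rewrite /flip in h *; lia.
Qed.

End Conjugate.

Section HandE.

Variables (F : fieldType) (v : F).
Hypothesis v_neq0 : v != 0.

Definition qbr (m : nat) : F := gbr v 1 m.
Definition qfact (m : nat) : F := gfact v 1 m.
Hypothesis qbr_neq0 : forall m, (0 < m)%N -> qbr m != 0.

(* h_r(q^rho) and e_r(q^rho), where q = v ^ 2 *)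
Definition hrho (r : nat) : F := gbin_ser v 1 r.
Definition erho (r : nat) : F := gbin_ser v^-1 (-1) r.

Let gbrV m : gbr v^-1 (-1) m = qbr m.
Proof. by rewrite /qbr /gbr -!exprVn invrK; ring. Qed.

Let gfactV m : gfact v^-1 (-1) m = qfact m.
Proof. by apply: eq_bigr => i _; apply: gbrV. Qed.

Lemma qbrE m : qbr m = v ^+ m - v ^- m. Proof. by rewrite /qbr /gbr mul1r. Qed.
Lemma qfact_neq0 m : qfact m != 0. Proof. exact: gfact_neq0. Qed.
Lemma qfactS m : qfact m.+1 = qfact m * qbr m.+1. Proof. exact: gfactS. Qed.
Lemma qfact0 : qfact 0 = 1. Proof. by rewrite /qfact /gfact big_ord0. Qed.
Lemma hrhoE r : hrho r = v ^+ 'C(r, 2) / qfact r. Proof. by []. Qed.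
Lemma erhoE r : erho r = v ^- 'C(r, 2) / qfact r.
Proof. by rewrite /erho /gbin_ser gfactV exprVn. Qed.

(** Both sides are a power of v over the brackets of the hook lengths, by [jt_det_cross] at (v, 1)
    for the conjugate and at (1/v, -1) for nu. Conjugation keeps the hooks and negates the exponent,
    and so does inverting v. *)
Lemma hrho_conj nu : is_partition nu ->
  jt_det hrho (conj_part nu) (head 0%N nu) = jt_det erho nu (size nu).
Proof.
move=> pn; have v'0 : v^-1 != 0 by rewrite invr_eq0.
rewrite (jt_det_cross _ _ _ _ (beta_conj_perm' pn)) ?mul1r //; last exact: conj_decr.
rewrite /erho (jt_det_cross _ _ _ _ (beta_conj_perm pn)) ?mulrNN ?mul1r //; first last.
- by move=> i j; apply: part_nth_decr.
- by move=> m; rewrite gbrV; apply: qbr_neq0.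
rewrite beta_exp_conj // gcross_conj // -exprz_inv; congr (_ / _).
by rewrite /gcross; apply: eq_bigr => x _; apply: eq_bigr => y _; rewrite gbrV.
Qed.

(** The beta numbers are 1, ..., b and a + b + 1, with 0 and b + 1, ..., b + a missing; the
    differences are the hook lengths a + b + 1, then 1, ..., a along the arm and 1, ..., b along the
    leg. *)
Lemma hrho_hook a b :
  jt_det hrho (hook a b) (size (hook a b)) =
  v ^ ('C(a.+1, 2)%:Z - 'C(b.+1, 2)%:Z) / (qbr (a + b).+1 * qfact a * qfact b).
Proof.
have decr i j : (i <= j)%N -> (nth 0%N (hook a b) j <= nth 0%N (hook a b) i)%N.
  case: i => [|i]; case: j => [|j] //= ij; rewrite !nth_nseq; first by case: ifP.
  by case: (ltnP j b) => jb; case: (ltnP i b) => ib //; lia.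
have sE : beta_seq (hook a b) b.+1 = iota 1 b ++ [:: (a + b).+1].
  rewrite /beta_seq -{2}(addn1 b) iotaD map_cat /= add0n /beta subnn /=.
  congr (_ ++ [:: _]).
  have -> : iota 1 b = [seq (1 + i)%N | i <- iota 0 b] by rewrite -iotaDl.
  apply/eq_in_map => i.
  rewrite mem_iota add0n => /andP[_ ib] /=; rewrite subSS.
  by case E: (b - i)%N => [|r]; rewrite /= ?nth_nseq ?ifT //; lia.
have pe : perm_eq (beta_seq (hook a b) b.+1 ++ (0%N :: iota b.+1 a)) (iota 0 (a + b).+2).
  have -> : iota 0 (a + b).+2 = 0%N :: iota 1 b ++ iota b.+1 a ++ [:: (a + b).+1].
    have -> : (a + b).+2 = (1 + (b + (a + 1)))%N by lia.
    rewrite iotaD iotaD iotaD /= add0n add1n.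
    by rewrite addSn [(b + a)%N]addnC.
  apply/seq.permP => P; rewrite sE /= !count_cat /=.
  by move: (count P _) (count P _) (nat_of_bool _) (nat_of_bool _) => p q r t; lia.
rewrite [size _]/= size_nseq (jt_det_cross _ _ _ decr pe) ?mul1r //.
have -> : beta_exp (hook a b) b.+1 = 'C(a.+1, 2)%:Z - 'C(b.+1, 2)%:Z.
  have sb k : 2 * (\sum_(x <- iota 1 k) ('C(x, 2)%:Z - b%:Z * x%:Z) + \sum_(j < k) (j.+1 ^ 2)%N%:Z)
      = k%:Z ^+ 2 * (k%:Z + 1) - b%:Z * (k%:Z * (k%:Z + 1)).
    elim: k => [|k IH]; first by rewrite big_nil big_ord0 /=; ring.
    rewrite -{1}(addn1 k) iotaD big_cat big_seq1 big_ord_recr /= add1n.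
    rewrite addrACA mulrDr IH [2 * (_ - _ + _)]mulrDr [2 * (_ - _)]mulrBr two_bin2 -mulnn PoszM (intS k); ring.
  have : 2 * beta_exp (hook a b) b.+1 = 2 * ('C(a.+1, 2)%:Z - 'C(b.+1, 2)%:Z).
    rewrite beta_exp_seq sE big_cat big_seq1 /= big_ord_recl /=.
    have -> : b.+1%:Z - 1 = b%:Z by rewrite (intS b) addrC addKr.
    rewrite [X in _ + (X + _)](_ : _ = 0) // add0r addrAC mulrDr sb mulrBr two_bin2 [RHS]mulrBr !two_bin2.
    by rewrite (intS (a + b)) (intS a) (intS b) PoszD; ring.
  by move/mulfI => -> //.
congr (_ / _); rewrite /gcross sE big_cat big_seq1 /= big_cons /= subn0.
rewrite mulrC; congr (_ * _ * _).
- rewrite /qfact /gfact -[a in RHS]addn0.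
  have iotaE : iota b.+1 a = index_iota b.+1 (b.+1 + a) by rewrite /index_iota addKn.
  rewrite iotaE addn0 big_nat_cond (eq_bigl (fun y => (b.+1 <= y < b.+1 + a)%N)) => [|y]; last first.
    by apply: andb_idr => /andP[]; lia.
  rewrite -big_nat -{1}[b.+1]add0n big_addn big_nat_rev /= addKn add0n big_mkord; apply: eq_bigr => i _.
  by congr gbr; have := ltn_ord i; lia.
- have iotaE : iota 1 b = index_iota 1 b.+1 by rewrite /index_iota subSS subn0.
  rewrite iotaE big_add1 /= big_mkord; apply: eq_bigr => i _.
  rewrite big_cons /= subn0 big1_seq ?mulr1 // => y /andP[yi].
  by rewrite mem_iota; have := ltn_ord i; lia.
Qed.

End HandE.

Lemma hsym_rec (R : comNzRingType) (x : nat -> R) N r :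
  hsym x N.+1 r.+1 = hsym x N r.+1 + x N * hsym x N.+1 r.
Proof.
have key : eq_upto r.+2 ((1 - x N *: 'X) * hpoly x N.+1 r.+2) (hpoly x N r.+2).
  rewrite /hpoly big_ord_recr /= mulrCA -[X in eq_upto _ _ X]mulr1.
  by apply: eq_upto_mul => //; apply: geomP.
have := key r.+1 (ltnSn _); rewrite mulrBl mul1r -scalerAl coefB coefZ coefXM /=.
by rewrite !coef_hpoly // => <-; rewrite subrK.
Qed.

Lemma hsym_no_var (R : comNzRingType) (x : nat -> R) r : hsym x 0 r.+1 = 0.
Proof. by rewrite /hsym /hpoly big_ord0 coef1. Qed.

Section QSeries.

Variables (F : fieldType) (v : F).
Hypothesis v_neq0 : v != 0.
Hypothesis qbr_neq0 : forall m, (0 < m)%N -> qbr v m != 0.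
Local Notation "[ m ]" := (qbr v m) (at level 0, m at level 99).
Local Notation qf := (qfact v).

Let vX m : v ^+ m != 0. Proof. exact: expf_neq0. Qed.
Let qf0 m : qf m != 0. Proof. exact: qfact_neq0. Qed.

Let vm2 m : v ^- 2 ^+ m = (v ^+ m)^-1 * (v ^+ m)^-1.
Proof. by rewrite exprVn -exprM mulnC exprM expr2 invfM. Qed.

Lemma hrhoS r : hrho v r.+1 * (1 - v ^- 2 ^+ r.+1) = hrho v r * v^-1.
Proof.
rewrite !hrhoE qfactS binS bin1 exprD.
have e : [r.+1] = v ^+ r.+1 * (1 - v ^- 2 ^+ r.+1).
  rewrite qbrE vm2; have := vX r.+1; move: (v ^+ r.+1) => z z0; field; exact: z0.
have := qbr_neq0 (ltn0Sn r); rewrite e mulf_eq0 negb_or => /andP[_].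
move: (1 - _) => z z0; rewrite exprS.
by have := vX r; have := qf0 r; move: (v ^+ r) (qf r) (v ^+ 'C(r, 2)) => p q s p0 q0; field; rewrite p0 q0 z0 v_neq0.
Qed.

(** The product is the cost of truncating to N variables; it tends to 1 when |v| > 1, which makes
    [hrho] the limit. *)
Lemma hsym_rho N r :
  hsym (fun i => v ^- (2 * i).+1) N r = hrho v r * \prod_(i < r) (1 - v ^- 2 ^+ (N + i)).
Proof.
elim: N r => [|N IHN] r.
  case: r => [|r]; first by rewrite hsym0 big_ord0 hrhoE qfact0 expr0 divr1 mulr1.
  by rewrite hsym_no_var big_ord_recl /= addn0 expr0 subrr mul0r mulr0.
elim: r => [|r IHr]; first by rewrite hsym0 big_ord0 hrhoE qfact0 expr0 divr1 mulr1.
rewrite hsym_rec IHN IHr big_ord_recl [in RHS]big_ord_recr /= addn0.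
have -> : \prod_(i < r) (1 - v ^- 2 ^+ (N + bump 0 i)) = \prod_(i < r) (1 - v ^- 2 ^+ (N.+1 + i)).
  by apply: eq_bigr => i _; rewrite /bump add1n addSnnS.
set P := \prod_(i < r) _.
have -> : v ^- (2 * N).+1 * (hrho v r * P) = v ^- 2 ^+ N * P * (hrho v r * v^-1).
  by rewrite exprS invfM vm2 mulnC exprM expr2 invfM; ring.
rewrite -hrhoS addSn -addnS exprD; ring.
Qed.

Lemma erhoS r : erho v r.+1 * (v ^+ 2 ^+ r.+1 - 1) = v * erho v r.
Proof.
rewrite !erhoE // qfactS binS bin1 exprD.
have e : v ^+ 2 ^+ r.+1 - 1 = v ^+ r.+1 * [r.+1].
  rewrite qbrE mulrBr mulfV ?vX // -exprM -exprD; congr (v ^+ _ - _); lia.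
rewrite e exprS; have := qbr_neq0 (ltn0Sn r).
have := vX r; have := vX 'C(r, 2); have := qf0 r.
move: [r.+1] (v ^+ r) (qf r) (v ^+ 'C(r, 2)) => b p q s q0 s0 p0 b0.
by field; rewrite p0 q0 s0 b0.
Qed.

Definition epoly (y : F) K : {poly F} := \poly_(r < K) (erho v r * y ^+ r).

(** With E(t) the product of the 1 + v^(-2j-1) t over j >= 0, this is E(v^2 t) = (1 + v t) E(t),
    read off from the recursion of its coefficients. *)
Lemma epoly_shift y K :
  eq_upto K (epoly (v ^+ 2 * y) K) ((1 + (v * y) *: 'X) * epoly y K).
Proof.
move=> i iK; rewrite mulrDl mul1r -scalerAl coefD coefZ coefXM !coef_poly iK.
case: i iK => [|i] iK /=; first by rewrite !expr0 mulr0 addr0.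
rewrite (ltnW iK); apply/eqP; rewrite -subr_eq0; apply/eqP.
have -> : erho v i.+1 * (v ^+ 2 * y) ^+ i.+1 -
    (erho v i.+1 * y ^+ i.+1 + v * y * (erho v i * y ^+ i)) =
    y ^+ i.+1 * (erho v i.+1 * (v ^+ 2 ^+ i.+1 - 1) - v * erho v i).
  by rewrite exprMn (exprS y); ring.
by rewrite erhoS subrr mulr0.
Qed.

Lemma epoly_shift_iter y K m :
  eq_upto K (epoly (v ^+ (2 * m) * y) K)
    (\prod_(c < m) (1 + (v ^+ (2 * c).+1 * y) *: 'X) * epoly y K).
Proof.
elim: m => [|m IH]; first by rewrite muln0 expr0 mul1r big_ord0 mul1r.
have -> : v ^+ (2 * m.+1) * y = v ^+ 2 * (v ^+ (2 * m) * y).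
  by rewrite mulnS exprD mulrA.
apply: (eq_upto_trans (@epoly_shift _ K)).
rewrite big_ord_recr /= [\prod_(c < m) _ * _]mulrC -mulrA mulrA -exprS.
exact: eq_upto_mul.
Qed.

Definition content_poly (mu : seq nat) : {poly F} :=
  \prod_(i < size mu) \prod_(c < nth 0%N mu i)
     (1 + (v ^ (2 * c%:Z - 2 * i%:Z)) *: 'X).

Definition qbin N j : F := if (j <= N)%N then qf N / (qf j * qf (N - j)) else 0.

Lemma qbin_rec N j : (j < N)%N ->
  qbin N.+1 j.+1 = v ^- j.+1 * qbin N j.+1 + v ^+ (N - j) * qbin N j.
Proof.
move=> jN; rewrite /qbin ltnS jN (ltnW jN) subSS -(subnSK jN) subnSK //.
have eN : (N = j.+1 + (N - j.+1))%N by lia.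
rewrite !qfactS.
have -> : (N - j)%N = (N - j.+1).+1 by rewrite subnSK.
rewrite !qfactS; set d := (N - j.+1)%N in eN *.
have -> : [N.+1] = v ^- j.+1 * [d.+1] + v ^+ d.+1 * [j.+1].
  rewrite eN !qbrE.
  have -> : (j.+1 + d).+1 = (j.+1 + d.+1)%N by rewrite addnS.
  rewrite exprD; have := vX j.+1; have := vX d.+1.
  by move: (v ^+ j.+1) (v ^+ d.+1) => p q q0 p0; field; rewrite p0 q0.
have := qf0 j; have := qf0 d; have := qbr_neq0 (ltn0Sn j); have := qbr_neq0 (ltn0Sn d).
have := vX j.+1; have := qf0 N.
move: (v ^+ j.+1) (v ^+ d.+1) [j.+1] [d.+1] (qf N) (qf j) (qf d).
by move=> p q b1 b2 f1 f2 f3 *; field; do ?[apply/andP; split].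
Qed.

Definition qbin_exp N j : int := 'C(j.+1, 2)%:Z - 'C((N - j).+1, 2)%:Z.

Lemma q_binomial N j :
  (\prod_(l < N) ((v ^- l.+1)%:P + v ^+ l.+1 *: 'X))`_j = qbin N j * v ^ qbin_exp N j.
Proof.
elim: N j => [|N IH] j.
  rewrite big_ord0 coef1 /qbin /qbin_exp; case: j => [|j] /=; last by rewrite mul0r.
  by rewrite qfact0 mulr1 divr1 subrr expr0z mulr1.
rewrite big_ord_recr /= mulrDr mulrC mul_polyC -scalerAr coefD !coefZ coefMX !IH.
case: j => [|j] /=.
  rewrite mulr0 addr0 /qbin /qbin_exp /= !subn0 qfact0 !mul1r !mulfV ?qf0 // !mul1r.
  rewrite exprnN -expfzDr //; congr (v ^ _).
  by rewrite [in RHS](binS N.+1) bin1 PoszD; ring.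
have [Nj|jN] := leqP N j.
  rewrite [qbin N j.+1]/qbin leqNgt ltnS Nj mul0r mulr0 add0r.
  case: (ltngtP N j) Nj => // [Nj _|<- _].
    have jN : (j <= N)%N = false by apply/negbTE; rewrite -ltnNge.
    by rewrite /qbin ltnS jN !mul0r mulr0.
  rewrite /qbin !leqnn !subnn qfact0 !mulr1 !mulfV // !mul1r /qbin_exp !subnn.
  by rewrite exprnP -expfzDr // [in RHS](binS N.+1) bin1 PoszD; congr (v ^ _); ring.
have e1 : v ^- N.+1 * v ^ qbin_exp N j.+1 = v ^- j.+1 * v ^ qbin_exp N.+1 j.+1.
  rewrite !exprnN -!expfzDr //; congr (v ^ _); rewrite /qbin_exp subSS.
  rewrite [in RHS](binS (N - j)) bin1 PoszD subnSK //.
  by move: 'C(j.+2, 2) 'C(N - j, 2) => p q; lia.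
have e2 : v ^+ N.+1 * v ^ qbin_exp N j = v ^+ (N - j) * v ^ qbin_exp N.+1 j.+1.
  rewrite !exprnP -!expfzDr //; congr (v ^ _); rewrite /qbin_exp subSS.
  rewrite [in RHS](binS j.+1) bin1 PoszD.
  by move: 'C(j.+1, 2) 'C((N - j).+1, 2) => p q; lia.
rewrite qbin_rec // mulrCA e1 [X in _ + X]mulrCA e2.
by move: (qbin N j) (qbin N j.+1) => p q; ring.
Qed.

(** The q-binomial theorem at X = -y^2, each factor multiplied by -1/y. The index b will be the leg
    length of a hook. *)
Lemma q_binomial_eval N (y : F) : y != 0 ->
  \sum_(b < N.+1) (-1) ^+ b * qbin N b * y ^ (N%:Z - 2 * b%:Z) *
     v ^ ('C((N - b).+1, 2)%:Z - 'C(b.+1, 2)%:Z) =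
  \prod_(l < N) (y * v ^+ l.+1 - y^-1 * v ^- l.+1).
Proof.
move=> y0.
have -> : \prod_(l < N) (y * v ^+ l.+1 - y^-1 * v ^- l.+1) =
    (- y^-1) ^+ N *
    (\prod_(l < N) ((v ^- l.+1)%:P + v ^+ l.+1 *: 'X)).[- (y ^+ 2)].
  rewrite horner_prod -[N in _ ^+ N]card_ord -prodr_const -big_split /=.
  apply: eq_bigr => l _; rewrite hornerD hornerZ hornerX hornerC.
  by move: (v ^+ l.+1) (v ^- l.+1) => p q; field.
rewrite (@horner_coef_wide _ N.+1); last first.
  elim: N => [|N IH]; first by rewrite big_ord0 size_poly1.
  rewrite big_ord_recr /=; apply: leq_trans (size_polyMleq _ _) _.
  have : (size ((v ^- N.+1)%:P + v ^+ N.+1 *: 'X)%R <= 2)%N.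
    apply: leq_trans (size_polyD _ _) _; rewrite geq_max.
    rewrite (leq_trans (size_polyC_leq1 _)) //=.
    by apply: leq_trans (size_scale_leq _ _) _; rewrite size_polyX.
  by move: IH; move: (size _) (size _) => p q; lia.
rewrite mulr_sumr [RHS](reindex_inj rev_ord_inj); apply: eq_bigr => b _ /=.
have bN : (b <= N)%N by rewrite -ltnS.
rewrite q_binomial subSS /qbin_exp subKn //.
have -> : qbin N (N - b) = qbin N b.
  by rewrite /qbin leq_subr bN subKn // (mulrC (qf b)).
have -> : (- y^-1) ^+ N * (qbin N b * v ^ ('C((N - b).+1, 2)%:Z - 'C(b.+1, 2)%:Z) *
     (- y ^+ 2) ^+ (N - b)) =
   ((- y^-1) ^+ N * (- y ^+ 2) ^+ (N - b)) * (qbin N b * v ^ ('C((N - b).+1, 2)%:Z - 'C(b.+1, 2)%:Z)).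
  by ring.
suff -> : (- y^-1) ^+ N * (- y ^+ 2) ^+ (N - b) = (-1) ^+ b * y ^ (N%:Z - 2 * b%:Z) by ring.
rewrite -[- y^-1]mulN1r -[- y ^+ 2]mulN1r !exprMn mulrACA; congr (_ * _).
  by rewrite -[X in (-1) ^+ X * _](subnK bN) exprD mulrAC -expr2 sqrr_sign mul1r.
rewrite -exprD exprVn exprnN exprnP -expfzDr //; congr (y ^ _); lia.
Qed.

Lemma coef_comp_scaleX (p : {poly F}) c k : (p \Po (c *: 'X))`_k = p`_k * c ^+ k.
Proof.
rewrite comp_polyE coef_sum; under eq_bigr do rewrite exprZn !coefZ coefXn.
have [kp|pk] := ltnP k (size p).
  rewrite (bigD1 (Ordinal kp)) //= eqxx mulr1 big1 ?addr0 // => i.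
  by rewrite -val_eqE /= eq_sym => /negbTE ->; rewrite !mulr0.
rewrite [p`_k]nth_default // mul0r big1 // => i _.
by rewrite gtn_eqF ?mulr0 // (leq_trans _ pk).
Qed.

(** The contents of the hook are -b, ..., a, each once, so the polynomial is that of the q-binomial
    theorem with X rescaled by v^(-2(b+1)). *)
Lemma content_poly_hook a b k :
  (content_poly (hook a b))`_k =
  qbin (a + b).+1 k * v ^ (k%:Z * (a%:Z - b%:Z)).
Proof.
pose n := (a + b).+1.
pose P : {poly F} := \prod_(l < n) ((v ^- l.+1)%:P + v ^+ l.+1 *: 'X).
have -> : content_poly (hook a b) = \prod_(j < n) (1 + v ^ (2 * j%:Z - 2 * b%:Z) *: 'X).
  have -> : n = (b + a.+1)%N by rewrite /n addnS addnC.
  rewrite big_split_ord /= /content_poly /= size_nseq big_ord_recl /= mulrC; congr (_ * _).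
    rewrite (reindex_inj rev_ord_inj) /=; apply: eq_bigr => i _.
    rewrite /bump add1n nth_nseq.
    have ib := ltn_ord i; rewrite (_ : (b - i.+1 < b)%N); last by lia.
    rewrite big_ord1 /= mulr0 add0r; congr (1 + v ^ _ *: 'X).
    by lia.
  apply: eq_bigr => i _; congr (1 + v ^ _ *: 'X).
  by rewrite PoszD; ring.
have -> : \prod_(j < n) (1 + v ^ (2 * j%:Z - 2 * b%:Z) *: 'X) =
    v ^+ 'C(n.+1, 2) *: (P \Po (v ^- (2 * b.+1) *: 'X)).
  rewrite /P rmorph_prod /=.
  have -> : v ^+ 'C(n.+1, 2) = \prod_(l < n) v ^+ l.+1.
    by rewrite prodrXr; congr (v ^+ _); elim: n {P} => [|m IH];
      rewrite ?big_ord0 // binS bin1 IH big_ord_recr.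
  rewrite -scaler_prod; apply: eq_bigr => j _.
  rewrite linearD linearZ /= comp_polyC comp_polyX scalerDr -alg_polyC !scalerA mulfV ?vX //.
  rewrite scale1r; congr (1 + _ *: 'X).
  by rewrite exprnN exprnP -!expfzDr //; congr (v ^ _); lia.
rewrite coefZ coef_comp_scaleX q_binomial.
have [kn|nk] := leqP k n; last by rewrite /qbin leqNgt nk !mul0r mulr0.
rewrite -mulrA mulrCA; congr (_ * _).
rewrite -exprVn -exprM exprVn exprnN exprnP -!expfzDr //; congr (v ^ _).
rewrite /qbin_exp; have := two_bin2 n.+1; have := two_bin2 k.+1; have := two_bin2 (n - k).+1.
have : (n - k)%N%:Z = a%:Z + b%:Z + 1 - k%:Z by rewrite /n in kn *; lia.
move: ('C(_, 2)) ('C(_, 2)) ('C(_, 2)) => p q r; rewrite PoszM; nia.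
Qed.

End QSeries.

(** * Schur functions at q^(mu + rho) *)

Section Limits.

Implicit Types (u w : nat -> algC) (l m : algC).

Lemma is_limit_cst l : is_limit (fun=> l) l.
Proof. by move=> e e0; exists 0%N => N _; rewrite subrr normr0. Qed.

Lemma is_limit_eq u w l N1 : (forall N, (N1 <= N)%N -> u N = w N) ->
  is_limit u l -> is_limit w l.
Proof.
move=> uw lu e /lu[N0 h]; exists (maxn N0 N1) => N.
by rewrite geq_max => /andP[h0 h1]; rewrite -uw ?h.
Qed.

Lemma is_limitD u w l m : is_limit u l -> is_limit w m ->
  is_limit (fun N => u N + w N) (l + m).
Proof.
move=> lu lw e e0; have e2 : 0 < e / 2 by rewrite divr_gt0.
have [N0 h0] := lu _ e2; have [N1 h1] := lw _ e2.
exists (maxn N0 N1) => N; rewrite geq_max => /andP[k0 k1].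
rewrite opprD addrACA; apply: le_lt_trans (ler_normD _ _) _.
by rewrite (splitr e) ltrD ?h0 ?h1.
Qed.

Lemma is_limitZ u l c : is_limit u l -> is_limit (fun N => c * u N) (c * l).
Proof.
move=> lu e e0; have [->|c0] := eqVneq c 0.
  by exists 0%N => N _; rewrite !mul0r subrr normr0.
have c1 : 0 < `|c| by rewrite normr_gt0.
have [N0 h] := lu _ (divr_gt0 e0 c1); exists N0 => N /h.
by rewrite -mulrBr normrM ltr_pdivlMr // mulrC.
Qed.

Lemma is_limitM0 u w : is_limit u 0 -> is_limit w 0 -> is_limit (fun N => u N * w N) 0.
Proof.
move=> lu lw e e0; have [N0 h0] := lu _ e0; have [N1 h1] := lw 1 ltr01.
exists (maxn N0 N1) => N; rewrite geq_max => /andP[/h0 k0 /h1 k1].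
move: k0 k1; rewrite !subr0 normrM => k0 k1.
apply: le_lt_trans k0; rewrite -[X in _ <= X]mulr1.
by apply: ler_wpM2l; rewrite ?normr_ge0 // ltW.
Qed.

Lemma is_limitM u w l m : is_limit u l -> is_limit w m ->
  is_limit (fun N => u N * w N) (l * m).
Proof.
move=> lu lw.
have sub f c : is_limit f c -> is_limit (fun N => f N + - c) 0.
  by move=> lf; have := is_limitD lf (is_limit_cst (- c)); rewrite subrr.
have h := is_limitD (is_limitM0 (sub _ _ lu) (sub _ _ lw))
  (is_limitD (is_limitZ m (sub _ _ lu)) (is_limitZ l lw)).
rewrite mulr0 !add0r in h; by apply: (@is_limit_eq _ _ _ 0%N) h => N _; ring.
Qed.

Lemma is_limit_uniq u l m : is_limit u l -> is_limit u m -> l = m.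
Proof.
move=> ul um; apply/eqP; rewrite -subr_eq0 -normr_eq0; apply/negPn/negP => nz.
have e0 : 0 < `|l - m| / 2 by rewrite divr_gt0 // lt_neqAle eq_sym nz normr_ge0.
have [N0 h0] := ul _ e0; have [N1 h1] := um _ e0.
have := ltrD (h0 _ (leq_maxl N0 N1)) (h1 _ (leq_maxr N0 N1)).
rewrite -splitr => lt; suff : `|l - m| < `|l - m| by rewrite ltxx.
apply: le_lt_trans lt; rewrite distrC.
have -> : m - l = (u (maxn N0 N1) - l) - (u (maxn N0 N1) - m) by ring.
exact: ler_normB.
Qed.

(** Bernoulli's inequality for 1/|w| = 1 + h, and the archimedean property. *)
Lemma is_limit_geom (w : algC) : `|w| < 1 -> is_limit (fun N => w ^+ N) 0.
Proof.
move=> w1 e e0; have [->|w0] := eqVneq w 0.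
  by exists 1%N => -[|N] // _; rewrite expr0n subr0 normr0.
have c0 : 0 < `|w| by rewrite normr_gt0.
pose h := `|w|^-1 - 1.
have h0 : 0 < h by rewrite subr_gt0 invf_gt1.
have bern N : 1 + N%:R * h <= (1 + h) ^+ N.
  elim: N => [|N IH]; first by rewrite mul0r addr0.
  rewrite exprS; apply: le_trans (_ : (1 + h) * (1 + N%:R * h) <= _); last first.
    by rewrite ler_wpM2l // addr_ge0 // ltW.
  have -> : (1 + h) * (1 + N%:R * h) = 1 + N.+1%:R * h + N%:R * h ^+ 2.
    by rewrite -natr1; ring.
  by rewrite lerDl mulr_ge0 // exprn_ge0 // ltW.
have ei0 : 0 < e^-1 by rewrite invr_gt0.
have bnd := archi_boundP (ltW (divr_gt0 ei0 h0)).
exists (Num.bound (e^-1 / h)) => N bN; rewrite subr0 normrX.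
have wE : `|w| = (1 + h)^-1 by rewrite /h addrC subrK invrK.
have p0 : 0 < (1 + h) ^+ N by rewrite exprn_gt0 // addr_gt0.
rewrite wE exprVn -[X in _ < X]invrK ltf_pV2 ?posrE ?invr_gt0 //.
apply: lt_le_trans (bern N); apply: lt_trans (_ : N%:R * h < _); last by rewrite ltrDr.
rewrite -ltr_pdivrMr //; apply: lt_le_trans bnd _.
by rewrite ler_nat.
Qed.

End Limits.

Local Notation "p %:F" := (@FracField.tofrac {poly algC} p)
  (at level 1, format "p %:F") : ring_scope.

(** * Rational functions determined by their values and limits *)

Section RationalValues.

Implicit Types (R S : ratfun) (v y z : algC).

Lemma tofrac_neq0 (A : {poly algC}) : A != 0 -> A%:F != 0.
Proof. by rewrite tofrac_eq0. Qed.

Lemma horner_neq0 (B : {poly algC}) v : B.[v] != 0 -> B%:F != 0.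
Proof. by move=> h; apply: tofrac_neq0; apply: contraNneq h => ->; rewrite horner0. Qed.

Lemma rat_value_poly (A : {poly algC}) v : rat_value A%:F v A.[v].
Proof. by exists A, 1; rewrite tofrac1 !divr1 hornerC oner_neq0 divr1. Qed.

Lemma rat_valueD R S v y z : rat_value R v y -> rat_value S v z ->
  rat_value (R + S) v (y + z).
Proof.
case=> [A [B [-> B0 ->]]] [A' [B' [-> B'0 ->]]].
exists (A * B' + A' * B), (B * B'); split.
- rewrite addf_div; [|exact: horner_neq0 B0|exact: horner_neq0 B'0].
  by rewrite tofracD !tofracM.
- by rewrite hornerM mulf_neq0.
- by rewrite hornerD !hornerM addf_div.
Qed.

Lemma rat_valueM R S v y z : rat_value R v y -> rat_value S v z ->
  rat_value (R * S) v (y * z).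
Proof.
case=> [A [B [-> B0 ->]]] [A' [B' [-> B'0 ->]]].
exists (A * A'), (B * B'); split.
- by rewrite mulf_div !tofracM.
- by rewrite hornerM mulf_neq0.
- by rewrite mulf_div !hornerM.
Qed.

Lemma rat_valueV R v y : rat_value R v y -> y != 0 -> rat_value R^-1 v y^-1.
Proof.
case=> [A [B [-> B0 ->]]]; rewrite mulf_eq0 negb_or => /andP[A0 _].
by exists B, A; rewrite !invf_div.
Qed.

Lemma rat_value_uniq R v y z : rat_value R v y -> rat_value R v z -> y = z.
Proof.
case=> [A [B [-> B0 ->]]] [A' [B' [E B'0 ->]]]; apply/eqP.
rewrite eqr_div // -!hornerM; apply/eqP; congr (_.[v]).
move/eqP: E; rewrite eqr_div; [|exact: horner_neq0 B0|exact: horner_neq0 B'0].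
by rewrite -!tofracM tofrac_eq => /eqP.
Qed.

Lemma poly_eq0_at_nat (A : {poly algC}) : (forall n : nat, (1 < n)%N -> A.[n%:R] = 0) -> A = 0.
Proof.
move=> A0; apply/eqP/negPn/negP => nz.
have := @max_poly_roots _ A [seq n%:R | n <- iota 2 (size A)] nz.
rewrite size_map size_iota ltnn => h; suff: false by []; apply: h.
  by apply/allP => x /mapP[n]; rewrite mem_iota => /andP[n1 _] ->; apply/eqP/A0.
by rewrite map_inj_uniq ?iota_uniq // => i j /eqP; rewrite eqr_nat => /eqP.
Qed.

Definition rep R (f : algC -> algC) : Prop :=
  forall v, 1 < `|v| -> rat_value R v (f v).

(** The predicate [is_schur_q] with an arbitrary sequence in place of the Schur polynomials. *)
Definition lim_rep R (u : algC -> nat -> algC) : Prop :=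
  forall v, 1 < `|v| -> exists2 y, rat_value R v y & is_limit (u v) y.

(** The difference has value 0 at every integer v >= 2, so its numerator has infinitely many
    roots. *)
Lemma lim_rep_uniq R S u : lim_rep R u -> lim_rep S u -> R = S.
Proof.
move=> rR rS; have n1 n : (1 < n)%N -> 1 < `|n%:R : algC| by rewrite normr_nat ltr1n.
have val n : (1 < n)%N -> rat_value (R + (-1)%:P%:F * S) n%:R 0.
  move=> /n1 h; have [y vy ly] := rR _ h; have [z vz lz] := rS _ h.
  rewrite -(is_limit_uniq ly lz) in vz.
  have := rat_valueD vy (rat_valueM (rat_value_poly (-1)%:P n%:R) vz).
  by rewrite hornerC mulN1r subrr.
have [A [B [E B0 _]]] := val 2 isT.
suff A0 : A = 0.
  by move: E; rewrite A0 tofrac0 mul0r polyCN tofracN tofrac1 mulN1r => /eqP; rewrite subr_eq0 => /eqP.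
suff : A * B = 0.
  move/eqP; rewrite mulf_eq0 => /orP[/eqP //|/eqP B00].
  by rewrite B00 horner0 eqxx in B0.
(* [rat_value] may use a different fraction at each point; cross multiplication carries the zero at
   n over to the fraction A / B fixed at the point 2. *)
apply: poly_eq0_at_nat => n /val[A' [B' [E' B'0 /esym/eqP]]].
rewrite mulf_eq0 invr_eq0 (negbTE B'0) orbF => /eqP A'0.
have : A * B' = A' * B.
  apply/eqP; rewrite -tofrac_eq !tofracM -eqr_div; [|exact: horner_neq0 B0|exact: horner_neq0 B'0].
  by rewrite -E -E'.
move/(congr1 (fun p => p.[n%:R])); rewrite !hornerM A'0 mul0r => /eqP.
by rewrite mulf_eq0 (negbTE B'0) orbF => /eqP ->; rewrite mul0r.
Qed.

Lemma rep_lim R f : rep R f -> lim_rep R (fun v _ => f v).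
Proof. by move=> rR v v1; exists (f v); [exact: rR | exact: is_limit_cst]. Qed.

Lemma repD R S f g : rep R f -> rep S g -> rep (R + S) (fun v => f v + g v).
Proof. by move=> rR rS v v1; apply: rat_valueD; [exact: rR | exact: rS]. Qed.

Lemma repM R S f g : rep R f -> rep S g -> rep (R * S) (fun v => f v * g v).
Proof. by move=> rR rS v v1; apply: rat_valueM; [exact: rR | exact: rS]. Qed.

Lemma repV R f : rep R f -> (forall v, 1 < `|v| -> f v != 0) -> rep R^-1 (fun v => (f v)^-1).
Proof. by move=> rR f0 v v1; apply: rat_valueV; [exact: rR | exact: f0]. Qed.

Lemma rep_poly (A : {poly algC}) : rep A%:F (fun v => A.[v]).
Proof. by move=> v _; apply: rat_value_poly. Qed.

Lemma rep_eq R f g : rep R f -> f =1 g -> rep R g.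
Proof. by move=> rR fg v v1; rewrite -fg; apply: rR. Qed.

Lemma rep_int (m : int) : rep m%:~R (fun=> m%:~R).
Proof.
have -> : (m%:~R : ratfun) = (m%:~R)%:P%:F by rewrite !rmorph_int.
by apply: rep_eq (rep_poly _) _ => v; rewrite hornerC.
Qed.

Lemma rep0 : rep 0 (fun=> 0). Proof. exact: (rep_int 0). Qed.
Lemma rep1 : rep 1 (fun=> 1). Proof. exact: (rep_int 1). Qed.

Lemma repN R f : rep R f -> rep (- R) (fun v => - f v).
Proof.
move=> rR; rewrite -mulN1r; apply: rep_eq (repM (rep_int (-1)) rR) _ => v.
by rewrite mulN1r.
Qed.

Lemma rep_sum (I : Type) (r : seq I) (P : pred I) (R : I -> ratfun) (f : I -> algC -> algC) :
  (forall i, P i -> rep (R i) (f i)) ->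
  rep (\sum_(i <- r | P i) R i) (fun v => \sum_(i <- r | P i) f i v).
Proof.
move=> h; elim: r => [|i r IH].
  by apply: rep_eq (_ : rep _ (fun=> 0)) _ => [|v]; rewrite big_nil //; exact: rep0.
rewrite big_cons; case Pi: (P i).
  by apply: rep_eq (repD (h i Pi) IH) _ => v; rewrite big_cons Pi.
by apply: rep_eq IH _ => v; rewrite big_cons Pi.
Qed.

Lemma rep_prod (I : Type) (r : seq I) (P : pred I) (R : I -> ratfun) (f : I -> algC -> algC) :
  (forall i, P i -> rep (R i) (f i)) ->
  rep (\prod_(i <- r | P i) R i) (fun v => \prod_(i <- r | P i) f i v).
Proof.
move=> h; elim: r => [|i r IH].
  by apply: rep_eq (_ : rep _ (fun=> 1)) _ => [|v]; rewrite big_nil //; exact: rep1.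
rewrite big_cons; case Pi: (P i).
  by apply: rep_eq (repM (h i Pi) IH) _ => v; rewrite big_cons Pi.
by apply: rep_eq IH _ => v; rewrite big_cons Pi.
Qed.

Lemma lim_rep_eq R u w N1 : (forall v N, 1 < `|v| -> (N1 <= N)%N -> u v N = w v N) ->
  lim_rep R u -> lim_rep R w.
Proof.
move=> uw rR v v1; have [y vy ly] := rR v v1; exists y => //.
by apply: is_limit_eq ly => N; apply: uw.
Qed.

Lemma lim_repD R S u w : lim_rep R u -> lim_rep S w -> lim_rep (R + S) (fun v N => u v N + w v N).
Proof.
move=> rR rS v v1; have [y vy ly] := rR v v1; have [z vz lz] := rS v v1.
by exists (y + z); [apply: rat_valueD | apply: is_limitD].
Qed.

Lemma lim_repM R S u w : lim_rep R u -> lim_rep S w -> lim_rep (R * S) (fun v N => u v N * w v N).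
Proof.
move=> rR rS v v1; have [y vy ly] := rR v v1; have [z vz lz] := rS v v1.
by exists (y * z); [apply: rat_valueM | apply: is_limitM].
Qed.

Lemma lim_rep_sum (I : eqType) (r : seq I) (R : I -> ratfun) (u : I -> algC -> nat -> algC) :
  {in r, forall i, lim_rep (R i) (u i)} ->
  lim_rep (\sum_(i <- r) R i) (fun v N => \sum_(i <- r) u i v N).
Proof.
elim: r => [|i r IH] h.
  rewrite big_nil; apply: (@lim_rep_eq _ (fun _ _ => 0) _ 0%N) => [v N _ _|]; first by rewrite big_nil.
  exact: rep_lim rep0.
rewrite big_cons; have hi := h i (mem_head _ _).
have hr : {in r, forall i, lim_rep (R i) (u i)} by move=> j jr; apply: h; rewrite inE jr orbT.
by apply: (@lim_rep_eq _ _ _ 0%N) (lim_repD hi (IH hr)) => v N _ _; rewrite big_cons.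
Qed.

Lemma lim_rep_prod (I : Type) (r : seq I) (R : I -> ratfun) (u : I -> algC -> nat -> algC) :
  (forall i, lim_rep (R i) (u i)) ->
  lim_rep (\prod_(i <- r) R i) (fun v N => \prod_(i <- r) u i v N).
Proof.
move=> h; elim: r => [|i r IH].
  rewrite big_nil; apply: (@lim_rep_eq _ (fun _ _ => 1) _ 0%N) => [v N _ _|]; first by rewrite big_nil.
  exact: rep_lim rep1.
rewrite big_cons.
by apply: (@lim_rep_eq _ _ _ 0%N) (lim_repM (h i) IH) => v N _ _; rewrite big_cons.
Qed.

Lemma lim_rep_jt_det (R : nat -> ratfun) (u : nat -> algC -> nat -> algC) nu l :
  (forall r, lim_rep (R r) (u r)) ->
  lim_rep (jt_det R nu l) (fun v N => jt_det (fun r => u r v N) nu l).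
Proof.
move=> h; rewrite /jt_det /determinant.
apply: lim_rep_sum => s _; apply: lim_repM.
  have -> : (-1 : ratfun) ^+ s = ((-1) ^+ s)%:~R by rewrite rmorphXn rmorphN1.
  apply: (@lim_rep_eq _ (fun _ _ => ((-1) ^+ s : int)%:~R) _ 0%N); last exact/rep_lim/rep_int.
  by move=> v N _ _; rewrite rmorphXn rmorphN1.
pose w i v N : algC := (\matrix_(i < l, j < l) jt_entry (fun r => u r v N) nu i j) i (s i).
apply: (@lim_rep_prod _ _ _ w) => i; rewrite mxE /jt_entry.
case: ifP => c; last first.
  apply: (@lim_rep_eq _ (fun _ _ => 0) _ 0%N); last exact: rep_lim rep0.
  by move=> v N _ _; rewrite /w mxE /jt_entry c.
apply: (@lim_rep_eq _ (u (nth 0 nu i + s i - i)%N) _ 0%N); last exact: h.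
by move=> v N _ _; rewrite /w mxE /jt_entry c.
Qed.

End RationalValues.

Section SchurValues.

Implicit Types (v : algC).

Lemma gt1_neq0 v : 1 < `|v| -> v != 0.
Proof. by move=> v1; rewrite -normr_gt0; apply: lt_trans v1. Qed.

Lemma qbr_gt1_neq0 v m : 1 < `|v| -> (0 < m)%N -> qbr v m != 0.
Proof.
move=> v1 m0; have v0 := gt1_neq0 v1; rewrite qbrE subr_eq0; apply/eqP => E.
have : `|v| ^+ (m + m) = 1.
  by rewrite -normrX exprD {2}E mulfV ?expf_neq0 // normr1.
by apply/eqP; rewrite gt_eqF // exprn_egt1 // -lt0n addn_gt0 m0.
Qed.

Lemma rep_qhalf : rep qhalf id.
Proof. by apply: rep_eq (rep_poly _) _ => v; rewrite hornerX. Qed.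

Lemma repX R f n : rep R f -> rep (R ^+ n) (fun v => f v ^+ n).
Proof.
move=> rR; elim: n => [|n IH]; first by apply: rep_eq rep1 _ => v; rewrite expr0.
by rewrite exprS; apply: rep_eq (repM rR IH) _ => v; rewrite exprS.
Qed.

Lemma rep_qhalf_expz (z : int) : rep (qhalf ^ z) (fun v => v ^ z).
Proof.
case: z => n; first exact: repX rep_qhalf.
by apply: repV (repX _ rep_qhalf) _ => v v1; rewrite expf_neq0 // gt1_neq0.
Qed.

Lemma rep_qbr m : rep (qbr qhalf m) (fun v => qbr v m).
Proof.
rewrite qbrE; apply: rep_eq (_ : rep _ (fun v => v ^+ m - v ^- m)) _ => [|v]; last by rewrite qbrE.
apply: repD; first exact: repX rep_qhalf.
apply: repN; apply: repV (repX _ rep_qhalf) _ => v v1.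
by rewrite expf_neq0 // gt1_neq0.
Qed.

Lemma rep_neq0 R f : rep R f -> f 2 != 0 -> R != 0.
Proof.
have n2 : 1 < `|2 : algC| by rewrite normr_nat ltr1n.
move=> rR; apply: contraNneq => R0; have := rR _ n2; rewrite R0.
by move/(rat_value_uniq (rep0 n2)) => <-.
Qed.

Lemma qhalf_neq0 : qhalf != 0.
Proof. by apply: rep_neq0 rep_qhalf _; rewrite pnatr_eq0. Qed.

Lemma qbr_qhalf_neq0 m : (0 < m)%N -> qbr qhalf m != 0.
Proof.
move=> m0; apply: rep_neq0 (rep_qbr m) _.
by rewrite qbr_gt1_neq0 // normr_nat ltr1n.
Qed.

Lemma rep_qfact m : rep (qfact qhalf m) (fun v => qfact v m).
Proof. by apply: rep_prod => i _; apply: rep_qbr. Qed.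

Lemma qfact_gt1_neq0 v m : 1 < `|v| -> qfact v m != 0.
Proof. by move=> v1; apply: qfact_neq0 => i; apply: qbr_gt1_neq0. Qed.

Lemma rep_hrho r : rep (hrho qhalf r) (fun v => hrho v r).
Proof.
by apply: repM; [exact: repX rep_qhalf | apply: repV (rep_qfact r) _ => v; exact: qfact_gt1_neq0].
Qed.

Lemma rep_erho r : rep (erho qhalf r) (fun v => erho v r).
Proof.
rewrite erhoE; apply: rep_eq (_ : rep _ (fun v => v ^- 'C(r, 2) / qfact v r)) _ => [|v].
  apply: repM; last by apply: repV (rep_qfact r) _ => v; exact: qfact_gt1_neq0.
  by apply: repV (repX _ rep_qhalf) _ => v v1; rewrite expf_neq0 // gt1_neq0.
by rewrite erhoE.
Qed.

Lemma q_mu_rho_shift mu v i : v != 0 ->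
  q_mu_rho mu v i = v ^+ (2 * nth 0%N mu i) * v ^- (2 * i).+1.
Proof.
move=> v0; rewrite /q_mu_rho exprnN exprnP -expfzDr //; congr (v ^ _).
by lia.
Qed.

Lemma q_rhoE v i : v != 0 -> q_mu_rho [::] v i = v ^- (2 * i).+1.
Proof. by move=> v0; rewrite q_mu_rho_shift // nth_nil muln0 expr0 mul1r. Qed.

(** The exponents decrease strictly and |v| > 1, so the coordinates are distinct, as the quotient of
    alternants in [schur_poly] requires. *)
Lemma q_mu_rho_inj mu v : is_partition mu -> 1 < `|v| -> injective (q_mu_rho mu v).
Proof.
move=> pm v1; have v0 := gt1_neq0 v1.
suff lt i j : (i < j)%N -> q_mu_rho mu v i != q_mu_rho mu v j.
  move=> i j E; case: (ltngtP i j) => // /lt; first by rewrite E eqxx.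
  by rewrite E eqxx.
move=> ij; apply/negP => /eqP E.
have mm := part_nth_decr pm (ltnW ij).
pose n := (2 * (nth 0%N mu i - nth 0%N mu j) + 2 * (j - i))%N.
have : v ^+ n * q_mu_rho mu v j = 1 * q_mu_rho mu v j.
  rewrite mul1r -[RHS]E /q_mu_rho exprnP -expfzDr //; congr (v ^ _).
  by rewrite /n; lia.
move/(mulIf (expfz_neq0 _ v0))/(congr1 (fun z => `|z|)); rewrite normrX normr1.
by apply/eqP; rewrite gt_eqF // exprn_egt1 // /n; lia.
Qed.

Definition rep_coefs (p : {poly ratfun}) (q : algC -> {poly algC}) : Prop :=
  forall j, rep p`_j (fun v => (q v)`_j).

Lemma rep_coefsM p p' q q' : rep_coefs p q -> rep_coefs p' q' ->
  rep_coefs (p * p') (fun v => q v * q' v).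
Proof.
move=> pq pq' j; rewrite coefM.
apply: rep_eq (_ : rep _ (fun v => \sum_(i < j.+1) (q v)`_i * (q' v)`_(j - i))) _ => [|v].
  by apply: rep_sum => i _; apply: repM.
by rewrite coefM.
Qed.

Lemma rep_coefs_lin R f : rep R f -> rep_coefs (1 + R *: 'X) (fun v => 1 + f v *: 'X).
Proof.
move=> rR j; rewrite coefD coef1 coefZ coefX.
apply: rep_eq (_ : rep _ (fun v => (j == 0%N)%:R + f v * (j == 1%N)%:R)) _ => [|v]; last first.
  by rewrite coefD coef1 coefZ coefX.
have rb (c : bool) : rep c%:R (fun=> c%:R) by case: c; [exact: rep1 | exact: rep0].
by apply: repD => //; apply: repM.
Qed.

Lemma rep_coefs_prod (I : Type) (r : seq I) (p : I -> {poly ratfun}) q :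
  (forall i, rep_coefs (p i) (q i)) ->
  rep_coefs (\prod_(i <- r) p i) (fun v => \prod_(i <- r) q i v).
Proof.
move=> h; elim: r => [|i r IH] j.
  rewrite big_nil coef1; apply: rep_eq (_ : rep _ (fun=> (j == 0%N)%:R)) _ => [|v].
    by case: (j == 0%N); [exact: rep1 | exact: rep0].
  by rewrite big_nil coef1.
by rewrite big_cons; apply: rep_eq (rep_coefsM (h i) IH j) _ => v; rewrite big_cons.
Qed.

Lemma lim_rep_hsym r : lim_rep (hrho qhalf r) (fun v N => hsym (q_mu_rho [::] v) N r).
Proof.
move=> v v1; exists (hrho v r); first exact: rep_hrho.
have v0 := gt1_neq0 v1.
have E N : hrho v r * \prod_(i < r) (1 - v ^- 2 ^+ (N + i)) = hsym (q_mu_rho [::] v) N r.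
  rewrite -hsym_rho // => [|m]; last exact: qbr_gt1_neq0.
  by congr (polyseq _)`_r; apply: eq_bigr => i _; rewrite q_rhoE.
apply: (@is_limit_eq _ _ _ 0%N (fun N _ => E N)).
have w1 : `|v ^- 2| < 1.
  by rewrite normrV ?unitfE ?expf_neq0 // normrX invf_lt1 ?exprn_egt1 // exprn_gt0 // (lt_trans _ v1).
rewrite -[X in is_limit _ X]mulr1; apply: is_limitM; first exact: is_limit_cst.
elim: r {E} => [|r IH].
  by apply: (@is_limit_eq (fun=> 1) _ _ 0%N) => [N _|]; rewrite ?big_ord0 //; exact: is_limit_cst.
have := is_limitM IH (is_limitD (is_limit_cst 1) (is_limitZ (- (v ^- 2 ^+ r)) (is_limit_geom w1))).
rewrite mulr0 addr0 mulr1; apply: (@is_limit_eq _ _ _ 0%N) => N _.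
by rewrite big_ord_recr /= exprD; ring.
Qed.

(* Only the first [size mu] variables of q^(mu + rho) differ from q^rho. *)
Lemma lim_rep_hsym_mu mu r :
  exists R, lim_rep R (fun v N => hsym (q_mu_rho mu v) N r).
Proof.
pose G (F : fieldType) (x y : nat -> F) : {poly F} :=
  \prod_(i < size mu) ((1 - y i *: 'X) * geom (x i) r.+1).
pose xr i : ratfun := qhalf ^ (2 * (nth 0%N mu i)%:Z - 2 * i%:Z - 1).
pose yr i : ratfun := qhalf ^ (2 * (nth 0%N [::] i)%:Z - 2 * i%:Z - 1).
have rx i : rep (xr i) (fun v => q_mu_rho mu v i) by exact: rep_qhalf_expz.
have ry i : rep (yr i) (fun v => q_mu_rho [::] v i) by exact: rep_qhalf_expz.
have repG : rep_coefs (G _ xr yr) (fun v => G _ (q_mu_rho mu v) (q_mu_rho [::] v)).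
  apply: (@rep_coefs_prod _ _ _ (fun (i : 'I_(size mu)) v =>
    (1 - q_mu_rho [::] v i *: 'X) * geom (q_mu_rho mu v i) r.+1)) => i.
  apply: rep_coefsM => j.
    rewrite -scaleNr; apply: rep_eq (rep_coefs_lin (repN (ry i)) j) _ => v.
    by rewrite scaleNr.
  rewrite coef_poly; case: ifP => jr.
    by apply: rep_eq (repX j (rx i)) _ => v; rewrite coef_poly jr.
  by apply: rep_eq rep0 _ => v; rewrite coef_poly jr.
exists (\sum_(j < r.+1) (G _ xr yr)`_j * hrho qhalf (r - j)).
have key v N : 1 < `|v| -> (size mu <= N)%N ->
   \sum_(j < r.+1) (G _ (q_mu_rho mu v) (q_mu_rho [::] v))`_j * hsym (q_mu_rho [::] v) N (r - j)
   = hsym (q_mu_rho mu v) N r.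
  move=> v1 mN; set x := q_mu_rho mu v; set y := q_mu_rho [::] v.
  have E : eq_upto r.+1 (G _ x y * hpoly y N r.+1) (hpoly x N r.+1).
    rewrite /hpoly -(subnKC mN) !big_split_ord /= mulrA.
    have -> : \prod_(i < N - size mu) geom (x (size mu + i)%N) r.+1 =
              \prod_(i < N - size mu) geom (y (size mu + i)%N) r.+1.
      apply: eq_bigr => i _; congr (geom _ _); rewrite /x /y /q_mu_rho.
      by rewrite !nth_default // leq_addr.
    apply: eq_upto_mul => //; rewrite /G -big_split /=; apply: eq_upto_prod => i _.
    rewrite mulrAC -[X in eq_upto _ _ X]mul1r; apply: eq_upto_mul => //.
    exact: geomP.
  rewrite -[RHS](E r (ltnSn r)) coefM; apply: eq_bigr => j _.
  by rewrite coef_hpoly // ltnS leq_subr.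
apply: lim_rep_eq key _.
by apply: lim_rep_sum => j _; apply: lim_repM; [exact/rep_lim/repG | exact: lim_rep_hsym].
Qed.

(** Existence for [epsilon]: the h_r converge to rational functions, and the Jacobi-Trudi
    determinant is a polynomial in them. *)
Lemma schur_q_spec nu mu : is_partition mu ->
  lim_rep (schur_q nu mu) (fun v N => schur_poly N nu (q_mu_rho mu v)).
Proof.
move=> pm; apply: (@epsilon_spec _ (inhabits 0) (is_schur_q nu mu)).
have [R hR] := ClassicalEpsilon.choice _ (lim_rep_hsym_mu mu).
exists (jt_det R nu (size nu)).
apply: (@lim_rep_eq _ (fun v N => jt_det (hsym (q_mu_rho mu v) N) nu (size nu)) _ (size nu)).
  by move=> v N v1 nN; rewrite schur_poly_jt // => i j _ _; apply: q_mu_rho_inj.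
exact: lim_rep_jt_det.
Qed.

Lemma schur_q_rho nu : schur_q nu [::] = jt_det (hrho qhalf) nu (size nu).
Proof.
apply: (lim_rep_uniq (@schur_q_spec nu [::] isT)).
apply: (@lim_rep_eq _ (fun v N => jt_det (hsym (q_mu_rho [::] v) N) nu (size nu)) _ (size nu)).
  by move=> v N v1 nN; rewrite schur_poly_jt // => i j _ _; apply: q_mu_rho_inj.
by apply: lim_rep_jt_det => r; apply: lim_rep_hsym.
Qed.

Lemma W1_conj nu : is_partition nu -> W1 (conj_part nu) = jt_det (erho qhalf) nu (size nu).
Proof.
move=> pn; rewrite /W1 schur_q_rho size_conj //.
exact: hrho_conj qhalf_neq0 qbr_qhalf_neq0 _ pn.
Qed.

(** The coefficient of Q^k in the sum over nu attached to mu, with the factor s_mu(q^rho) of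
    W_(mu,nu) taken out. *)
Definition closed_coef mu k : ratfun :=
  \sum_(nu <- parts k) schur_q nu mu * W1 (conj_part nu).

Let prod_coef mu k v N : algC := (\prod_(i < N) epoly v (q_mu_rho mu v i) k.+1)`_k.

Lemma lim_rep_closed_coef mu k : is_partition mu ->
  lim_rep (closed_coef mu k) (prod_coef mu k).
Proof.
move=> pm.
apply: (@lim_rep_eq _ (fun v N => \sum_(nu <- parts k)
   schur_poly N nu (q_mu_rho mu v) * jt_det (erho v) nu (size nu)) _ 0%N).
  move=> v N v1 _; rewrite /prod_coef dual_cauchy_coef; last first.
    by move=> i j _ _; apply: q_mu_rho_inj.
  (* Partitions longer than N drop out, as [schur_poly] is 0 on them. *)
  apply: eq_bigr => nu _; have [nN|/negbTE nN] := boolP (size nu <= N)%N.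
    by congr (_ * _); rewrite [RHS]jt_det_size // erhoE expr0 qfact0 divr1 invr1.
  by rewrite /schur_poly nN !mul0r.
apply: lim_rep_sum => nu; rewrite mem_parts => /andP[pn _].
apply: lim_repM; first exact: schur_q_spec.
rewrite W1_conj //.
by apply: (@lim_rep_jt_det _ (fun r v _ => erho v r)) => r; apply/rep_lim/rep_erho.
Qed.

(** The variable of row i is that of q^rho times v^(2 mu_i), so iterating the functional equation of
    [epoly] yields one factor per cell of the row. This is exact as soon as N >= l(mu). *)
Lemma prod_coef_shift mu k v N : 1 < `|v| -> (size mu <= N)%N ->
  \sum_(j < k.+1) (content_poly v mu)`_j * prod_coef [::] (k - j) v N = prod_coef mu k v N.
Proof.
move=> v1 mN; have v0 := gt1_neq0 v1.
have q0 m : (0 < m)%N -> qbr v m != 0 by exact: qbr_gt1_neq0.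
have shift i : eq_upto k.+1 (epoly v (q_mu_rho mu v i) k.+1)
    (\prod_(c < nth 0%N mu i) (1 + (v ^ (2 * c%:Z - 2 * i%:Z)) *: 'X) *
     epoly v (q_mu_rho [::] v i) k.+1).
  rewrite q_mu_rho_shift // -q_rhoE //.
  apply: (eq_upto_trans (@epoly_shift_iter _ _ v0 q0 _ _ _)) => j jk.
  congr (polyseq (_ * _))`_j; apply: eq_bigr => c _; congr (1 + _ *: 'X).
  rewrite q_rhoE // exprnN exprnP -expfzDr //; congr (v ^ _).
  by lia.
have E : eq_upto k.+1 (content_poly v mu * \prod_(i < N) epoly v (q_mu_rho [::] v i) k.+1)
    (\prod_(i < N) epoly v (q_mu_rho mu v i) k.+1).
  apply: eq_upto_sym; apply: (@eq_upto_trans _ _ _ _ _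
    (@eq_upto_prod _ k.+1 _ (index_enum 'I_N) xpredT _ _ (fun (i : 'I_N) _ => shift i))).
  rewrite big_split /=; apply: eq_upto_mul => // j _; congr (polyseq _)`_j.
  rewrite /content_poly -(subnKC mN) big_split_ord /= [X in _ * X]big1 ?mulr1 // => i _.
  by rewrite nth_default ?leq_addr // big_ord0.
rewrite /prod_coef -[RHS](E k (ltnSn k)) coefM; apply: eq_bigr => j _; congr (_ * _).
apply: (@eq_upto_prod _ (k - j).+1) => // i _ d dk.
by rewrite !coef_poly dk (leq_trans dk) // ltnS leq_subr.
Qed.

Lemma rep_content_poly mu j : rep (content_poly qhalf mu)`_j (fun v => (content_poly v mu)`_j).
Proof.
apply: (@rep_coefs_prod _ _ _ (fun (i : 'I_(size mu)) v => \prod_(c < nth 0%N mu i)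
   (1 + (v ^ (2 * c%:Z - 2 * i%:Z)) *: 'X))) => i.
apply: (@rep_coefs_prod _ _ _ (fun (c : 'I_(nth 0%N mu i)) v => 1 + (v ^ (2 * c%:Z - 2 * i%:Z)) *: 'X)) => c.
exact/rep_coefs_lin/rep_qhalf_expz.
Qed.

Lemma closed_coef_shift mu k : is_partition mu ->
  closed_coef mu k =
  \sum_(j < k.+1) (content_poly qhalf mu)`_j * closed_coef [::] (k - j).
Proof.
move=> pm; apply: (lim_rep_uniq (lim_rep_closed_coef k pm)).
apply: (@lim_rep_eq _ _ _ (size mu) (fun v N => @prod_coef_shift mu k v N)).
apply: lim_rep_sum => j _; apply: lim_repM; first exact/rep_lim/rep_content_poly.
exact: lim_rep_closed_coef.
Qed.

End SchurValues.

(** * The one-point function *)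

Section Convolution.

Variable R : comNzRingType.
Implicit Types (u w z : nat -> R).

(** The product of power series in one variable, given by their coefficients; its laws are imported
    from truncated polynomials. *)
Definition conv u w k : R := \sum_(j < k.+1) u j * w (k - j)%N.

Lemma conv_poly K u w k : (k < K)%N ->
  ((\poly_(i < K) u i) * (\poly_(i < K) w i))`_k = conv u w k.
Proof.
move=> kK; rewrite coefM; apply: eq_bigr => j _.
by rewrite !coef_poly !ifT // (leq_ltn_trans _ kK) // ?leq_subr // -ltnS.
Qed.

Lemma eq_upto_conv K u w :
  eq_upto K (\poly_(i < K) conv u w i) ((\poly_(i < K) u i) * (\poly_(i < K) w i)).
Proof. by move=> k kK; rewrite conv_poly // coef_poly kK. Qed.

Lemma convA u w z k : conv u (conv w z) k = conv (conv u w) z k.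
Proof.
rewrite -!(@conv_poly k.+1) //.
transitivity ((\poly_(i < k.+1) u i * (\poly_(i < k.+1) w i * \poly_(i < k.+1) z i))`_k).
  by apply: (eq_upto_mul _ (@eq_upto_conv _ _ _)).
by rewrite mulrA; apply/esym/(eq_upto_mul (@eq_upto_conv _ _ _)).
Qed.

Lemma convC u w k : conv u w k = conv w u k.
Proof. by rewrite -!(@conv_poly k.+1) // mulrC. Qed.

Lemma conv1 u k : conv (fun j => (j == 0%N)%:R) u k = u k.
Proof.
rewrite /conv big_ord_recl /= mul1r subn0 big1 ?addr0 // => j _.
by rewrite mul0r.
Qed.

Lemma eq_conv u u' w w' : u =1 u' -> w =1 w' -> conv u w =1 conv u' w'.
Proof. by move=> eu ew k; apply: eq_bigr => j _; rewrite eu ew. Qed.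

End Convolution.

Section OnePart.

Implicit Types (f g : series) (n k r : nat).

Lemma splits0 : perm_eq (splits [::]) [:: ([::], [::])].
Proof.
apply: uniq_perm => [||x]; rewrite ?undup_uniq // mem_undup inE.
apply/mapP/eqP => [[m _ ->]|->]; first by rewrite tuple0.
by exists [tuple]; rewrite ?mem_enum.
Qed.

Lemma smul_nil f g k : smul f g k [::] = conv (f^~ [::]) (g^~ [::]) k.
Proof.
by apply: eq_bigr => j _; rewrite (perm_big _ splits0) /= big_seq1.
Qed.

Lemma splits1 n : perm_eq (splits [:: n]) [:: ([:: n], [::]); ([::], [:: n])].
Proof.
apply: uniq_perm => [||x]; rewrite ?undup_uniq // mem_undup.
apply/mapP/idP => [[m _ ->]|].
  by case/tupleP: m => b m; rewrite tuple0 /=; case: b; rewrite !inE eqxx ?orbT.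
rewrite !inE => /orP[] /eqP ->.
- by exists [tuple true]; rewrite ?mem_enum.
- by exists [tuple false]; rewrite ?mem_enum.
Qed.

Lemma smul_seq1 f g k n : smul f g k [:: n] =
  conv (f^~ [:: n]) (g^~ [::]) k + conv (f^~ [::]) (g^~ [:: n]) k.
Proof.
rewrite -big_split /=; apply: eq_bigr => j _.
by rewrite (perm_big _ (splits1 n)) /= !big_cons big_nil /= addr0.
Qed.

Lemma spow_nil_small f r k : f 0%N [::] = 0 -> (k < r)%N -> spow f r k [::] = 0.
Proof.
move=> f0; elim: r k => // r IH k kr; rewrite /spow iterS -/(spow f r) smul_nil.
apply: big1 => -[[|j] /= jk] _; first by rewrite f0 mul0r.
by rewrite IH ?mulr0 //; lia.
Qed.

Lemma spow_seq1_eq0 f r k n : (forall j, f j [:: n] = 0) -> spow f r k [:: n] = 0.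
Proof.
move=> fn; elim: r k => [|r IH] k; first by rewrite /spow /= /sone andbF.
rewrite /spow iterS -/(spow f r) smul_seq1 /conv !big1 ?addr0 // => j _.
  by rewrite IH mulr0.
by rewrite fn mul0r.
Qed.

(** With g = 1 - f, the product of f with the sum of the g^r telescopes. The bound on r can be
    raised to k in every coefficient because g^r starts in degree r. *)
Lemma sinv_nil f k : f 0%N [::] = 1 ->
  conv (f^~ [::]) ((sinv f)^~ [::]) k = (k == 0%N)%:R.
Proof.
move=> f0; pose g := ssub sone f.
have g0 : g 0%N [::] = 0 by rewrite /g /ssub /sone f0 subrr.
have E j : (j < k.+1)%N -> sinv f j [::] = \sum_(r < k.+1) spow g r j [::].
  move=> jk; rewrite /sinv addn0 -(subnKC jk) big_split_ord /= [X in _ = _ + X]big1 ?addr0 //.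
  by move=> i _; apply: (@spow_nil_small g (j.+1 + i)); rewrite // addSn ltnS leq_addr.
have fE j : f j [::] = (j == 0%N)%:R - g j [::].
  by rewrite /g /ssub /sone andbT opprB addrC subrK.
rewrite /conv (eq_bigr (fun j : 'I_k.+1 => \sum_(r < k.+1)
   ((nat_of_ord j == 0%N)%:R * spow g r (k - j)%N [::] - g j [::] * spow g r (k - j)%N [::]))); last first.
  move=> j _; rewrite E ?ltnS ?leq_subr // mulr_sumr; apply: eq_bigr => r _.
  by rewrite fE mulrBl.
rewrite exchange_big /= (eq_bigr (fun r : 'I_k.+1 => - (spow g r.+1 k [::] - spow g r k [::]))); last first.
  move=> r _; rewrite sumrB opprB; congr (_ - _); first exact: (conv1 (fun j => spow g r j [::]) k).
  by rewrite /spow iterS smul_nil.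
rewrite sumrN -(big_mkord xpredT (fun r => spow g r.+1 k [::] - spow g r k [::])).
by rewrite telescope_sumr // (@spow_nil_small g k.+1 k) // sub0r opprK /spow /= /sone andbT.
Qed.

(** f - 1 has no part free of the p variables, so its powers beyond the first have no linear
    term. *)
Lemma slog_seq1 f k n : (forall j, f j [::] = (j == 0%N)%:R) ->
  slog f k [:: n] = f k [:: n].
Proof.
move=> f0; pose h := ssub f sone.
have h0 j : h j [::] = 0 by rewrite /h /ssub /sone f0 andbT subrr.
have hpow r j : (0 < r)%N -> spow h r j [::] = 0.
  case: r => // r _; rewrite /spow iterS smul_nil /conv big1 // => i _.
  by rewrite h0 mul0r.
have hn : spow h 1 k [:: n] = f k [:: n].
  rewrite /spow /= smul_seq1 [X in _ + X]big1 ?addr0; last by move=> i _; rewrite h0 mul0r.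
  rewrite convC (eq_conv (u' := fun j => (j == 0%N)%:R) (w' := h^~ [:: n])) // => [|j].
    by rewrite conv1 /h /ssub /sone andbF subr0.
  by rewrite /sone andbT.
rewrite /slog /= addn1 big_ltn // sqrrN expr1n divr1 mul1r hn.
rewrite big_nat big1 ?addr0 // => r /andP[r2 _].
case: r r2 => // r r1; rewrite /spow iterS -/(spow h r) smul_seq1 -/h.
rewrite /conv !big1 ?addr0 ?mulr0 // => i _; first by rewrite h0 mul0r.
by rewrite hpow ?mulr0.
Qed.

(** The quotient is 1 at p = 0, so the logarithm keeps its linear terms; the inverse of the series
    at p = 0 contributes none of its own. *)
Lemma normalized_seq1 f k n : f 0%N [::] = 1 ->
  slog (smul f (sinv (at_p0 f))) k [:: n] =
  conv (f^~ [:: n]) ((sinv (at_p0 f))^~ [::]) k.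
Proof.
move=> f0; rewrite slog_seq1 => [|j]; last by rewrite smul_nil; exact: (@sinv_nil (at_p0 f) j f0).
rewrite smul_seq1 [X in _ + X]big1 ?addr0 // => j _.
rewrite [sinv _ _ [:: n]]big1 ?mulr0 // => r _; apply: spow_seq1_eq0 => i.
by rewrite /ssub /sone /at_p0 andbF subr0.
Qed.

End OnePart.

Section Hooks.

Implicit Types (a b n : nat) (mu : seq nat).

Lemma hook_partition a b : is_partition (hook a b).
Proof.
rewrite /is_partition inE /= mem_nseq andbF andbT.
by case: b => //= b; elim: b => //= b; case: b.
Qed.

Lemma kappa_hook a b : kappa (hook a b) = (a + b).+1%:Z * (a%:Z - b%:Z).
Proof.
rewrite /kappa /= size_nseq big_ord_recl /=.
rewrite (eq_bigr (fun j : 'I_b => - (2 * j.+1)%N%:Z)) => [|j _]; last first.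
  by rewrite /bump /= nth_nseq ltn_ord; lia.
rewrite sumrN -(big_morph Posz PoszD (erefl _)) -big_distrr /=.
have -> : (2 * \sum_(j < b) j.+1 = b * b.+1)%N.
  elim: b => [|b IH]; first by rewrite big_ord0.
  by rewrite big_ord_recr /= mulnDr IH; lia.
by lia.
Qed.

Lemma zpart_seq1 n : zpart [:: n.+1] = n.+1.
Proof.
rewrite /zpart /= addn0 big_nat_recr //= eqxx expn1 muln1.
rewrite big_nat big1 ?mul1n // => j /andP[_ jn].
by rewrite gtn_eqF // expn0.
Qed.

Lemma is_hookP n mu : mu \in parts n.+1 -> size mu + head 0%N mu = n.+2 ->
  exists2 b, (b < n.+1)%N & mu = hook (n - b) b.
Proof.
rewrite mem_parts => /andP[/andP[_]]; case: mu => //= x s.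
rewrite inE negb_or => /andP[x0 s0] /eqP sx E.
have ss : sumn s = size s by lia.
have : s = nseq (size s) 1%N.
  elim: s s0 ss {sx E} => //= y s IH; rewrite inE negb_or => /andP[y0 s0] E.
  have le : (size s <= sumn s)%N.
    elim: s s0 {IH E} => //= z s IH; rewrite inE negb_or => /andP[z0 /IH]; lia.
  by rewrite -IH //; [congr (_ :: _) | ]; lia.
move=> ->; exists (size s); first by lia.
by rewrite /hook; congr (_ :: _); lia.
Qed.

Lemma size_head_le n mu : mu \in parts n.+1 -> (size mu + head 0%N mu <= n.+2)%N.
Proof.
rewrite mem_parts => /andP[/andP[_]]; case: mu => //= x s.
rewrite inE negb_or => /andP[x0 s0] /eqP sx.
suff : (size s <= sumn s)%N by lia.
elim: s s0 {sx} => //= z s IH; rewrite inE negb_or => /andP[z0 /IH]; lia.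
Qed.

Lemma sum_hooks (V : nmodType) n (F : seq nat -> V) :
  (forall mu, mu \in parts n.+1 -> (size mu + head 0%N mu <= n.+1)%N -> F mu = 0) ->
  \sum_(mu <- parts n.+1) F mu = \sum_(b < n.+1) F (hook (n - b) b).
Proof.
move=> F0; rewrite (bigID (fun mu => size mu + head 0%N mu == n.+2)) /=.
rewrite [X in _ + X]big_seq_cond [X in _ + X]big1 ?addr0 => [|mu /andP[mun E]]; last first.
  by apply: F0 => //; have := size_head_le mun; lia.
rewrite -big_filter -(big_mkord xpredT (fun b => F (hook (n - b) b))) /index_iota subn0.
rewrite -(big_map (fun b => hook (n - b) b) xpredT F); apply: perm_big.
apply: uniq_perm; first exact: filter_uniq (parts_uniq _).
  rewrite map_inj_in_uniq ?iota_uniq // => b c _ _ [_ /(congr1 size)].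
  by rewrite !size_nseq.
move=> mu; rewrite mem_filter; apply/andP/mapP => [[/eqP E mun]|[b]].
  by have [b bn ->] := is_hookP mun E; exists b; rewrite ?mem_iota.
rewrite mem_iota /= => bn ->; rewrite mem_parts hook_partition sumn_hook /=.
by rewrite size_nseq; split; apply/eqP; lia.
Qed.

End Hooks.

Section OnePointFunction.

Implicit Types (a : int) (n k : nat).

Lemma cstM : {morph cst : x y / x * y}.
Proof. by move=> x y; rewrite /cst polyCM tofracM. Qed.

Lemma cst_sign b : cst ((-1) ^+ b) = (-1) ^+ b.
Proof. by rewrite /cst !rmorphXn /= !rmorphN !rmorph1. Qed.

Lemma parts0 : parts 0 = [:: [::]].
Proof.
apply: perm_small_eq => //; apply: uniq_perm; rewrite ?parts_uniq // => mu.
rewrite mem_parts inE; case: mu => // x s /=.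
by rewrite /is_partition inE negb_or; case: x => [|x]; rewrite ?andbF.
Qed.

Lemma schur_q_nil : schur_q [::] [::] = 1.
Proof. by rewrite schur_q_rho /jt_det det_mx00. Qed.

Lemma Zopen_nil a k : Zopen a k [::] = closed_coef [::] k.
Proof.
rewrite /Zopen /= parts0 big_seq1; apply: eq_bigr => nu _.
rewrite sym_char0 /zpart big_nil expr0 mulr1 divr1.
rewrite /kappa big_ord0 mulr0 expr0z /W2 schur_q_nil !mul1r.
by rewrite /cst polyC1 tofrac1 mulr1.
Qed.

Lemma closed_coef_nil0 : closed_coef [::] 0 = 1.
Proof. by rewrite /closed_coef parts0 big_seq1 /W1 /= schur_q_nil mulr1. Qed.

Lemma Zopen_seq1 a n k : Zopen a k [:: n.+1] =
  \sum_(b < n.+1) qhalf ^ (a * kappa (hook (n - b) b)) *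
    schur_q (hook (n - b) b) [::] * cst ((-1) ^+ b / (n.+1%:R * 'i)) *
    closed_coef (hook (n - b) b) k.
Proof.
rewrite /Zopen /= addn0 sum_hooks => [|mu mun hk].
  apply: eq_bigr => b _; rewrite /closed_coef [RHS]mulr_sumr; apply: eq_bigr => nu _.
  rewrite zpart_seq1 expr1 /W2.
  have bn : (b <= n)%N by rewrite -ltnS.
  have E : sym_char (hook (n - b) b) [:: n.+1] = (-1) ^+ b.
    by rewrite -(sym_char_hook (n - b) b) subnK.
  rewrite E.
  have shuffle (R : comNzRingType) (x s t w c : R) :
    x * (s * t) * w * c = x * s * c * (t * w) by ring.
  exact: shuffle.
move: mun; rewrite mem_parts => /andP[pm /eqP sm].
apply: big1 => nu _; rewrite -sm sym_char_nonhook ?sm //.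
by rewrite mul0r /cst polyC0 tofrac0 mulr0.
Qed.

(** By [closed_coef_shift] each hook carries the same factor [closed_coef [::]], which the inverse
    of the amplitude at p = 0 cancels. *)
Lemma one_point_hooks a n k : one_point a n.+1 k =
  \sum_(b < n.+1) qhalf ^ (a * kappa (hook (n - b) b)) *
    schur_q (hook (n - b) b) [::] * cst ((-1) ^+ b / (n.+1%:R * 'i)) *
    (content_poly qhalf (hook (n - b) b))`_k.
Proof.
rewrite /one_point /Fopen /Zhat normalized_seq1 ?Zopen_nil ?closed_coef_nil0 //.
set I := (X in conv _ X).
rewrite /conv; under eq_bigr do rewrite Zopen_seq1 mulr_suml.
rewrite exchange_big /=; apply: eq_bigr => b _.
move: (_ * cst _) => c; have := hook_partition (n - b) b; move: (hook _ _) => mu pm.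
transitivity (c * conv (closed_coef mu) I k).
  by rewrite /conv mulr_sumr; apply: eq_bigr => j _; rewrite mulrA.
congr (_ * _).
rewrite (eq_conv (u' := conv (fun j => (content_poly qhalf mu)`_j) (closed_coef [::])) (w' := I)) //; last first.
  by move=> j; apply: closed_coef_shift.
rewrite -convA convC -[RHS](conv1 _ k); apply: eq_conv => // j.
rewrite -(@sinv_nil (at_p0 (Zopen a))) /at_p0 /= ?Zopen_nil ?closed_coef_nil0 //.
by apply: eq_conv => // i; rewrite Zopen_nil.
Qed.

(** For the hook with leg b, the framing contributes the exponent a (n+1) (n - 2b) of [qhalf] and
    the contents contribute k (n - 2b). Together they are y^(n - 2b), the shape summed by
    [q_binomial_eval]. *)
Lemma one_point_closed a n k :
  let y := qhalf ^ (a * n.+1%:Z + k%:Z) in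
  one_point a n.+1 k =
  cst (n.+1%:R * 'i)^-1 * qbin qhalf n.+1 k / (qbr qhalf n.+1 * qfact qhalf n) *
  \prod_(l < n) (y * qhalf ^+ l.+1 - y^-1 * qhalf ^- l.+1).
Proof.
move=> y; have v0 := qhalf_neq0; have q0 := qbr_qhalf_neq0.
have y0 : y != 0 by rewrite expfz_neq0.
rewrite -(q_binomial_eval v0 q0) // one_point_hooks mulr_sumr; apply: eq_bigr => b _.
have bn : (b <= n)%N by rewrite -ltnS.
rewrite kappa_hook schur_q_rho (hrho_hook v0 q0) (content_poly_hook v0 q0) (subnK bn).
rewrite cstM cst_sign [qbin _ n b]/qbin bn.
have -> : y ^ (n%:Z - 2 * b%:Z) =
    qhalf ^ (a * (n.+1%:Z * ((n - b)%:Z - b%:Z))) * qhalf ^ (k%:Z * ((n - b)%:Z - b%:Z)).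
  have expE (F : fieldType) (v : F) (r s t u : int) :
      v != 0 -> r * s = t + u -> (v ^ r) ^ s = v ^ t * v ^ u.
    by move=> vn0 E; rewrite -expfzDr // -E exprz_exp.
  by apply: (expE _ _ _ _ _ _ v0); rewrite -subzn //; ring.
have shuffle (R : fieldType) (e c x z t w A B C D : R) :
    D != 0 -> A != 0 -> B != 0 -> C != 0 ->
    z * (w / (D * C * B)) * (e * c) * (x * t) =
    c * x / (D * A) * (e * (A / (B * C)) * (z * t) * w).
  by move=> ? ? ? ?; field; apply/and4P.
apply: shuffle; first exact: q0.
- exact: (qfact_neq0 q0).
- exact: (qfact_neq0 q0).
- exact: (qfact_neq0 q0).
Qed.

End OnePointFunction.

(** * Laurent expansion at a simple pole *)

Section ConvolutionInverse.

Variable F : fieldType.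
Implicit Types (u w z : nat -> F).

(** In degree m + k, with m the order of u, only u_m w_k survives: the other terms vanish by
    minimality of m or by induction. *)
Lemma conv_eq0 u w : (exists j, u j != 0) -> (forall k, conv u w k = 0) -> forall k, w k = 0.
Proof.
move=> ex_u; pose m := ex_minn ex_u.
have [um m_min] : u m != 0 /\ forall j, (j < m)%N -> u j = 0.
  rewrite /m; case: ex_minnP => i ui imin; split=> // j ji.
  by apply/eqP; apply: contraTT ji => /imin; rewrite -leqNgt.
move=> uw k; elim/ltn_ind: k => k IH.
have mk : (m < (m + k).+1)%N by rewrite ltnS leq_addr.
have := uw (m + k)%N; rewrite /conv (bigD1 (Ordinal mk)) //= addKn big1 ?addr0.
  by move/eqP; rewrite mulf_eq0 (negbTE um) => /eqP.
move=> i /negP im; have [lt|le] := ltnP i m; first by rewrite m_min ?mul0r.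
rewrite IH ?mulr0 //; have : nat_of_ord i <> m by move=> E; apply: im; apply/eqP/val_inj.
by have := ltn_ord i; lia.
Qed.

Lemma conv_inj u w z : (exists j, u j != 0) -> conv u w =1 conv u z -> w =1 z.
Proof.
move=> un0 E k; apply/eqP; rewrite -subr_eq0; apply/eqP.
apply: (conv_eq0 (w := fun k => w k - z k) un0) => j.
rewrite /conv; under eq_bigr do rewrite mulrBr.
by rewrite sumrB -/(conv u w j) -/(conv u z j) E subrr.
Qed.

(** Division of power series: the list of the first coefficients determines the next one. *)
Lemma conv_solve u z : u 0%N != 0 -> exists w, conv u w =1 z.
Proof.
move=> u0.
pose step s := rcons s ((z (size s) - \sum_(j < size s) u j.+1 * nth 0 s (size s - j.+1)) / u 0%N).
pose s n := iter n step [::].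
have sz n : size (s n) = n by elim: n => //= n IH; rewrite size_rcons IH.
have nth_s m n k : (k < n)%N -> (n <= m)%N -> nth 0 (s m) k = nth 0 (s n) k.
  move=> kn; elim: m => [|m IH]; first by rewrite leqn0 => /eqP n0; rewrite n0 in kn.
  rewrite leq_eqVlt => /orP[/eqP <- //|]; rewrite ltnS => nm.
  by rewrite /= nth_rcons sz (leq_trans kn nm) IH.
exists (fun k => nth 0 (s k.+1) k) => k.
rewrite /conv big_ord_recl /= subn0 nth_rcons sz ltnn eqxx mulrCA mulfV // mulr1.
rewrite [X in _ + X](eq_bigr (fun j : 'I_k => u j.+1 * nth 0 (s k) (k - j.+1))) ?subrK // => j _.
rewrite /bump /= add1n; congr (_ * _).
by apply/esym/(@nth_s k (k - j.+1).+1); have := ltn_ord j; lia.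
Qed.

End ConvolutionInverse.

Section ExpCoef.

Implicit Types (A B : {poly algC}) (n : nat).

Lemma exp_coef_wide N A n : (size A <= N)%N ->
  exp_coef A n = \sum_(j < N) A`_j * ('i * j%:R / 2) ^+ n / n`!%:R.
Proof.
move=> AN; apply/esym/(@sum_ord_extend _ (fun j => A`_j * ('i * j%:R / 2) ^+ n / n`!%:R)) => //.
by move=> j /andP[Aj _]; rewrite nth_default // !mul0r.
Qed.

Lemma exp_coefD A B n : exp_coef (A + B) n = exp_coef A n + exp_coef B n.
Proof.
pose N := maxn (size A) (size B).
rewrite (@exp_coef_wide N (A + B)) ?size_polyD // (@exp_coef_wide N A) ?leq_maxl //.
rewrite (@exp_coef_wide N B) ?leq_maxr // -big_split; apply: eq_bigr => j _.
by rewrite coefD !mulrDl.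
Qed.

Lemma exp_coefZ c A n : exp_coef (c *: A) n = c * exp_coef A n.
Proof.
rewrite (@exp_coef_wide (size A) (c *: A)) ?size_scale_leq // mulr_sumr.
by apply: eq_bigr => j _; rewrite coefZ !mulrA.
Qed.

Lemma exp_coef0 n : exp_coef 0 n = 0.
Proof. by rewrite /exp_coef size_poly0 big_ord0. Qed.

Lemma exp_coef_sum (I : Type) (r : seq I) (P : pred I) (G : I -> {poly algC}) n :
  exp_coef (\sum_(i <- r | P i) G i) n = \sum_(i <- r | P i) exp_coef (G i) n.
Proof.
by elim/big_ind2: _ => [|? ? ? ? <- <-|//]; rewrite ?exp_coef0 ?exp_coefD.
Qed.

Lemma exp_coefXn j n : exp_coef 'X^j n = ('i * j%:R / 2) ^+ n / n`!%:R.
Proof.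
rewrite /exp_coef size_polyXn big_ord_recr /= coefXn eqxx mul1r big1 ?add0r // => i _.
by rewrite coefXn ltn_eqF // !mul0r.
Qed.

Lemma exp_coefXnM i j n :
  exp_coef ('X^i * 'X^j) n = conv (exp_coef 'X^i) (exp_coef 'X^j) n.
Proof.
rewrite -exprD exp_coefXn natrD mulrDr mulrDl addrC exprDn mulr_suml.
apply: eq_bigr => m _; rewrite !exp_coefXn -mulr_natr.
have mn : (m <= n)%N by rewrite -ltnS.
have nz p : p`!%:R != 0 :> algC by rewrite pnatr_eq0 -lt0n fact_gt0.
rewrite -(bin_fact mn) !natrM; have := nz m; have := nz (n - m)%N.
have : 'C(n, m)%:R != 0 :> algC by rewrite pnatr_eq0 -lt0n bin_gt0.
move: ('C(n, m)%:R : algC) (m`!%:R : algC) ((n - m)`!%:R : algC) => c p q c0 q0 p0.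
by move: (_ ^+ m) (_ ^+ (n - m)) => s t; field; rewrite c0 q0 p0.
Qed.

Lemma exp_coefM A B n : exp_coef (A * B) n = conv (exp_coef A) (exp_coef B) n.
Proof.
rewrite -(coefK A) poly_def mulr_suml exp_coef_sum /conv.
under [RHS]eq_bigr do rewrite exp_coef_sum mulr_suml.
rewrite exchange_big; apply: eq_bigr => i _ /=.
rewrite -(coefK B) poly_def mulr_sumr exp_coef_sum.
under [RHS]eq_bigr do rewrite exp_coef_sum mulr_sumr.
rewrite exchange_big; apply: eq_bigr => j _ /=.
rewrite -scalerAl -scalerAr !exp_coefZ exp_coefXnM !mulr_sumr.
by apply: eq_bigr => m _; rewrite !exp_coefZ; ring.
Qed.

Lemma exp_coef_0 A : exp_coef A 0 = A.[1].
Proof.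
rewrite horner_coef; apply: eq_bigr => j _.
by rewrite expr0 divr1 expr1n.
Qed.

(** If the first N coefficients vanished, so would the sum of the A_j p(x_j) for every p of degree
    below N. A polynomial vanishing at all the distinct nodes x_j but the last isolates the leading
    coefficient of A. *)
Lemma exp_coef_neq0 A : A != 0 -> exists n, exp_coef A n != 0.
Proof.
move=> A0; pose N := size A; pose x (j : nat) : algC := 'i * j%:R / 2.
have [/existsP [n hn]|] := boolP [exists n : 'I_N, exp_coef A n != 0]; first by exists n.
rewrite negb_exists => /forallP all0.
have mom n : (n < N)%N -> \sum_(j < N) A`_j * x j ^+ n = 0.
  move=> nN; have /negPn/eqP := all0 (Ordinal nN); rewrite /exp_coef -mulr_suml => /eqP.
  by rewrite mulf_eq0 invr_eq0 pnatr_eq0 (gtn_eqF (fact_gt0 _)) orbF => /eqP.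
have N0 : (0 < N)%N by rewrite lt0n size_poly_eq0.
pose p := \prod_(j < N.-1) ('X - (x j)%:P).
have sp : size p = N by rewrite size_prod_XsubC /index_enum -enumT size_enum_ord prednK.
have : \sum_(j < N) A`_j * p.[x j] = 0.
  under eq_bigr do rewrite horner_coef sp mulr_sumr.
  rewrite exchange_big /= big1 // => n _.
  under eq_bigr do rewrite mulrCA; by rewrite -mulr_sumr mom ?mulr0.
rewrite -(prednK N0) big_ord_recr /= big1 ?add0r => [/eqP|j _]; last first.
  by rewrite horner_prod (bigD1 j) //= hornerXsubC subrr mul0r mulr0.
rewrite mulf_eq0 -[A`__]/(lead_coef A) lead_coef_eq0 (negbTE A0) /= horner_prod.
case/prodf_eq0 => j _; rewrite hornerXsubC subr_eq0 /x -!mulrA => /eqP.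
move/(mulfI (neq0Ci _))/(mulIf (_ : 2^-1 != 0)); rewrite invr_eq0 pnatr_eq0 => /(_ isT)/eqP.
by rewrite eqr_nat gtn_eqF // ltn_ord.
Qed.

End ExpCoef.

Section Laurent.

Local Notation "p %:F" := (@FracField.tofrac {poly algC} p) (at level 1, format "p %:F") : ring_scope.

Implicit Types (R S g : ratfun) (m n w : nat) (c : int -> algC).

Lemma convCA (F : comNzRingType) (u w z : nat -> F) k :
  conv u (conv w z) k = conv w (conv u z) k.
Proof. by rewrite !convA; apply: eq_conv => // j; apply: convC. Qed.

Lemma conv_delta (F : comNzRingType) w (u : nat -> F) n :
  conv (fun j => (j == w)%:R) u n = if (w <= n)%N then u (n - w)%N else 0.
Proof.
have [wn|nw] := leqP w n.
  have wn' : (w < n.+1)%N by [].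
  rewrite /conv (bigD1 (Ordinal wn')) //= eqxx mul1r big1 ?addr0 // => j /negP jw.
  case: eqP => [E|_]; last by rewrite mul0r.
  by case: jw; apply/eqP/val_inj.
by rewrite /conv big1 // => j _; rewrite ltn_eqF ?mul0r // (leq_trans _ nw).
Qed.

(** R vanishes to order at least m at [qhalf] = 1, that is at lambda = 0, and y is the coefficient
    of ([qhalf] - 1)^m; y may be 0. *)
Definition ord_value (m : int) R (y : algC) : Prop :=
  exists2 g, R = (qhalf - 1) ^ m * g & rat_value g 1 y.

Lemma qhalf1_neq0 : qhalf - 1 != 0.
Proof.
rewrite /qhalf -[1]tofrac1 -tofracB tofrac_eq0 -polyC1 polyXsubC_eq0 //.
Qed.

Section Pole.

Variables (P Q : {poly algC}).
Hypothesis Q1 : Q.[1] != 0.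
Let D := ('X - 1%:P) * Q.

Lemma pole_den_neq0 : D != 0.
Proof.
by rewrite mulf_neq0 ?polyXsubC_eq0 //; apply: contraNneq Q1 => ->; rewrite horner0.
Qed.

Lemma exp_coef_pole0 : exp_coef D 0 = 0.
Proof. by rewrite exp_coef_0 hornerM hornerXsubC subrr mul0r. Qed.

Lemma exp_coef_pole1 : exp_coef D 1 = 'i / 2 * Q.[1].
Proof.
rewrite exp_coefM /conv !big_ord_recl big_ord0 addr0 /= subn0 subnn.
rewrite !exp_coef_0 hornerXsubC subrr mul0r add0r; congr (_ * _).
have -> : 'X - 1%:P = 'X^1 + (-1) *: 'X^0 :> {poly algC}.
  by rewrite expr1 expr0 scaleN1r polyC1.
by rewrite exp_coefD exp_coefZ !exp_coefXn !expr1 !(mulr0, mul0r) mulr1 divr1 addr0.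
Qed.

Lemma exp_coef_pole1_neq0 : exp_coef D 1 != 0.
Proof.
by rewrite exp_coef_pole1 mulf_neq0 // mulf_neq0 ?neq0Ci // invr_eq0 pnatr_eq0.
Qed.

Lemma is_laurent_pole : exists c, is_laurent (P%:F / D%:F) c.
Proof.
have [u hu] := @conv_solve _ (fun j => exp_coef D j.+1) (exp_coef P) exp_coef_pole1_neq0.
exists (fun e : int => if -1 <= e then u (absz (e + 1)) else 0), P, D, 1%N.
split=> [|//|e|n]; first exact: pole_den_neq0.
  by rewrite ltNge => /negbTE ->.
case: n => [|n]; first by rewrite big_ord_recl big_ord0 exp_coef_pole0 mul0r addr0.
rewrite big_ord_recl exp_coef_pole0 mul0r add0r subn1 /= -hu; apply: eq_bigr => j _.
rewrite /bump /= add1n subSS ifT; last by lia.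
by congr (_ * u _); lia.
Qed.

(** [epsilon] leaves the fraction A / B and the shift w unknown. Cross multiplying and cancelling
    the series of B replaces them by P and D, whose lowest terms give the coefficient. *)
Lemma is_laurent_pole_coef c : is_laurent (P%:F / D%:F) c ->
  c (-1) = 2 * (P.[1] / Q.[1]) / 'i.
Proof.
case=> [A [B [w [B0 E csupp hc]]]].
have ABD : D * A = B * P.
  move/eqP: E; rewrite eqr_div ?tofrac_eq0 ?pole_den_neq0 // -!tofracM tofrac_eq => /eqP E.
  by rewrite mulrC -E mulrC.
pose C n := c (n%:Z - w%:Z); pose dl n : algC := (n == w)%:R.
have hC : conv (exp_coef B) C =1 conv dl (exp_coef A).
  by move=> n; rewrite conv_delta -hc.
have {hC} DC : conv (exp_coef D) C =1 conv dl (exp_coef P).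
  apply: (conv_inj (exp_coef_neq0 B0)) => n.
  rewrite convCA (eq_conv (frefl _) hC) convCA [RHS]convCA.
  by apply: eq_conv => // j; rewrite -!exp_coefM ABD.
(* For w = 0 there is no term at exponent -1, and since the series of D starts in degree one, P
   vanishes at 1. *)
case: w @C @dl csupp {hc} DC => [|w] C dl csupp DC.
  have := DC 0%N; rewrite conv_delta /conv big_ord_recl big_ord0 exp_coef_pole0 mul0r addr0.
  by rewrite leqnn exp_coef_0 csupp // => <-; rewrite mul0r mulr0 mul0r.
have step n : (forall i, (i < n)%N -> C i = 0) -> exp_coef D 1 * C n = conv dl (exp_coef P) n.+1.
  move=> C0; rewrite -DC /conv !big_ord_recl exp_coef_pole0 mul0r add0r.
  rewrite /bump /= subSS subn0 big1 ?addr0 // => i _.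
  by rewrite C0 ?mulr0 // /bump /=; have := ltn_ord i; lia.
(* The coefficients at exponents below -1 vanish one after another. *)
have Cw n : (n <= w)%N -> forall i, (i < n)%N -> C i = 0.
  elim: n => // n IH nw i; rewrite ltnS leq_eqVlt => /orP[/eqP->|]; last exact: IH (ltnW nw) i.
  have := step n (IH (ltnW nw)); rewrite conv_delta ltnS leqNgt nw => /eqP.
  by rewrite mulf_eq0 (negbTE exp_coef_pole1_neq0) => /eqP.
have := step w (Cw w (leqnn w)); rewrite conv_delta leqnn subnn exp_coef_0 exp_coef_pole1.
have -> : C w = c (-1) by rewrite /C; congr (c _); lia.
move=> <-; have := Q1; have := neq0Ci algC; move: 'i (Q.[1]) => i q i0 q0.
by field; rewrite q0 i0.
Qed.

End Pole.

Lemma laurent_ord_value R y : ord_value (-1) R y -> laurent R (-1) = 2 * y / 'i.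
Proof.
case=> g RE [P [Q [gE Q1 ->]]].
have E : R = P%:F / (('X - 1%:P) * Q)%:F.
  by rewrite RE gE tofracM tofracB polyC1 tofrac1 invfM mulrCA exprN1.
apply: (is_laurent_pole_coef Q1); rewrite -E.
apply: (@epsilon_spec _ (inhabits (fun _ => 0)) (is_laurent R)).
by rewrite E; apply: is_laurent_pole.
Qed.

End Laurent.

Section OrderAtOne.

Implicit Types (R S g : ratfun).

Lemma ord_valueM m n R S y z : ord_value m R y -> ord_value n S z ->
  ord_value (m + n) (R * S) (y * z).
Proof.
case=> g -> gy [h -> hz]; exists (g * h); last exact: rat_valueM.
by rewrite (expfzDr _ _ qhalf1_neq0) mulrACA.
Qed.

Lemma ord_valueV m R y : ord_value m R y -> y != 0 -> ord_value (- m) R^-1 y^-1.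
Proof.
case=> g -> gy y0; exists g^-1; last exact: rat_valueV.
by rewrite invfM invr_expz.
Qed.

Lemma ord_value_cst c : ord_value 0 (cst c) c.
Proof.
exists (cst c); first by rewrite expr0z mul1r.
by rewrite -[X in rat_value _ _ X](hornerC c 1); apply: rat_value_poly.
Qed.

Lemma ord_value_prod n (R : nat -> ratfun) (y : nat -> algC) :
  (forall i, ord_value 1 (R i) (y i)) ->
  ord_value n%:Z (\prod_(i < n) R i) (\prod_(i < n) y i).
Proof.
move=> h; elim: n => [|n IH].
  by rewrite !big_ord0; have := ord_value_cst 1; rewrite /cst polyC1 tofrac1.
by rewrite !big_ord_recr /= -addn1 PoszD; apply: ord_valueM.
Qed.

(** Write v^n - v^-n = (v - 1) (1 + v + ... + v^(2n-1)) v^-n; the sum has 2n terms, each 1 at v =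
    1. *)
Lemma ord_value_nat_bracket n :
  ord_value 1 (qhalf ^+ n - qhalf ^- n) (2 * n%:R).
Proof.
have qv k : rat_value (qhalf ^+ k) 1 1.
  have := rat_value_poly ('X^k) 1; rewrite hornerXn expr1n /qhalf.
  by rewrite rmorphXn.
have sv k : rat_value (\sum_(i < k) qhalf ^+ i) 1 k%:R.
  elim: k => [|k IH]; last by rewrite big_ord_recr /= -natr1; apply: rat_valueD.
  by rewrite big_ord0 -[0]tofrac0 -[0%:R](horner0 1); apply: rat_value_poly.
exists ((\sum_(i < n + n) qhalf ^+ i) * (qhalf ^+ n)^-1); last first.
  have -> : 2 * n%:R = (n + n)%:R / 1 :> algC by rewrite divr1 natrD; ring.
  exact: rat_valueM (sv _) (rat_valueV (qv n) (oner_neq0 _)).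
rewrite expr1z mulrA -subrX1 exprD mulrBl mul1r mulfK //.
by rewrite expf_neq0 // qhalf_neq0.
Qed.

Lemma ord_valueN m R y : ord_value m R y -> ord_value m (- R) (- y).
Proof.
move=> h; have := ord_valueM (ord_value_cst (-1)) h.
by rewrite add0r mulN1r /cst polyCN polyC1 tofracN tofrac1 mulN1r.
Qed.

Lemma ord_value_bracket (z : int) :
  ord_value 1 (qhalf ^ z - (qhalf ^ z)^-1) (2 * z%:~R).
Proof.
case: z => n; first exact: ord_value_nat_bracket.
rewrite NegzE -invr_expz invrK -opprB mulrNz mulrN.
exact: ord_valueN (ord_value_nat_bracket n.+1).
Qed.

Lemma ord_value_qbr n : ord_value 1 (qbr qhalf n) (2 * n%:R).
Proof. by rewrite qbrE; apply: ord_value_nat_bracket. Qed.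

Lemma ord_value_qfact n : ord_value n%:Z (qfact qhalf n) (2 ^+ n * n`!%:R).
Proof.
have -> : 2 ^+ n * n`!%:R = \prod_(i < n) (2 * i.+1%:R) :> algC.
  elim: n => [|n IH]; first by rewrite big_ord0 expr0 mulr1.
  by rewrite big_ord_recr /= -IH exprS factS natrM; ring.
by apply: (@ord_value_prod n (fun i => qbr qhalf i.+1) (fun i => 2 * i.+1%:R)) => i; exact: ord_value_qbr.
Qed.

Lemma ord_value_qbin n k :
  ord_value 0 (qbin qhalf n k) 'C(n, k)%:R.
Proof.
rewrite /qbin; have [kn|nk] := leqP k n; last first.
  by rewrite bin_small //; have := ord_value_cst 0; rewrite /cst polyC0 tofrac0.
have nz m : (2 ^+ m * m`!%:R : algC) != 0.
  by rewrite mulf_neq0 ?expf_neq0 ?pnatr_eq0 // -lt0n fact_gt0.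
have := ord_valueM (ord_value_qfact n)
  (ord_valueV (ord_valueM (ord_value_qfact k) (ord_value_qfact (n - k))) (mulf_neq0 (nz k) (nz (n - k)%N))).
have -> : n%:Z - (k%:Z + (n - k)%N%:Z) = 0 by lia.
have -> // : 2 ^+ n * n`!%:R / (2 ^+ k * k`!%:R * (2 ^+ (n - k) * (n - k)`!%:R)) = 'C(n, k)%:R :> algC.
apply/(canLR (mulfK (mulf_neq0 (nz k) (nz (n - k)%N)))).
by rewrite -(bin_fact kn) -[in 2 ^+ n](subnK kn) exprD !natrM; ring.
Qed.

Lemma one_point_laurent a n k :
  laurent (one_point a n.+1 k) (-1) =
  - ((\prod_(l < n) (a * n.+1%:Z + k%:Z + l.+1%:Z)%:~R) * 'C(n.+1, k)%:R /
     (n.+1%:R * n.+1`!%:R)).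
Proof.
set z := fun l : nat => a * n.+1%:Z + k%:Z + l.+1%:Z.
have qn0 : 2 ^+ n * n`!%:R != 0 :> algC.
  by rewrite mulf_neq0 ?expf_neq0 ?pnatr_eq0 // -lt0n fact_gt0.
have bn0 : 2 * n.+1%:R != 0 :> algC by rewrite mulf_neq0 ?pnatr_eq0.
have v1 : ord_value n%:Z (\prod_(l < n) (qhalf ^ z l - (qhalf ^ z l)^-1))
    (\prod_(l < n) (2 * (z l)%:~R)).
  apply: (@ord_value_prod n (fun l => qhalf ^ z l - (qhalf ^ z l)^-1)
    (fun l => 2 * (z l)%:~R)) => l; exact: ord_value_bracket.
have := ord_valueM (ord_valueM (ord_valueM (ord_value_cst (n.+1%:R * 'i)^-1) (ord_value_qbin n.+1 k))
   (ord_valueV (ord_valueM (ord_value_qbr n.+1) (ord_value_qfact n)) (mulf_neq0 bn0 qn0))) v1.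
(* There are n brackets in the product against n + 1 in the denominator, so at most a simple pole
   remains. *)
have -> : 0 + 0 - (1 + n%:Z) + n%:Z = -1 by lia.
have -> : \prod_(l < n) (qhalf ^ z l - (qhalf ^ z l)^-1) =
    \prod_(l < n) (qhalf ^ (a * n.+1%:Z + k%:Z) * qhalf ^+ l.+1 -
      (qhalf ^ (a * n.+1%:Z + k%:Z))^-1 * qhalf ^- l.+1).
  apply: eq_bigr => l _; rewrite -invfM.
  by rewrite /z (expfzDr _ _ qhalf_neq0).
rewrite -one_point_closed => /laurent_ord_value ->.
rewrite big_split prodr_const card_ord /= factS natrM.
have := neq0Ci algC; have i2 := sqrCi algC.
have : n.+1%:R != 0 :> algC by rewrite pnatr_eq0.
have : n`!%:R != 0 :> algC by rewrite pnatr_eq0 -lt0n fact_gt0.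
have : 2 ^+ n != 0 :> algC by rewrite expf_neq0 // pnatr_eq0.
move: i2 (2 ^+ n) (n`!%:R : algC) (n.+1%:R : algC) ('C(_, _)%:R : algC) (\prod_(_ < _) _).
move: 'i => i i2 p f N c P p0 f0 N0 i0.
(* The powers of 2 cancel; one 'i comes from the amplitude and one from e^(i lambda / 2) - 1, and
   their product gives the minus sign. *)
transitivity (P * c / (N * (N * f)) / i ^+ 2); last by rewrite i2 invrN1 mulrN1.
by field; rewrite p0 f0 N0 i0.
Qed.

End OrderAtOne.

(** * Moebius inversion *)

Section Moebius.

Implicit Types (g k m n p s : nat).

Lemma moebius_coprime_mul p m : prime p -> (0 < m)%N -> ~~ (p %| m)%N ->
  moebius (p * m) = - moebius m.
Proof.
move=> pp m0 pm; have p0 := prime_gt0 pp.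
have pmP : p \notin primes m by rewrite mem_primes pp m0.
have perm : perm_eq (primes (p * m)) (p :: primes m).
  apply: uniq_perm; rewrite /= ?pmP ?primes_uniq // => q.
  by rewrite primesM // primes_prime // !inE.
rewrite /moebius muln_gt0 p0 m0 /= (perm_all _ perm) (perm_size perm) /=.
rewrite lognM // logn_prime // eqxx /= (_ : logn p m = 0%N) /=; last first.
  by apply/eqP; rewrite -leqn0 leqNgt logn_gt0.
rewrite (eq_in_all (a2 := fun q => logn q m == 1%N)) => [|q qm].
  by case: ifP => _; rewrite ?oppr0 // exprS mulN1r.
by rewrite lognM // logn_prime // (_ : (q == p) = false) //; apply: contraNF pmP => /eqP <-.
Qed.

Lemma moebius_square p m : prime p -> (p %| m)%N -> moebius (p * m) = 0.
Proof.
move=> pp pm; case: m pm => [|m] pm; first by rewrite muln0.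
rewrite /moebius; case: ifP => // /andP[_ /allP /(_ p)].
rewrite mem_primes pp muln_gt0 prime_gt0 // dvdn_mulr //= => /(_ isT).
have p0 := prime_gt0 pp; rewrite lognM // logn_prime // eqxx add1n eqSS => /eqP E.
by have := logn_gt0 p m.+1; rewrite E mem_primes pp pm.
Qed.

(** For a prime p dividing s, the divisors p m with p dividing m contribute 0, and those with m
    prime to p cancel the divisors prime to p. *)
Lemma sum_moebius s : (0 < s)%N -> \sum_(n <- divisors s) moebius n = (s == 1%N)%:R.
Proof.
move=> s0; have [s1|s1] := leqP s 1.
  by rewrite (_ : s = 1%N); [rewrite big_seq1 | lia].
rewrite gtn_eqF //; have pp := pdiv_prime s1; move: (pdiv s) (pdiv_dvd s) pp => p ps pp.
have p0 := prime_gt0 pp; have sp0 : (0 < s %/ p)%N by rewrite divn_gt0 // dvdn_leq.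
rewrite (bigID (dvdn p)) /= -big_filter.
have perm1 : perm_eq [seq n <- divisors s | (p %| n)%N] [seq (p * m)%N | m <- divisors (s %/ p)].
  apply: uniq_perm; rewrite ?filter_uniq ?divisors_uniq //.
    rewrite map_inj_in_uniq ?divisors_uniq // => x y _ _ /eqP.
    by rewrite eqn_pmul2l // => /eqP.
  move=> n; rewrite mem_filter -dvdn_divisors //; apply/andP/mapP => [[/dvdnP [m ->]]|[m]].
    rewrite mulnC -[X in (_ %| X)%N](divnK ps) [X in (_ %| X)%N]mulnC dvdn_pmul2l // => ms.
    by exists m; rewrite -?dvdn_divisors // mulnC.
  rewrite -dvdn_divisors // => ms ->; rewrite dvdn_mulr // -[X in (_ %| X)%N](divnK ps).
  by rewrite [X in (_ %| X)%N]mulnC dvdn_pmul2l.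
rewrite (perm_big _ perm1) big_map (bigID (dvdn p)) /= big1 ?add0r => [|m pm]; last first.
  exact: moebius_square.
have perm2 : perm_eq [seq n <- divisors (s %/ p) | ~~ (p %| n)%N] [seq n <- divisors s | ~~ (p %| n)%N].
  apply: uniq_perm; rewrite ?filter_uniq ?divisors_uniq // => n.
  rewrite !mem_filter -!dvdn_divisors //; case pn: (p %| n)%N => //=.
  rewrite -[in RHS](divnK ps) mulnC Gauss_dvdr //.
  by rewrite coprime_sym prime_coprime // pn.
rewrite -big_filter (perm_big _ perm2) -[X in _ + X]big_filter /= -big_split big_seq big1 //= => n.
rewrite mem_filter -dvdn_divisors // => /andP[pn ns].
by rewrite moebius_coprime_mul ?addNr // (dvdn_gt0 s0).
Qed.

(** Both sides run over the chains n | s | g, with s = n r. *)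
Lemma exchange_divisors (V : nmodType) g (F : nat -> nat -> V) : (0 < g)%N ->
  \sum_(n <- divisors g) \sum_(r <- divisors (g %/ n)) F n (n * r)%N =
  \sum_(s <- divisors g) \sum_(n <- divisors s) F n s.
Proof.
move=> g0; rewrite big_seq.
rewrite (eq_bigr (fun n => \sum_(s <- divisors g | (n %| s)%N) F n s)) => [|n]; last first.
  rewrite -dvdn_divisors // => ng; rewrite -[RHS]big_filter; have n0 := dvdn_gt0 g0 ng.
  have gn0 : (0 < g %/ n)%N by rewrite divn_gt0 // dvdn_leq.
  rewrite -(big_map (muln n) xpredT (F n)); apply: perm_big.
  apply: uniq_perm; rewrite ?filter_uniq ?divisors_uniq //.
    rewrite map_inj_in_uniq ?divisors_uniq // => x y _ _ /eqP.
    by rewrite eqn_pmul2l // => /eqP.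
  move=> s; rewrite mem_filter -dvdn_divisors //; apply/mapP/andP => [[r]|[/dvdnP [r ->]]].
    rewrite -dvdn_divisors // => rg ->; rewrite dvdn_mulr //; split=> //.
    by rewrite -[X in (_ %| X)%N](divnK ng) [X in (_ %| X)%N]mulnC dvdn_pmul2l.
  rewrite mulnC -[X in (_ %| X)%N](divnK ng) [X in (_ %| X)%N]mulnC dvdn_pmul2l // => rg.
  by exists r; rewrite -?dvdn_divisors.
rewrite -big_seq (exchange_big_dep xpredT) //= big_seq [RHS]big_seq; apply: eq_bigr => s.
rewrite -dvdn_divisors // => sg; have s0 := dvdn_gt0 g0 sg.
rewrite -[LHS]big_filter; apply: perm_big; apply: uniq_perm; rewrite ?filter_uniq ?divisors_uniq // => n.
rewrite mem_filter -!dvdn_divisors //; case ns: (n %| s)%N => //=.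
exact: dvdn_trans ns sg.
Qed.

(** After substituting h, the weights 1/n^2 and 1/r^2 combine into 1/s^2 with s = n r, free of n, so
    the sum of [moebius] over n | s leaves only s = 1. *)
Lemma moebius_inversion_gcd (F : fieldType) (f h : nat -> nat -> F) :
  (forall k m, (0 < m)%N ->
     h k m = \sum_(r <- divisors (gcdn k m)) f (k %/ r)%N (m %/ r)%N / r%:R ^+ 2) ->
  forall k m, (0 < m)%N ->
  f k m = \sum_(n <- divisors (gcdn k m)) (moebius n)%:~R / n%:R ^+ 2 * h (k %/ n)%N (m %/ n)%N.
Proof.
move=> hE k m m0; set g := gcdn k m; have g0 : (0 < g)%N by rewrite gcdn_gt0 m0 orbT.
rewrite big_seq (eq_bigr (fun n => \sum_(r <- divisors (g %/ n))
   (moebius n)%:~R * (f (k %/ (n * r))%N (m %/ (n * r))%N / (n * r)%:R ^+ 2))) => [|n]; last first.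
  rewrite -dvdn_divisors // => ng; have n0 := dvdn_gt0 g0 ng.
  have := ng; rewrite dvdn_gcd => /andP[nk nm].
  rewrite hE ?divn_gt0 ?(dvdn_leq m0) // mulr_sumr.
  have -> : gcdn (k %/ n) (m %/ n) = (g %/ n)%N.
    by apply/eqP; rewrite eqn_div // mulnC muln_gcdr !(mulnC n) !divnK.
  apply: eq_bigr => r _; rewrite !divnMA natrM exprMn [in RHS]invfM.
  by move: (n%:R ^- 2) (r%:R ^- 2) (f _ _) (_%:~R) => x y z t; ring.
rewrite -big_seq (@exchange_divisors _ g (fun n s => (moebius n)%:~R * (f (k %/ s)%N (m %/ s)%N / s%:R ^+ 2))) //.
rewrite big_seq (eq_bigr (fun s => (s == 1%N)%:R * f (k %/ s)%N (m %/ s)%N)) => [|s]; last first.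
  rewrite -dvdn_divisors // => sg; have s0 := dvdn_gt0 g0 sg.
  rewrite -mulr_suml -rmorph_sum /= sum_moebius //.
  by case: eqP => [->|_]; rewrite ?mul0r // !mul1r expr1n divr1.
rewrite -big_seq (bigD1_seq 1%N) ?divisors_uniq -?dvdn_divisors ?dvd1n //=.
rewrite !divn1 mul1r big1 ?addr0 // => s /negbTE ->; by rewrite mul0r.
Qed.

End Moebius.

(** * Expansion in logarithms *)

Section LogExpansion.

(** The summand n = 1 of the formula; for N > 0 it is the opposite of [Psi01 a K N]. *)
Definition disk_count (a : int) (K N : nat) : algC :=
  (-1) ^+ K * ((\prod_(1 <= j < N) (N%:Z * a + j%:Z + K%:Z)%:~R) / N%:R *
    inv_fact K%:Z * inv_fact (N%:Z - K%:Z)).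

(** For k > n both sides are 0, which is what the convention 1/r! = 0 for r < 0 provides. *)
Lemma inv_fact_bin n k : 'C(n, k)%:R / n`!%:R = inv_fact k%:Z * inv_fact (n%:Z - k%:Z).
Proof.
have [kn|nk] := leqP k n; last first.
  rewrite bin_small // mul0r (_ : n%:Z - k%:Z = Negz (k - n).-1) ?mulr0 //; lia.
rewrite subzn //= -(bin_fact kn) !natrM.
by rewrite [in LHS]invfM mulrA mulfV ?mul1r ?invfM // pnatr_eq0 -lt0n bin_gt0.
Qed.

Lemma xdPsi01E a K N : xdPsi01 a K N = - N%:R * disk_count a K N.
Proof.
case: N => [|n]; first by rewrite /xdPsi01 oppr0 !mul0r.
rewrite /xdPsi01 /Psi01 /= /one_point_genus mulr0 sub0r one_point_laurent /disk_count.
rewrite -!mulrA -inv_fact_bin big_add1 big_mkord.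
have -> : \prod_(l < n) (a * n.+1 + K + l.+1)%:~R = \prod_(i < n) (n.+1%:Z * a + i.+1%:Z + K%:Z)%:~R :> algC.
  by apply: eq_bigr => l _; congr (_%:~R); ring.
by rewrite invfM; ring.
Qed.

(** The logarithm with indices (k, m) reaches (K, N) with coefficient -1/r exactly when (K, N) = r
    (k, m). So r runs over the common divisors, and m / r = N / r^2 is the origin of the square. *)
Lemma log_expansion_gcd a d K N : log_expansion a d -> (0 < N)%N ->
  disk_count a K N = \sum_(r <- divisors (gcdn K N)) d (K %/ r)%N (N %/ r)%N / r%:R ^+ 2.
Proof.
move=> hd N0; have Nn0 : - N%:R != 0 :> algC by rewrite oppr_eq0 pnatr_eq0 -lt0n.
have g0 : (0 < gcdn K N)%N by rewrite gcdn_gt0 N0 orbT.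
apply: (mulfI Nn0); rewrite -xdPsi01E hd.
rewrite mulr_sumr.
transitivity (\sum_(1 <= r < N.+1) \sum_(k < K.+1 | (k * r == K)%N) \sum_(1 <= m < N.+1 | (m * r == N)%N)
   (- (m%:R * d k m / r%:R))).
  under eq_bigr => k _ do under eq_bigr => m _ do rewrite /log_coef mulrN mulr_sumr -sumrN big_mkcond /=.
  under eq_bigr => k _ do rewrite exchange_big /=.
  rewrite exchange_big /=; apply: eq_bigr => r _; rewrite [RHS]big_mkcond; apply: eq_bigr => k _.
  case: eqP => /= _; last by rewrite big1.
  by rewrite [RHS]big_mkcond.
have perm : perm_eq (divisors (gcdn K N)) [seq r <- index_iota 1 N.+1 | (r %| K)%N && (r %| N)%N].
  apply: uniq_perm; rewrite ?filter_uniq ?divisors_uniq ?iota_uniq // => r.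
  rewrite mem_filter -dvdn_divisors // dvdn_gcd mem_index_iota; case: andP => //= -[_ rN].
  by rewrite ltnS (dvdn_leq N0 rN) (dvdn_gt0 N0 rN).
rewrite (perm_big _ perm) big_filter [RHS]big_mkcond big_nat [RHS]big_nat; apply: eq_bigr => r /andP[r0 rN].
have mulE x y : (x * r == y)%N = (r %| y)%N && (x == y %/ r)%N.
  apply/eqP/andP => [<-|[ry /eqP ->]]; last by rewrite divnK.
  by rewrite dvdn_mull // mulnK.
case rK : (r %| K)%N => /=; last first.
  by rewrite big1 // => k; rewrite mulE // rK.
have Kr : (K %/ r < K.+1)%N by rewrite ltnS leq_div.
rewrite (big_pred1 (Ordinal Kr)) => [|k]; last by rewrite mulE // rK.
rewrite /=; case rN' : (r %| N)%N; last by rewrite big1 // => m; rewrite mulE // rN'.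
rewrite (eq_bigl (fun m => m == N %/ r)%N) => [|m]; last by rewrite mulE // rN'.
rewrite big_nat1_eq divn_gt0 // (dvdn_leq N0 rN') ltnS leq_div /=.
have -> : N%:R = (N %/ r)%:R * r%:R :> algC by rewrite -natrM divnK.
have : r%:R != 0 :> algC by rewrite pnatr_eq0 -lt0n.
by move: (r%:R : algC) ((N %/ r)%:R : algC) (d _ _) => x y z x0; field.
Qed.

End LogExpansion.

Theorem mainTheorem9 (a : int) (ha : a != -1) (d : nat -> nat -> algC)
    (hd : log_expansion a d) (k m : nat) (hm : (1 <= m)%N) :
  d k m =
  \sum_(n <- divisors (gcdn k m))
     (moebius n)%:~R / n%:R ^+ 2 * (-1) ^+ (k %/ n)%N *
     ((\prod_(1 <= j < (m %/ n)%N)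
         ((m %/ n)%:Z * a + j%:Z + (k %/ n)%:Z)%:~R) /
      (m %/ n)%:R *
      inv_fact (k %/ n)%:Z * inv_fact ((m %/ n)%:Z - (k %/ n)%:Z)).
Proof.
rewrite (moebius_inversion_gcd (h := disk_count a)) // => [|K N N0].
  by apply: eq_bigr => n _; rewrite /disk_count [LHS]mulrA.
exact: log_expansion_gcd hd N0.
Qed.
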